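(* Let $f\in\mathbb{C}\{x_1,\ldots,x_n\}$ and $g\in\mathbb{C}\{y_1,\ldots,y_m\}$ be the equations of non-smooth normal crossing divisors. Let $(X,0)=(V(f+g),0)\subseteq(\mathbb{C}^{n+m},0)$. Then $(X,0)$ is not free, whereas $(\mathrm{Sing}(X),0)$ is free.
   Context: All spaces are germs at the origin: $\mathbb{C}^N$ means $(\mathbb{C}^N,0)$, with ring $S=\mathbb{C}\{z_1,\ldots,z_N\}$ of convergent power series. A normal crossing divisor germ is one which, in suitable analytic coordinates $z_1,\ldots,z_N$ centred at $0$, is the reduced divisor $\{z_1\cdots z_p=0\}$ for some $1\leqslant p\leqslant N$; it is non-smooth if $p\geqslant2$. $\mathrm{Sing}(X)$ is the singular locus of $X$, considered with its reduced structure. $\mathrm{Der}_{\mathbb{C}^N}$ is the $S$-module of vector fields, free with basis $\partial_{z_1},\ldots,\partial_{z_N}$; $\Omega^q_{\mathbb{C}^N}$ is the $S$-module of differential $q$-forms; $\langle\cdot,\cdot\rangle:\bigwedge^q\mathrm{Der}_{\mathbb{C}^N}\times\Omega^q_{\mathbb{C}^N}\to S$ is the usual pairing. For an equidimensional subspace $Z\subseteq\mathbb{C}^N$ of codimension $k$ defined by the radical ideal $I_Z\subseteq S$, the module of multi-logarithmic $k$-vector fields along $Z$ is $$\mathrm{Der}^k(-\log Z)=\left\{\delta\in\bigwedge^k\mathrm{Der}_{\mathbb{C}^N}\ \middle|\ \forall f_1,\ldots,f_k\in I_Z,\ \langle\delta,df_1\wedge\dots\wedge df_k\rangle\in I_Z\right\}.$$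 An equidimensional reduced subspace $Z\subseteq\mathbb{C}^N$ of codimension $k\geqslant 1$ is called free if the projective dimension of the $S$-module $\mathrm{Der}^k(-\log Z)$ equals $k-1$. (For a reduced hypersurface, $k=1$, this says that $\mathrm{Der}^1(-\log Z)$ is a free $S$-module.) *)

(* Defs.v *)
From HB Require Import structures.
From mathcomp Require Import all_boot all_order all_algebra.
From mathcomp Require Import complex boolp reals.
From mathcomp Require Import mpoly.

Set Implicit Arguments.
Unset Strict Implicit.
Unset Printing Implicit Defensive.

Import Order.TTheory GRing.Theory Num.Theory.

Local Open Scope ring_scope.

Record fps (n : nat) (K : Type) : Type := FPS { fps_coef :> 'X_{1..n} -> K }.

HB.instance Definition _ n K := gen_eqMixin (fps n K).
HB.instance Definition _ n K := gen_choiceMixin (fps n K).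

Section FormalPowerSeries.
Variables (n : nat) (K : comNzRingType).
Implicit Types (f g h : fps n K) (a b : 'X_{1..n}).

Definition fps0 : fps n K := FPS (fun _ => 0).
Definition fps_opp f : fps n K := FPS (fun a => - f a).
Definition fps_add f g : fps n K := FPS (fun a => f a + g a).
Definition fps1 : fps n K := FPS (fun a => (a == 0%MM)%:R).

(* The sum over all b + c = a: as b and c range over multi-indices of degree
   at most |a|, the sum is finite and nothing is lost. *)
Definition fps_mul f g : fps n K := FPS (fun a =>
  \sum_(k : 'X_{1..n < (mdeg a).+1, (mdeg a).+1} | a == (k.1 + k.2)%MM)
     f k.1 * g k.2).

Let fpsP f g : (forall a, f a = g a) -> f = g.
Proof. by case: f g => [f] [g] fg; congr FPS; apply/funext. Qed.

Let addA : associative fps_add.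
Proof. by move=> f g h; apply: fpsP => a /=; rewrite addrA. Qed.
Let addC : commutative fps_add.
Proof. by move=> f g; apply: fpsP => a /=; rewrite addrC. Qed.
Let add0 : left_id fps0 fps_add.
Proof. by move=> f; apply: fpsP => a /=; rewrite add0r. Qed.
Let addN : left_inverse fps0 fps_opp fps_add.
Proof. by move=> f; apply: fpsP => a /=; rewrite addNr. Qed.

HB.instance Definition _ := GRing.isZmodule.Build (fps n K) addA addC add0 addN.

Definition fps_trunc (d : nat) f : {mpoly K[n]} :=
  \sum_(k : 'X_{1..n < d}) f k *: 'X_[k].

Lemma fps_truncE d f a : (mdeg a < d)%N -> (fps_trunc d f)@_a = f a.
Proof.
move=> ad; rewrite /fps_trunc raddf_sum /= (bigD1 (BMultinom ad)) //=.
rewrite mcoeffZ mcoeffX eqxx mulr1 big1 ?addr0 // => k kN.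
by rewrite bmeqP /= in kN; rewrite mcoeffZ mcoeffX (negPf kN) mulr0.
Qed.

Lemma fps_mulE d f g a : (mdeg a < d)%N ->
  fps_mul f g a = (fps_trunc d f * fps_trunc d g)@_a.
Proof.
move=> ad; rewrite (mcoeff_poly_mul _ _ (ltnSn (mdeg a))).
apply: eq_bigr => k _; have kd (b : 'X_{1..n < (mdeg a).+1}) : (mdeg b < d)%N.
  exact: leq_trans (bmdeg b) ad.
by rewrite !fps_truncE.
Qed.

Let mulE_gen d (p q p' q' : {mpoly K[n]}) a : (mdeg a < d)%N ->
  (forall b, (mdeg b < d)%N -> p@_b = p'@_b) ->
  (forall b, (mdeg b < d)%N -> q@_b = q'@_b) ->
  (p * q)@_a = (p' * q')@_a.
Proof.
move=> ad pp qq; rewrite !(mcoeff_poly_mul _ _ ad).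
by apply: eq_bigr => k _; rewrite pp ?bmdeg// qq ?bmdeg.
Qed.

Let trunc_mul d f g b : (mdeg b < d)%N ->
  (fps_trunc d (fps_mul f g))@_b = (fps_trunc d f * fps_trunc d g)@_b.
Proof. by move=> bd; rewrite fps_truncE // (fps_mulE _ _ bd). Qed.

Let mulA : associative fps_mul.
Proof.
move=> f g h; apply: fpsP => a; have ad := ltnSn (mdeg a).
rewrite !(fps_mulE _ _ ad).
rewrite (mulE_gen (p' := fps_trunc (mdeg a).+1 f)
  (q' := fps_trunc (mdeg a).+1 g * fps_trunc (mdeg a).+1 h) ad) //;
  last exact: trunc_mul.
rewrite mulrA; apply: esym; apply: (mulE_gen ad) => // b; exact: trunc_mul.
Qed.

Let mulC : commutative fps_mul.
Proof.
move=> f g; apply: fpsP => a; have ad := ltnSn (mdeg a).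
by rewrite !(fps_mulE _ _ ad) mulrC.
Qed.

Let mul1 : left_id fps1 fps_mul.
Proof.
move=> f; apply: fpsP => a; have ad := ltnSn (mdeg a).
rewrite (fps_mulE _ _ ad) -[RHS](fps_truncE f ad) -[in RHS](mul1r (fps_trunc _ _)).
apply: (mulE_gen ad) => // b bd.
by rewrite fps_truncE // mcoeff1.
Qed.

Let mulD : left_distributive fps_mul fps_add.
Proof.
move=> f g h; apply: fpsP => a; rewrite /= -big_split /=.
by apply: eq_bigr => k _; rewrite mulrDl.
Qed.

Let one_neq0 : fps1 != 0.
Proof.
apply/eqP => /(congr1 (fun f : fps n K => f 0%MM)).
by rewrite /= eqxx => /eqP; rewrite oner_eq0.
Qed.

HB.instance Definition _ := GRing.Zmodule_isComNzRing.Build (fps n K)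
  mulA mulC mul1 mulD one_neq0.

Definition fps_deriv (i : 'I_n) f : fps n K :=
  FPS (fun a => f (a + U_(i))%MM *+ (a i).+1).

End FormalPowerSeries.

(* The image of f under the substitution of the variables x_(h i) for x_i.
   Only meant for injective h. *)
Definition fps_embed (n N : nat) (K : comNzRingType) (h : 'I_n -> 'I_N)
    (f : fps n K) : fps N K :=
  FPS (fun a => if [forall j, (j \notin codom h) ==> (a j == 0%N)]
           then f [multinom a (h i) | i < n] else 0).

Section Convergent.
Variable K : numFieldType.

(* Absolute summability of sum_a f_a r^|a| on some polydisc of radius r > 0,
   i.e. boundedness of its partial sums (in R[i], 0 < r forces r to be a real
   number). *)
Definition convergent (n : nat) (f : fps n K) : Prop :=
  exists r M : K, 0 < r /\
    forall d, \sum_(k : 'X_{1..n < d}) `|f k| * r ^+ mdeg k <= M.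

Lemma convergent_shrink n (f : fps n K) (r M r' : K) :
  0 < r' -> r' <= r ->
  (forall d, \sum_(k : 'X_{1..n < d}) `|f k| * r ^+ mdeg k <= M) ->
  forall d, \sum_(k : 'X_{1..n < d}) `|f k| * r' ^+ mdeg k <= M.
Proof.
move=> r0 rr H d; apply: le_trans (H d); apply: ler_sum => k _.
rewrite ler_wpM2l //; apply: lerXn2r => //; rewrite nnegrE ?ltW //.
exact: lt_le_trans rr.
Qed.

Lemma convergent2 n (f g : fps n K) : convergent f -> convergent g ->
  exists r M M' : K, [/\ 0 < r,
    forall d, \sum_(k : 'X_{1..n < d}) `|f k| * r ^+ mdeg k <= M &
    forall d, \sum_(k : 'X_{1..n < d}) `|g k| * r ^+ mdeg k <= M'].
Proof.
move=> [r [M [r0 Hf]]] [s [M' [s0 Hg]]].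
have rs : r * s / (r + s) <= r.
  by rewrite ler_pdivrMr ?addr_gt0// ler_pM2l// lerDr ltW.
have sr : r * s / (r + s) <= s.
  by rewrite ler_pdivrMr ?addr_gt0// mulrC ler_pM2l// lerDl ltW.
have t0 : 0 < r * s / (r + s) by rewrite divr_gt0 ?mulr_gt0 ?addr_gt0.
exists (r * s / (r + s)), M, M'; split=> //.
- exact: convergent_shrink Hf.
- exact: convergent_shrink Hg.
Qed.

Definition convergent_pred (n : nat) : {pred fps n K} :=
  [pred f | `[< convergent f >]].

Lemma convergent_subring n : subring_closed (@convergent_pred n).
Proof.
split.
- apply/asboolP; exists 1, 1; split=> // d.
  case: d => [|d]; first by rewrite big1 // => k; have := bmdeg k.
  rewrite (bigD1 bm0) //= big1 ?addr0.
    by rewrite expr1n mulr1 /GRing.one /= /fps1 eqxx normr1.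
  move=> k; rewrite bmeqP /= => /negPf kN'.
  by rewrite /GRing.one /= /fps1 kN' normr0 mul0r.
- move=> f g /asboolP cf /asboolP cg; apply/asboolP.
  have [r [M [M' [r0 Hf Hg]]]] := convergent2 cf cg.
  exists r, (M + M'); split=> // d.
  apply: le_trans (lerD (Hf d) (Hg d)); rewrite -big_split /=.
  apply: ler_sum => k _; rewrite -mulrDl ler_wpM2r ?exprn_ge0 ?(ltW r0) //.
  exact: (ler_normB (f k) (g k)).
- move=> f g /asboolP cf /asboolP cg; apply/asboolP.
  have [r [M [M' [r0 Hf Hg]]]] := convergent2 cf cg.
  exists r, (M * M'); split=> // d.
  pose F (k : 'X_{1..n}) := `|f k| * r ^+ mdeg k.
  pose G (k : 'X_{1..n}) := `|g k| * r ^+ mdeg k.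
  have F0 k : 0 <= F k by rewrite mulr_ge0 ?exprn_ge0 ?(ltW r0).
  have G0 k : 0 <= G k by rewrite mulr_ge0 ?exprn_ge0 ?(ltW r0).
  apply: (@le_trans _ _ (\sum_(k : 'X_{1..n < d}) \sum_(l : 'X_{1..n < d, d})
      if (k : 'X_{1..n}) == (l.1 + l.2)%MM then F l.1 * G l.2 else 0)).
    apply: ler_sum => k _; have kd := bmdeg k.
    rewrite [X in `|X|](_ : _ = (fps_trunc d f * fps_trunc d g)@_k); last first.
      exact: fps_mulE.
    rewrite (mcoeff_poly_mul _ _ kd) -big_mkcond /=.
    apply: le_trans (ler_wpM2r _ (ler_norm_sum _ _ _)) _.
      by rewrite exprn_ge0 ?(ltW r0).
    rewrite mulr_suml; apply: ler_sum => l /eqP kl.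
    by rewrite !fps_truncE ?bmdeg// normrM kl mdegD exprD mulrACA.
  rewrite exchange_big /=.
  apply: (@le_trans _ _ (\sum_(l : 'X_{1..n < d, d}) F l.1 * G l.2)).
    apply: ler_sum => l _; rewrite -big_mkcond /=.
    have [ld|ld] := ltnP (mdeg (l.1 + l.2)%MM) d.
      rewrite (big_pred1 (BMultinom ld)) //.
    rewrite big_pred0 => [|k]; first exact: mulr_ge0 (F0 _) (G0 _).
    apply/negP => /eqP kl.
    by move: ld; rewrite -kl leqNgt bmdeg.
  rewrite -(pair_bigA _ (fun k l : 'X_{1..n < d} => F k * G l)) /=.
  under eq_bigr do rewrite -mulr_sumr.
  rewrite -mulr_suml; apply: ler_pM; rewrite ?sumr_ge0 //; [exact: Hf|exact: Hg].
Qed.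

HB.instance Definition _ n :=
  GRing.isSubringClosed.Build (fps n K) (@convergent_pred n)
    (convergent_subring n).

Lemma convergent_deriv n (i : 'I_n) (f : fps n K) :
  convergent f -> convergent (fps_deriv i f).
Proof.
move=> [r [M [r0 Hf]]]; exists (r / 2), (r^-1 * M); split; first by rewrite divr_gt0.
move=> d.
have sd (k : 'X_{1..n < d}) : (mdeg (k + U_(i))%MM < d.+1)%N.
  by rewrite mdegD mdeg1 addn1 ltnS bmdeg.
pose s k := BMultinom (sd k).
have sI : injective s.
  move=> k l /(congr1 (fun b : 'X_{1..n < d.+1} => (b : 'X_{1..n}))) /= skl.
  apply/val_inj => /=; apply: (@addmI _ U_(i)%MM).
  by rewrite addmC skl addmC.
have rI0 : 0 <= r^-1 by rewrite invr_ge0 ltW.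
apply: le_trans (ler_wpM2l rI0 (Hf d.+1)).
apply: (@le_trans _ _ (r^-1 * \sum_(k in s @: [set: 'X_{1..n < d}])
                                `|f k| * r ^+ mdeg k)); last first.
  rewrite ler_wpM2l // [leRHS](bigID (mem (s @: [set: 'X_{1..n < d}]))) /= lerDl.
  by rewrite sumr_ge0 // => k _; rewrite mulr_ge0 ?exprn_ge0 ?(ltW r0).
rewrite big_imset /=; last by move=> k l _ _; apply: sI.
rewrite mulr_sumr [leRHS](eq_bigl xpredT) => [|k]; last by rewrite inE.
apply: ler_sum => k _; rewrite /fps_deriv normrMn mdegD mdeg1 addn1 exprSr.
rewrite mulrCA [r^-1 * _]mulrC mulfK ?gt_eqF// mulrnAl -mulrnAr.
rewrite ler_wpM2l // expr_div_n -mulrnAr ler_piMr ?exprn_ge0 ?(ltW r0)//.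
rewrite -mulr_natl ler_pdivrMr ?exprn_gt0// mul1r -natrX ler_nat.
apply: leq_trans (ltn_expl (k i) (ltnSn 1)) _.
by rewrite leq_exp2l // mdegE (bigD1 i) //= leq_addr.
Qed.

Lemma convergent_embed n N (h : 'I_n -> 'I_N) (f : fps n K) :
  injective h -> convergent f -> convergent (fps_embed h f).
Proof.
move=> hI [r [M [r0 Hf]]]; exists r, M; split=> // d.
apply: le_trans (Hf d).
have mdegh (a : 'X_{1..N}) :
  mdeg a = (mdeg [multinom a (h i) | i < n] +
            \sum_(j | j \notin codom h) a j)%N.
  rewrite !mdegE (bigID (mem (codom h))) /=; congr addn.
  rewrite (eq_bigl (mem (h @: [set: 'I_n]))); last first.
    move=> j; apply/idP/imsetP => [/codomP[i ->]|[i _ ->]]; last exact: codom_f.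
    by exists i.
  rewrite big_imset /=; last by move=> i j _ _; apply: hI.
  rewrite (eq_bigl xpredT) => [|i]; last by rewrite inE.
  by apply: eq_bigr => i _; rewrite mnmE.
have qd (a : 'X_{1..N < d}) : (mdeg [multinom a (h i) | i < n] < d)%N.
  by apply: leq_ltn_trans (bmdeg a); rewrite (mdegh a) leq_addr.
pose q a := BMultinom (qd a).
pose A := [set a : 'X_{1..N < d} |
            [forall j, (j \notin codom h) ==> (a j == 0%N)]].
have qI : {in A &, injective q}.
  move=> a b; rewrite !inE => /forallP a0 /forallP b0.
  move=> /(congr1 (fun c : 'X_{1..n < d} => (c : 'X_{1..n}))) /= /mnmP qab.
  apply/val_inj/mnmP => j /=; have [/codomP[i ->]|jh] := boolP (j \in codom h).
    by have := qab i; rewrite !mnmE.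
  by have := a0 j; have := b0 j; rewrite jh /= => /eqP -> /eqP ->.
rewrite [leRHS](bigID (mem (q @: A))) /= big_imset //= -[leLHS]addr0.
apply: lerD; last first.
  by rewrite sumr_ge0 // => k _; rewrite mulr_ge0 ?exprn_ge0 ?(ltW r0).
rewrite [leRHS]big_mkcond /=; apply: ler_sum => a _.
rewrite inE /fps_embed; case: ifPn => [a0|_]; last by rewrite normr0 mul0r.
suff -> : mdeg a = mdeg [multinom a (h i) | i < n] by [].
rewrite (mdegh a) big1 ?addn0 // => j jh.
by move/forallP: a0 => /(_ j); rewrite jh /= => /eqP.
Qed.

End Convergent.

(* cps n K is the ring K{x_1, ..., x_n}. *)
Record cps (n : nat) (K : numFieldType) : Type := CPS {
  cps_coef :> fps n K ;
  _ : cps_coef \in @convergent_pred K n }.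

HB.instance Definition _ n K := [isSub for @cps_coef n K].
HB.instance Definition _ n K := [Choice of cps n K by <:].
HB.instance Definition _ n K := [SubChoice_isSubComNzRing of cps n K by <:].

Section ConvergentOps.
Variables (K : numFieldType) (n : nat).
Implicit Type f : cps n K.

Lemma cps_convergent f : convergent f.
Proof. exact/asboolP/(valP f). Qed.

Definition pderiv (i : 'I_n) f : cps n K :=
  CPS (asboolT (convergent_deriv i (cps_convergent f))).

Definition cps_embed (N : nat) (h : 'I_n -> 'I_N) (hI : injective h) f :
    cps N K :=
  CPS (asboolT (convergent_embed hI (cps_convergent f))).

End ConvergentOps.

(* Possibly equal to the whole ring, unlike idealr_closed of ring_quotient. *)
Record ideal (S : comNzRingType) : Type := Ideal {
  ideal_pred :> {pred S} ;
  idealP : submod_closed (ideal_pred : {pred S^o}) }.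

Section Ideals.
Variable S : comNzRingType.
Implicit Types (I J P Q : ideal S) (A : S -> Prop) (a x y : S).

Lemma ideal0 I : 0 \in I.
Proof. by case: (idealP I). Qed.

Lemma idealZD I a x y : x \in I -> y \in I -> a * x + y \in I.
Proof. by move=> xI yI; case: (idealP I) => _ IZD; exact: IZD. Qed.

Lemma idealD I x y : x \in I -> y \in I -> x + y \in I.
Proof. by move=> xI yI; rewrite -[x]mul1r; apply: idealZD. Qed.

Lemma idealMl I a x : x \in I -> a * x \in I.
Proof. by move=> xI; rewrite -[_ * _]addr0; apply: idealZD => //; apply: ideal0. Qed.

Lemma ideal_sum (T : Type) (r : seq T) (p : pred T) (F : T -> S) I :
  (forall i, p i -> F i \in I) -> \sum_(i <- r | p i) F i \in I.
Proof. by move=> FI; apply: (big_ind (fun x => x \in I)) FI => [|x y]; [apply: ideal0|apply: idealD]. Qed.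

(* The smallest ideal containing A. *)
Definition ideal_gen_pred A : {pred S} :=
  [pred x | `[< forall J, (forall a, A a -> a \in J) -> x \in J >]].

Lemma ideal_gen_closed A : submod_closed (ideal_gen_pred A : {pred S^o}).
Proof.
split=> [|a x y /asboolP xA /asboolP yA].
  by apply/asboolP => J _; apply: ideal0.
by apply/asboolP => J AJ; exact: (idealZD a (xA J AJ) (yA J AJ)).
Qed.

Definition ideal_gen A : ideal S := Ideal (ideal_gen_closed A).

Definition principal a : ideal S := ideal_gen (fun x => x = a).

Definition radical_pred I : {pred S} := [pred x | `[< exists n, x ^+ n \in I >]].

Lemma radical_closed I : submod_closed (radical_pred I : {pred S^o}).
Proof.
split=> [|a x y /asboolP[i xI] /asboolP[j yI]]; apply/asboolP.
  by exists 1%N; rewrite expr1; apply: ideal0.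
exists (i + j)%N; rewrite exprDn; apply: ideal_sum => k _.
rewrite -mulr_natl; apply: idealMl; have [jk|kj] := leqP j k.
  by rewrite -(subnK jk) exprD mulrA; apply: idealMl.
rewrite mulrC; apply: idealMl; rewrite exprMn; apply: idealMl.
have ik : (i <= i + j - k)%N by rewrite -addnBA ?leq_addr // ltnW.
by rewrite -(subnK ik) exprD; apply: idealMl.
Qed.

Definition radical I : ideal S := Ideal (radical_closed I).

Definition radical_ideal I : Prop := {subset radical I <= I}.

Definition prime_ideal P : Prop := 1 \notin P /\ prime_idealr_closed P.

Definition minimal_prime I P : Prop :=
  [/\ prime_ideal P, {subset I <= P} &
      forall Q, prime_ideal Q -> {subset I <= Q} -> {subset Q <= P} ->
        {subset P <= Q}].

(* There is a chain of prime ideals Q_0 < ... < Q_k = P. *)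
Fixpoint height_ge P (k : nat) : Prop :=
  if k is k'.+1 then
    exists Q, [/\ prime_ideal Q, {subset Q <= P}, ~ {subset P <= Q} &
                  height_ge Q k']
  else True.

Definition height P (k : nat) : Prop := height_ge P k /\ ~ height_ge P k.+1.

(* I is the radical ideal of a nonempty reduced subspace all of whose
   irreducible components have codimension k. The components correspond to
   the minimal primes over I, and their codimensions are the heights of these
   primes. *)
Definition reduced_equidim I (k : nat) : Prop :=
  [/\ 1 \notin I, radical_ideal I & forall P, minimal_prime I P -> height P k].

End Ideals.

Section ProjectiveDimension.
Variable S : comNzRingType.

Definition projective (P : lmodType S) : Prop :=
  forall (M N : lmodType S) (p : {linear M -> N}) (h : {linear P -> N}),
    (forall y, exists x, p x = y) ->
    exists l : {linear P -> M}, forall x, p (l x) = h x.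

(* M has a projective resolution 0 -> P_d -> ... -> P_0 -> M -> 0. *)
Definition projdim_le (M : lmodType S) (d : nat) : Prop :=
  exists (P : nat -> lmodType S) (e : {linear P 0 -> M})
         (del : forall i, {linear P i.+1 -> P i}),
    [/\ forall i, projective (P i),
        forall i, (d < i)%N -> forall x : P i, x = 0,
        forall y, exists x, e x = y,
        forall x, e x = 0 <-> exists y, del 0 y = x &
        forall i x, del i x = 0 <-> exists y, del i.+1 y = x].

Definition projdim (M : lmodType S) (d : nat) : Prop :=
  projdim_le M d /\ forall d', (d' < d)%N -> ~ projdim_le M d'.

End ProjectiveDimension.

(* Strictly increasing multi-indices i_1 < ... < i_k in {0, ..., N-1}. *)
Definition incr_index (N k : nat) : predArgType :=
  {t : k.-tuple 'I_N | sorted ltn [seq val i | i <- t]}.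

Section Freeness.
Variables (K : numFieldType) (N : nat).
Local Notation S := (cps N K).

(* Elements of the k-th exterior power of Der, by their coordinates on the
   basis of the d/dz_(i_1) /\ ... /\ d/dz_(i_k), i_1 < ... < i_k. *)
Definition mvfield (k : nat) : Type := {ffun incr_index N k -> S^o}.
HB.instance Definition _ k := GRing.Lmodule.on (mvfield k).

(* Differential k-forms, by their coordinates on the basis of the
   dz_(i_1) /\ ... /\ dz_(i_k), i_1 < ... < i_k. *)
Definition dform (k : nat) : Type := {ffun incr_index N k -> S^o}.
HB.instance Definition _ k := GRing.Lmodule.on (dform k).

(* The two bases above are dual to each other. *)
Definition pairing k (delta : mvfield k) (omega : dform k) : S :=
  \sum_i delta i * omega i.

(* The coordinates of df_1 /\ ... /\ df_k are the k-minors of the Jacobian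
   matrix of f. *)
Definition wedge_d k (f : 'I_k -> S) : dform k :=
  [ffun i : incr_index N k =>
     \det (\matrix_(a < k, b < k) pderiv (tnth (val i) b) (f a))].

Definition derlog_pred k (I : ideal S) : {pred mvfield k} :=
  [pred delta | `[< forall f : 'I_k -> S, (forall a, f a \in I) ->
                      pairing delta (wedge_d f) \in I >]].

Lemma derlog_closed k (I : ideal S) : submod_closed (@derlog_pred k I).
Proof.
split=> [|a x y /asboolP xI /asboolP yI]; apply/asboolP => f fI.
  by rewrite /pairing big1 ?ideal0 // => i _; rewrite ffunE mul0r.
rewrite /pairing (_ : \sum_i _ = a * pairing x (wedge_d f) +
                                 pairing y (wedge_d f)).
  by apply: idealZD; [apply: xI|apply: yI].
rewrite /pairing mulr_sumr -big_split /=; apply: eq_bigr => i _.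
by rewrite !ffunE mulrDl mulrA.
Qed.

HB.instance Definition _ k (I : ideal S) :=
  GRing.isSubmodClosed.Build S (mvfield k) (@derlog_pred k I)
    (derlog_closed k I).

(* Der^k(-log Z) for the subspace Z defined by I, as an S-module *)
Record derlog (k : nat) (I : ideal S) : Type := Derlog {
  derlog_val :> mvfield k ;
  _ : derlog_val \in @derlog_pred k I }.

HB.instance Definition _ k I := [isSub for @derlog_val k I].
HB.instance Definition _ k I := [Choice of derlog k I by <:].
HB.instance Definition _ k I := [SubChoice_isSubLmodule of derlog k I by <:].

Definition free_germ (I : ideal S) : Prop :=
  exists2 k : nat, (0 < k)%N &
    reduced_equidim I k /\ projdim (derlog k I) k.-1.

(* The radical ideal of the singular locus of the reduced equidimensional
   germ of codimension k defined by I: by the Jacobian criterion, a point is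
   singular when all the k-minors of the Jacobian matrices of k-tuples of
   elements of I vanish there. *)
Definition sing (k : nat) (I : ideal S) : ideal S :=
  radical (ideal_gen (fun x => x \in I \/
    exists (f : 'I_k -> S) (i : incr_index N k),
      (forall a, f a \in I) /\ x = wedge_d f i)).

(* Analytic coordinates centred at the origin: by the inverse function theorem,
   z is a local biholomorphism at 0 iff its Jacobian determinant at 0 is
   nonzero. *)
Definition coordinates (z : 'I_N -> S) : Prop :=
  (forall i, z i 0%MM = 0) /\
  \det (\matrix_(i < N, j < N) (pderiv j (z i)) 0%MM) != 0.

(* f generates the ideal of the reduced divisor {z_1 ... z_p = 0}, for suitable
   coordinates z (z_1 is z 0). *)
Definition normal_crossing (f : S) (p : nat) : Prop :=
  (1 <= p <= N)%N /\
  exists2 z : 'I_N -> S, coordinates z &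
    principal f =i principal (\prod_(i < N | (i < p)%N) z i).

Definition nonsmooth_normal_crossing (f : S) : Prop :=
  exists2 p, (2 <= p)%N & normal_crossing f p.

End Freeness.

(* Main.v *)
(** In suitable coordinates Z of C^(n+m), after absorbing units, the equation is
    h = prod_(i in A) Z_i + prod_(j in B) Z_j with A and B disjoint, |A|, |B| >= 2.

    h is prime: the substitution Z_a -> Z_a prod_(B - b) Z, Z_b -> - prod_A Z
    (a in A, b in B) kills h and is injective on the series without monomials
    divisible by prod_A Z, which represent every class modulo h.

    V(h) is not free: an Euler field splits off Der(-log h), and the other
    summand is the kernel of S^N -> S, delta |-> delta(h).  Its image J contains a
    regular sequence of length 3, so Ext^1(J, S) = 0: linear forms on the kernel
    extend to S^N.  If the kernel were projective it would then be a summand of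
    S^N, so that J would be projective, hence the unit ideal.

    Sing(V(h)) is the union of the linear spaces Z_T = 0 over the T consisting of
    two elements of A and two of B.  Pairing with dZ_T identifies its module of
    multi-logarithmic 4-vector fields with a direct sum of one ideal (Z_i, i in T)
    for each such T and of copies of S; the Koszul complexes show that its
    projective dimension is 3.  That the components have codimension exactly 4
    follows from dim C{z_1, ..., z_N} <= N, proved by induction on N through
    Weierstrass division and the incomparability of primes in integral
    extensions. *)

Require Import Defs.
From HB Require Import structures.
From mathcomp Require Import all_boot all_order all_algebra.
From mathcomp Require Import complex boolp reals.
From mathcomp Require Import mpoly.
From mathcomp Require Import fingroup perm.
From mathcomp Require Import ring zify.
From mathcomp Require finmap monalg.

Set Implicit Arguments.
Unset Strict Implicit.
Unset Printing Implicit Defensive.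

Import Order.TTheory GRing.Theory Num.Theory.

Local Open Scope ring_scope.


(** * Convergent power series *)

(** Projectivity and resolutions range over arbitrary modules, without finiteness. A dual basis of
    Der(-log h) may therefore be infinite; it becomes finite on the kernel because a fixed nonzero
    element of J, times any element of the kernel, is a combination of finitely many Koszul
    relations. The regular sequence in J consists of one partial derivative along A, the sum of all
    partial derivatives along A, and one partial derivative along B: two partial derivatives along A
    share factors as soon as A has three elements, hence the sum.

    Convergence is controlled by the norms sum |f_k| s^(w.k) with variable weights w. For suitable
    weights a chosen monomial becomes the lightest one of a series, and division by that series is a
    contraction for small s. This one argument yields inverses of units, normal forms modulo h and
    Weierstrass division.

    The projective dimension 3 of the second module cannot drop: a contraction of the top of the
    resolution would put 1 into the ideal (Z_i, i in T). *)

Section Coefficients.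
Variables (K : numFieldType) (n : nat).
Implicit Types (f g h : cps n K) (a b : 'X_{1..n}).

Lemma cpsP f g : (forall a, f a = g a) -> f = g.
Proof.
move=> fg; apply: val_inj => /=; case: (cps_coef f) (cps_coef g) fg => [u] [v] /= uv.
by congr FPS; apply/funext.
Qed.

Lemma cps0E a : (0 : cps n K) a = 0. Proof. by []. Qed.
Lemma cps1E a : (1 : cps n K) a = (a == 0%MM)%:R. Proof. by []. Qed.
Lemma cpsDE f g a : (f + g) a = f a + g a. Proof. by []. Qed.
Lemma cpsNE f a : (- f) a = - f a. Proof. by []. Qed.
Lemma cpsBE f g a : (f - g) a = f a - g a. Proof. by []. Qed.

Lemma cps_sumE (I : Type) (r : seq I) (P : pred I) (F : I -> cps n K) a :
  (\sum_(i <- r | P i) F i) a = \sum_(i <- r | P i) F i a.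
Proof. exact: (big_morph (fun f : cps n K => f a)). Qed.

Lemma cpsME d f g a : (mdeg a < d)%N ->
  (f * g) a = \sum_(k : 'X_{1..n < d}) \sum_(l : 'X_{1..n < d} | a == (k + l)%MM)
     f k * g l.
Proof.
move=> ad; have -> : (f * g) a = fps_mul f g a by [].
rewrite (fps_mulE _ _ ad) (mcoeff_poly_mul _ _ ad) pair_big_dep /=.
by apply: eq_bigr => k _; rewrite !fps_truncE ?bmdeg.
Qed.

Lemma cpsM_neq0 f g a : (f * g) a != 0 ->
  exists k l, [/\ a = (k + l)%MM, f k != 0 & g l != 0].
Proof.
move=> /eqP fg; apply: contrapT => nE; apply: fg.
rewrite (cpsME f g (ltnSn (mdeg a))); apply: big1 => k _; apply: big1 => l /eqP akl.
have [->|fk] := eqVneq (f k) 0; first by rewrite mul0r.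
have [->|gl] := eqVneq (g l) 0; first by rewrite mulr0.
by case: nE; exists k, l.
Qed.

Lemma cpsM0E f g : (f * g) 0%MM = f 0%MM * g 0%MM.
Proof.
rewrite (@cpsME 1%N) ?mdeg0//.
have bm0E (k : 'X_{1..n < 1}) : k == bm0.
  by rewrite bmeqP /=; have := bmdeg k; rewrite ltnS leqn0 mdeg_eq0.
rewrite (big_pred1 bm0) => [|k]; last by rewrite /= bm0E.
by rewrite (big_pred1 bm0) => [//|l]; rewrite /= bm0E (eqP (bm0E l)) /= addm0 eqxx.
Qed.

Lemma cps_prod0E (I : Type) (r : seq I) (P : pred I) (F : I -> cps n K) :
  (\prod_(i <- r | P i) F i) 0%MM = \prod_(i <- r | P i) F i 0%MM.
Proof.
apply: (big_morph (fun f : cps n K => f 0%MM)); first exact: cpsM0E.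
by rewrite cps1E eqxx.
Qed.

Lemma convergent_monom (c : K) a : convergent (FPS (fun k => c *+ (k == a))).
Proof.
exists 1, `|c|; split=> // d.
have [ad|da] := ltnP (mdeg a) d.
  rewrite (bigD1 (BMultinom ad)) //= eqxx expr1n mulr1 big1 ?addr0 // => k.
  by rewrite bmeqP /= => /negPf ->; rewrite normr0 mul0r.
rewrite big1 // => k _ /=; have /negPf -> : (k : 'X_{1..n}) != a.
  by apply: contraTneq (bmdeg k) => ->; rewrite -leqNgt.
by rewrite normr0 mul0r.
Qed.

Definition monom (c : K) a : cps n K := CPS (asboolT (convergent_monom c a)).

Lemma coef_monom c a k : monom c a k = c *+ (k == a). Proof. by []. Qed.
Opaque monom.

Lemma coef_monomM c a f k :
  (monom c a * f) k = if (a <= k)%MM then c * f (k - a)%MM else 0.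
Proof.
rewrite (cpsME _ _ (ltnSn (mdeg k))); case: ifPn => [ak|Nak]; last first.
  rewrite big1 // => u _; rewrite big1 // => v /eqP kuv.
  rewrite coef_monom; case: eqP => [ua|_]; last by rewrite mul0r.
  by case/negP: Nak; have := lem_addr u v; rewrite -kuv ua.
have kd : (mdeg (k - a)%MM < (mdeg k).+1)%N by rewrite ltnS mdegB.
have ad : (mdeg a < (mdeg k).+1)%N by rewrite ltnS -(submK ak) mdegD leq_addl.
rewrite (bigD1 (BMultinom ad)) //= [X in _ + X]big1 ?addr0 => [|u]; last first.
  rewrite bmeqP /= => /negPf ua; rewrite big1 // => v _.
  by rewrite coef_monom ua mul0r.
rewrite (big_pred1 (BMultinom kd)) => [|v].
  by rewrite coef_monom eqxx.
by rewrite /= bmeqP /= -{1}(submK ak) [(a + _)%MM]addmC eqm_add2r eq_sym.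
Qed.

Lemma monomM c a c' a' : monom c a * monom c' a' = monom (c * c') (a + a')%MM.
Proof.
apply: cpsP => k; rewrite coef_monomM !coef_monom; case: ifPn => [ak|Nak].
  by rewrite -mulrnAr -[in RHS](submK ak) [(a + _)%MM]addmC eqm_add2r.
by rewrite (_ : k == _ = false) //; apply: contraNF Nak => /eqP ->; apply: lem_addr.
Qed.

Lemma monom1 : monom 1 0%MM = 1. Proof. by apply: cpsP. Qed.

Lemma monomX c a e : monom c a ^+ e = monom (c ^+ e) (a *+ e)%MM.
Proof.
elim: e => [|e IH]; first by rewrite !expr0 mulm0n monom1.
by rewrite !exprS IH monomM mulmS.
Qed.

Lemma prod_monom (I : Type) (r : seq I) (P : pred I) (c : I -> K) (a : I -> 'X_{1..n}) :
  \prod_(i <- r | P i) monom (c i) (a i) =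
  monom (\prod_(i <- r | P i) c i) (\big[+%MM/0%MM]_(i <- r | P i) a i).
Proof.
elim/big_rec3: _ => [|i x y z _ ->]; first by rewrite monom1.
by rewrite monomM.
Qed.

Definition X_ (i : 'I_n) : cps n K := monom 1 U_(i)%MM.

Lemma min_supp f : f != 0 ->
  exists2 a, f a != 0 & forall b, f b != 0 -> (a <= b)%O.
Proof.
move=> f0; have [b fb] : exists b, f b != 0.
  apply: contrapT => fb; case/eqP: f0; apply: cpsP => b; rewrite cps0E.
  by apply: contrapT => /eqP fb'; apply: fb; exists b.
apply: contrapT => nE; elim/(@ltmwf n): b fb => b IH fb; apply: nE; exists b => // c fc.
by rewrite leNgt; apply/negP => /IH /(_ fc).
Qed.

(** The monomial order is compatible with addition, so at the sum of the smallest exponents of f and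
    g only one product of coefficients survives. *)
Lemma cps_mul_eq0 f g : f * g = 0 -> f = 0 \/ g = 0.
Proof.
move=> fg; apply: contrapT => /not_orP[/eqP f0 /eqP g0].
have [a fa aP] := min_supp f0; have [b gb bP] := min_supp g0.
have /eqP := congr1 (fun h : cps n K => h (a + b)%MM) fg.
have da : (mdeg a < (mdeg (a + b)%MM).+1)%N by rewrite ltnS mdegD leq_addr.
have db : (mdeg b < (mdeg (a + b)%MM).+1)%N by rewrite ltnS mdegD leq_addl.
rewrite (cpsME _ _ (ltnSn _)) (bigD1 (BMultinom da)) //=.
rewrite (big_pred1 (BMultinom db)) => [|l] /=; last first.
  by rewrite bmeqP /= eqm_add2l eq_sym.
rewrite [X in _ + X]big1 ?addr0 ?mulf_eq0 ?(negPf fa) ?(negPf gb) // => k.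
rewrite bmeqP /= => ka; rewrite big1 // => l /eqP abkl.
have [->|fk] := eqVneq (f k) 0; first by rewrite mul0r.
have [->|gl] := eqVneq (g l) 0; first by rewrite mulr0.
have ltak : (a < k)%O by rewrite lt_neqAle aP // eq_sym ka.
by have := ltmc_le_add ltak (bP _ gl); rewrite -abkl ltxx.
Qed.

Lemma cps_mulI f g h : f != 0 -> f * g = f * h -> g = h.
Proof.
move=> f0 /eqP; rewrite -subr_eq0 -mulrBr => /eqP /cps_mul_eq0[] /eqP.
  by rewrite (negPf f0).
by rewrite subr_eq0 => /eqP.
Qed.

Lemma cps_prod_neq0 (I : Type) (r : seq I) (P : pred I) (F : I -> cps n K) :
  (forall i, P i -> F i != 0) -> \prod_(i <- r | P i) F i != 0.
Proof.
move=> F0; apply: (big_ind (fun f : cps n K => f != 0)) => //.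
  exact: oner_neq0.
by move=> f g f0 g0; apply/negP => /eqP /cps_mul_eq0[] /eqP; apply/negP.
Qed.

Lemma coef_pderiv i f a : pderiv i f a = f (a + U_(i))%MM *+ (a i).+1.
Proof. by []. Qed.

Lemma pderivD i f g : pderiv i (f + g) = pderiv i f + pderiv i g.
Proof. by apply: cpsP => a; rewrite cpsDE !coef_pderiv mulrnDl. Qed.

Fact pderiv_is_zmod_morphism i : zmod_morphism (@pderiv K n i).
Proof. by move=> f g; apply: cpsP => a; rewrite cpsBE !coef_pderiv mulrnBl. Qed.

Lemma pderivM i f g : pderiv i (f * g) = pderiv i f * g + f * pderiv i g.
Proof.
(* The Leibniz rule is taken from polynomials by truncation; [d] must exceed |a| + 1, the degree
   from which the derivative reads its coefficient at a. *)
apply: cpsP => a; set d := (mdeg a).+2.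
have ad : (mdeg a < d)%N by [].
have ad1 : (mdeg a < (mdeg a).+1)%N by [].
have aUd : (mdeg (a + U_(i))%MM < d)%N by rewrite mdegD mdeg1 addn1.
rewrite cpsDE coef_pderiv.
have -> : (f * g) (a + U_(i))%MM = fps_mul f g (a + U_(i))%MM by [].
rewrite (fps_mulE _ _ aUd) -mcoeff_mderiv mderivM mcoeffD.
have dk (b : 'X_{1..n < (mdeg a).+1}) : (mdeg b < d)%N := ltnW (bmdeg b).
have dkU (b : 'X_{1..n < (mdeg a).+1}) : (mdeg (b + U_(i))%MM < d)%N.
  by rewrite mdegD mdeg1 addn1 ltnS bmdeg.
rewrite !(cpsME _ _ ad1) !pair_big_dep /=; congr (_ + _).
  rewrite (mcoeff_poly_mul _ _ ad1); apply: eq_bigr => k _.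
  by rewrite mcoeff_mderiv !fps_truncE ?dk ?dkU.
rewrite (mcoeff_poly_mul _ _ ad1); apply: eq_bigr => k _.
by rewrite mcoeff_mderiv !fps_truncE ?dk ?dkU.
Qed.

End Coefficients.
#[global] Opaque monom.

HB.instance Definition _ (K : numFieldType) n i :=
  GRing.isZmodMorphism.Build (cps n K) (cps n K) (@pderiv K n i)
    (@pderiv_is_zmod_morphism K n i).

(** * Weighted norms on polydiscs and division with remainder *)

Section WeightedDegree.
Variables (n : nat) (w : 'I_n -> nat).
Implicit Types a b : 'X_{1..n}.

Definition wdeg a : nat := \sum_i (w i * a i)%N.

Lemma wdegD a b : wdeg (a + b)%MM = (wdeg a + wdeg b)%N.
Proof. by rewrite /wdeg -big_split; apply: eq_bigr => i _; rewrite mnmDE mulnDr. Qed.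

Lemma wdeg0 : wdeg 0%MM = 0%N.
Proof. by rewrite /wdeg big1 // => i _; rewrite mnm0E muln0. Qed.

Lemma wdegU i : wdeg U_(i)%MM = w i.
Proof.
rewrite /wdeg (bigD1 i) //= big1 ?addn0 => [|j /negPf ji].
  by rewrite mnm1E eqxx muln1.
by rewrite mnm1E eq_sym ji muln0.
Qed.

Lemma wdegMn a e : wdeg (a *+ e)%MM = (wdeg a * e)%N.
Proof. by rewrite /wdeg big_distrl; apply: eq_bigr => i _; rewrite mulmnE mulnA. Qed.

Lemma mdeg_le_wdeg a : (forall i, 0 < w i)%N -> (mdeg a <= wdeg a)%N.
Proof. by move=> w0; rewrite mdegE; apply: leq_sum => i _; rewrite leq_pmull. Qed.

Lemma wdeg_le_mdeg a : (wdeg a <= (\sum_i w i) * mdeg a)%N.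
Proof.
rewrite mdegE /wdeg big_distrr /=; apply: leq_sum => i _.
by rewrite leq_mul2r (bigD1 i) //= leq_addr orbT.
Qed.

End WeightedDegree.

Lemma wdeg1 n (a : 'X_{1..n}) : wdeg (fun=> 1%N) a = mdeg a.
Proof. by rewrite mdegE; apply: eq_bigr => i _; rewrite mul1n. Qed.

Section WeightedNorm.
Variables (K : numFieldType) (n : nat).
Implicit Types (w : 'I_n -> nat) (f g h : cps n K) (a b k : 'X_{1..n}) (s M : K).

(* M bounds the norm sum_k |f_k| s^(w.k), i.e. the norm on the polydisc with
   radii s^(w_i). *)
Definition norm_le w s f M :=
  forall d, \sum_(k : 'X_{1..n < d}) `|f k| * s ^+ wdeg w k <= M.

Definition order_ge w l f := forall k, (wdeg w k < l)%N -> f k = 0.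

Lemma order_geM w l l' f g :
  order_ge w l f -> order_ge w l' g -> order_ge w (l + l') (f * g).
Proof.
move=> fl gl a al; apply/eqP; apply: contraLR al => /cpsM_neq0[b [c [-> fb gc]]].
rewrite wdegD -leqNgt; apply: leq_add; rewrite leqNgt; [apply: contraNN fb|apply: contraNN gc].
  by move=> /fl ->.
by move=> /gl ->.
Qed.

Lemma order_geD w l f g : order_ge w l f -> order_ge w l g -> order_ge w l (f + g).
Proof. by move=> fl gl a al; rewrite cpsDE fl ?gl ?addr0. Qed.

Lemma order_geN w l f : order_ge w l f -> order_ge w l (- f).
Proof. by move=> fl a al; rewrite cpsNE fl ?oppr0. Qed.

Lemma order_ge_sum w l (I : Type) (r : seq I) (P : pred I) (F : I -> cps n K) :
  (forall i, P i -> order_ge w l (F i)) -> order_ge w l (\sum_(i <- r | P i) F i).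
Proof. by move=> Fl a al; rewrite cps_sumE big1 // => i /Fl ->. Qed.

Lemma order_geW w l l' f : (l' <= l)%N -> order_ge w l f -> order_ge w l' f.
Proof. by move=> ll fl a al; apply: fl; apply: leq_trans al ll. Qed.

Lemma order_ge0 w f : order_ge w 0 f. Proof. by []. Qed.

Lemma order_ge_prod w (I : Type) (r : seq I) (P : pred I) (F : I -> cps n K) (l : I -> nat) :
  (forall i, P i -> order_ge w (l i) (F i)) ->
  order_ge w (\sum_(i <- r | P i) l i) (\prod_(i <- r | P i) F i).
Proof.
move=> Fl; elim/big_rec2: _ => [|i x y Pi IH]; first exact: order_ge0.
by apply: order_geM => //; apply: Fl.
Qed.

Lemma order_geX w l f e : order_ge w l f -> order_ge w (l * e) (f ^+ e).
Proof.
move=> fl; elim: e => [|e IH]; first by rewrite muln0; apply: order_ge0.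
by rewrite exprS mulnS; apply: order_geM.
Qed.

Variables (w : 'I_n -> nat).

Lemma norm_le_ge0 s f M : norm_le w s f M -> 0 <= M.
Proof.
move=> /(_ 0%N); rewrite big1 // => k; have := bmdeg k; by rewrite ltn0.
Qed.

Lemma norm_leW s f M M' : M <= M' -> norm_le w s f M -> norm_le w s f M'.
Proof. by move=> MM fM d; apply: le_trans (fM d) MM. Qed.

Section FixedRadius.
Variables (s : K) (s0 : 0 < s).
Let s_ge0 := ltW s0.

Lemma norm_leD f g M M' : norm_le w s f M -> norm_le w s g M' ->
  norm_le w s (f + g) (M + M').
Proof.
move=> fM gM d; apply: le_trans (lerD (fM d) (gM d)); rewrite -big_split /=.
by apply: ler_sum => k _; rewrite -mulrDl ler_wpM2r ?exprn_ge0 // ler_normD.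
Qed.

Lemma norm_leN f M : norm_le w s f M -> norm_le w s (- f) M.
Proof. by move=> fM d; under eq_bigr do rewrite cpsNE normrN; apply: fM. Qed.

Lemma norm_le0 : norm_le w s 0 0.
Proof. by move=> d; rewrite big1 // => k _; rewrite cps0E normr0 mul0r. Qed.

Lemma norm_le_sum (I : Type) (r : seq I) (P : pred I) (F : I -> cps n K) (M : I -> K) :
  (forall i, P i -> norm_le w s (F i) (M i)) ->
  norm_le w s (\sum_(i <- r | P i) F i) (\sum_(i <- r | P i) M i).
Proof.
move=> FM; elim/big_rec2: _ => [|i x y Pi IH]; first exact: norm_le0.
by apply: norm_leD => //; apply: FM.
Qed.

Lemma norm_le_monom c a : norm_le w s (monom c a) (`|c| * s ^+ wdeg w a).
Proof.
move=> d; have [ad|da] := ltnP (mdeg a) d.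
  rewrite (bigD1 (BMultinom ad)) //= coef_monom eqxx mulr1n big1 ?addr0 // => k.
  by rewrite bmeqP /= coef_monom => /negPf ->; rewrite normr0 mul0r.
rewrite big1 ?mulr_ge0 ?exprn_ge0 // => k _; rewrite coef_monom.
have /negPf -> : (k : 'X_{1..n}) != a.
  by apply: contraTneq (bmdeg k) => ->; rewrite -leqNgt.
by rewrite normr0 mul0r.
Qed.

Lemma norm_le_C c : norm_le w s (monom c 0%MM) `|c|.
Proof. by have := norm_le_monom c 0%MM; rewrite wdeg0 mulr1. Qed.

Lemma norm_le_X i : norm_le w s (X_ K i) (s ^+ w i).
Proof. by have := norm_le_monom 1 U_(i)%MM; rewrite wdegU normr1 mul1r. Qed.

Lemma norm_le1 : norm_le w s 1 1.
Proof. by have := norm_le_monom 1 0%MM; rewrite monom1 wdeg0 normr1 mulr1. Qed.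

Lemma norm_leM f g M M' : norm_le w s f M -> norm_le w s g M' ->
  norm_le w s (f * g) (M * M').
Proof.
move=> fM gM d.
pose F k := `|f k| * s ^+ wdeg w k; pose G k := `|g k| * s ^+ wdeg w k.
have F0 k : 0 <= F k by rewrite mulr_ge0 ?exprn_ge0.
have G0 k : 0 <= G k by rewrite mulr_ge0 ?exprn_ge0.
apply: (@le_trans _ _ (\sum_(k : 'X_{1..n < d}) \sum_(l : 'X_{1..n < d})
   \sum_(m : 'X_{1..n < d} | (k : 'X_{1..n}) == (l + m)%MM) F l * G m)).
  apply: ler_sum => k _; rewrite (cpsME _ _ (bmdeg k)).
  apply: le_trans (ler_wpM2r _ (ler_norm_sum _ _ _)) _; first by rewrite exprn_ge0.
  rewrite mulr_suml; apply: ler_sum => l _.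
  apply: le_trans (ler_wpM2r _ (ler_norm_sum _ _ _)) _; first by rewrite exprn_ge0.
  rewrite mulr_suml; apply: ler_sum => m /eqP klm.
  by rewrite /F /G normrM klm wdegD exprD mulrACA.
apply: (@le_trans _ _ (\sum_(l : 'X_{1..n < d}) \sum_(m : 'X_{1..n < d}) F l * G m)).
  rewrite exchange_big /=; apply: ler_sum => l _.
  rewrite (exchange_big_dep xpredT) //=; apply: ler_sum => m _.
  have [ld|ld] := ltnP (mdeg (l + m)%MM) d.
    by rewrite (big_pred1 (BMultinom ld)).
  rewrite big_pred0 => [|k]; first exact: mulr_ge0 (F0 _) (G0 _).
  apply/negP => /eqP kl; move: (bmdeg k); rewrite kl => /leq_trans/(_ ld).
  by rewrite ltnn.
under eq_bigr do rewrite -mulr_sumr.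
by rewrite -mulr_suml; apply: ler_pM; rewrite ?sumr_ge0.
Qed.

Lemma norm_leX f M e : norm_le w s f M -> norm_le w s (f ^+ e) (M ^+ e).
Proof.
move=> fM; elim: e => [|e IH]; first by rewrite !expr0; apply: norm_le1.
by rewrite !exprS; apply: norm_leM.
Qed.

Lemma norm_le_prod (I : Type) (r : seq I) (P : pred I) (F : I -> cps n K) (M : I -> K) :
  (forall i, P i -> norm_le w s (F i) (M i)) ->
  norm_le w s (\prod_(i <- r | P i) F i) (\prod_(i <- r | P i) M i).
Proof.
move=> FM; elim/big_rec2: _ => [|i x y Pi IH]; first exact: norm_le1.
by apply: norm_leM => //; apply: FM.
Qed.

(** Every term has weight at least l, hence loses at least the factor (s'/s)^l. High order thus
    becomes a small norm. *)
Lemma norm_le_shrink s' l f M : 0 < s' -> s' <= s -> order_ge w l f ->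
  norm_le w s f M -> norm_le w s' f ((s' / s) ^+ l * M).
Proof.
move=> s'0 s's fl fM d; have q0 : 0 <= s' / s by rewrite divr_ge0 // ltW.
apply: le_trans (ler_wpM2l _ (fM d)); last by rewrite exprn_ge0.
rewrite mulr_sumr; apply: ler_sum => k _.
have [kl|lk] := ltnP (wdeg w k) l; first by rewrite fl // normr0 !mul0r mulr0.
rewrite mulrCA; apply: ler_wpM2l => //; rewrite -(subnK lk) !exprD [in X in _ <= X]mulrC -mulrA.
rewrite -exprMn [s * _]mulrC divfK ?gt_eqF // ler_wpM2r ?exprn_ge0 ?(ltW s'0) //.
by apply: lerXn2r; rewrite ?nnegrE ?(ltW s'0).
Qed.

End FixedRadius.

Hypothesis w0 : forall i, (0 < w i)%N.

(** For s at most 1 and positive weights, s^(w.k) is at most s^|k|; r / (1 + r) lies below both r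
    and 1. *)
Lemma norm_le_exists f : exists s M, [/\ 0 < s, s <= 1 & norm_le w s f M].
Proof.
have [r [M [r0 fM]]] := cps_convergent f.
have r1 : 0 < 1 + r by rewrite addr_gt0.
have s0 : 0 < r / (1 + r) by rewrite divr_gt0.
have s1 : r / (1 + r) <= 1 by rewrite ler_pdivrMr // mul1r lerDr.
have sr : r / (1 + r) <= r by rewrite ler_pdivrMr // ler_peMr ?(ltW r0) // lerDl ltW.
exists (r / (1 + r)), M; split=> // d.
apply: le_trans (convergent_shrink s0 sr fM d); apply: ler_sum => k _.
apply: ler_wpM2l => //; apply: ler_wiXn2l => //; first exact: ltW.
exact: mdeg_le_wdeg.
Qed.

(** The product of the individual radii serves as common radius: each is at most 1, so the product
    lies below all of them. *)
Lemma norm_le_finite (I : finType) (F : I -> cps n K) :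
  exists s M, [/\ 0 < s, s <= 1, 0 <= M & forall i, norm_le w s (F i) M].
Proof.
have [/= sM sMP] := choice (fun i => let: ex_intro s (ex_intro M P) := norm_le_exists (F i) in
  ex_intro (fun sM : K * K => [/\ 0 < sM.1, sM.1 <= 1 & norm_le w sM.1 (F i) sM.2]) (s, M) P).
have M0 i : 0 <= (sM i).2 by case: (sMP i) => _ _ /norm_le_ge0.
exists (\prod_i (sM i).1), (\sum_i (sM i).2); split.
- by apply: prodr_gt0 => i _; case: (sMP i).
- by apply: prodr_ile1 => i _; case: (sMP i) => /ltW -> ->.
- exact: sumr_ge0.
move=> i; have [si0 si1 fM] := sMP i.
have p0 : 0 < \prod_i (sM i).1 by apply: prodr_gt0 => j _; case: (sMP j).
have pi : \prod_i (sM i).1 <= (sM i).1.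
  rewrite (bigD1 i) //= ler_piMr ?(ltW si0) //.
  by apply: prodr_ile1 => j _; case: (sMP j) => /ltW -> ->.
have := norm_le_shrink si0 p0 pi (@order_ge0 w _) fM.
rewrite expr0 mul1r; apply: norm_leW.
by rewrite (bigD1 i) //= lerDl sumr_ge0.
Qed.

(** With m the sum of the weights, w.k is at most m |k|; for t < 1 below s, the ordinary radius t^m
    therefore works. *)
Lemma norm_le_convergent (f : fps n K) s M : 0 < s ->
  (forall d, \sum_(k : 'X_{1..n < d}) `|f k| * s ^+ wdeg w k <= M) -> convergent f.
Proof.
move=> s0 fM; set m := \sum_i w i; pose t := s / (1 + s).
have s1 : 0 < 1 + s by rewrite addr_gt0.
have t0 : 0 < t by rewrite divr_gt0.
have t1 : t <= 1 by rewrite ler_pdivrMr // mul1r lerDr.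
have ts : t <= s by rewrite ler_pdivrMr // ler_peMr ?(ltW s0) // lerDl ltW.
exists (t ^+ m), M; split=> [|d]; first by rewrite exprn_gt0.
apply: le_trans (fM d); apply: ler_sum => k _; apply: ler_wpM2l => //.
apply: (@le_trans _ _ (t ^+ wdeg w k)).
  rewrite -exprM; apply: ler_wiXn2l => //; first exact: ltW.
  exact: wdeg_le_mdeg.
by apply: lerXn2r; rewrite ?nnegrE ?(ltW s0) ?(ltW t0).
Qed.

(** Each coefficient is eventually constant along u, and each partial sum of the norm sees only
    finitely many coefficients, so the bound passes to the limit. *)
Lemma cps_limit (u : nat -> cps n K) s M : 0 < s ->
  (forall j, norm_le w s (u j) M) ->
  (forall j, order_ge w j (u j.+1 - u j)) ->
  exists v : cps n K, norm_le w s v M /\ forall j, order_ge w j (v - u j).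
Proof.
move=> s0 uM ust.
have ustab i j a : (wdeg w a < i)%N -> u (i + j)%N a = u i a.
  move=> ai; elim: j => [|j IH]; first by rewrite addn0.
  apply/eqP; rewrite -IH addnS -subr_eq0 -cpsBE; apply/eqP/ust.
  exact: leq_trans ai (leq_addr _ _).
pose v : fps n K := FPS (fun a => u (wdeg w a).+1 a).
have vE i a : (wdeg w a < i)%N -> v a = u i a.
  by move=> ai; rewrite /= -(subnKC ai) ustab.
have vM d : \sum_(k : 'X_{1..n < d}) `|v k| * s ^+ wdeg w k <= M.
  (* This index exceeds the weight of every monomial of degree below d, so v agrees with that term
     of the sequence on the whole partial sum. *)
  apply: le_trans (uM ((\sum_i w i) * d).+1 d); apply: ler_sum => k _.
  rewrite (@vE ((\sum_i w i) * d).+1) // ltnS.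
  apply: leq_trans (wdeg_le_mdeg _ _) _; rewrite leq_mul2l (ltnW (bmdeg k)) orbT //.
exists (CPS (asboolT (norm_le_convergent s0 vM))); split=> [d|j a aj].
  exact: vM.
by rewrite cpsBE; apply/eqP; rewrite subr_eq0; apply/eqP/vE.
Qed.

End WeightedNorm.

Section Division.
Variables (K : numFieldType) (n : nat).
Implicit Types (w : 'I_n -> nat) (f g p q r : cps n K) (a b e : 'X_{1..n}).

Lemma sum_shift_le (F : 'X_{1..n} -> K) e d : (forall k, 0 <= F k) ->
  \sum_(k : 'X_{1..n < d}) F (k + e)%MM <= \sum_(l : 'X_{1..n < d + mdeg e}) F l.
Proof.
move=> F0.
have sd (k : 'X_{1..n < d}) : (mdeg (k + e)%MM < d + mdeg e)%N.
  by rewrite mdegD ltn_add2r bmdeg.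
pose s k := BMultinom (sd k).
have sI : injective s.
  move=> k l /(congr1 (fun b : 'X_{1..n < d + mdeg e} => (b : 'X_{1..n}))) /= skl.
  exact/val_inj/(addIm skl).
rewrite [leRHS](bigID (mem (s @: [set: 'X_{1..n < d}]))) /= big_imset /=; last first.
  by move=> k l _ _; apply: sI.
rewrite [X in _ <= X + _](eq_bigl xpredT) => [|k]; last by rewrite inE.
by rewrite lerDl sumr_ge0.
Qed.

Lemma shift_norm_le w e s f M : 0 < s -> norm_le w s f M ->
  forall d, \sum_(k : 'X_{1..n < d}) `|f (k + e)%MM| * s ^+ wdeg w k <= M / s ^+ wdeg w e.
Proof.
move=> s0 fM d; rewrite ler_pdivlMr ?exprn_gt0 // mulr_suml.
apply: le_trans (fM (d + mdeg e)%N).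
rewrite (eq_bigr (fun k : 'X_{1..n < d} => `|f (k + e)%MM| * s ^+ wdeg w (k + e))).
  apply: (@sum_shift_le (fun k => `|f k| * s ^+ wdeg w k)) => k.
  by rewrite mulr_ge0 ?exprn_ge0 ?(ltW s0).
by move=> k _; rewrite wdegD exprD mulrA.
Qed.

Lemma shift_convergent e f : convergent (FPS (fun k => f (k + e)%MM)).
Proof.
have w0 (i : 'I_n) : (0 < (fun=> 1) i)%N by [].
have [s [M [s0 _ fM]]] := norm_le_exists w0 f.
exact: (@norm_le_convergent _ _ (fun=> 1%N) (FPS (fun k => f (k + e)%MM)) _ _ s0 (shift_norm_le e s0 fM)).
Qed.

(** Division by x^e, dropping the terms that x^e does not divide. *)
Definition shift e f : cps n K := CPS (asboolT (shift_convergent e f)).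

Lemma shiftE e f k : shift e f k = f (k + e)%MM. Proof. by []. Qed.

Lemma shiftB e f g : shift e (f - g) = shift e f - shift e g.
Proof. exact: cpsP. Qed.

Lemma order_ge_shift w l e f : order_ge w (l + wdeg w e) f -> order_ge w l (shift e f).
Proof. by move=> fl k kl; rewrite shiftE; apply: fl; rewrite wdegD ltn_add2r. Qed.

(* q is the fixed point of q |-> (g + q p) / x^e, where the terms not divisible by
   x^e are dropped; on the polydisc with radii s^(w_i) this is a contraction for
   small s. *)
Lemma division w e p g : (forall i, 0 < w i)%N ->
  (forall k, p k != 0 -> (wdeg w e < wdeg w k)%N) ->
  exists q r, g = q * (monom 1 e - p) + r /\ forall k, (e <= k)%MM -> r k = 0.
Proof.
move=> w0 ep; set E := wdeg w e.
have pE : order_ge w E.+1 p.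
  by move=> k; rewrite ltnS leqNgt => kE; apply: contraNeq kE => /ep.
have [s1 [M [s10 s11 M0 pg]]] := norm_le_finite w0 (fun b : bool => if b then p else g).
have pM := pg true; have gM := pg false; rewrite /= in pM gM.
have D0 : 0 < 2 * M + 1 by rewrite ltr_wpDl ?mulr_ge0.
(* As p has order at least E + 1, shrinking the radius from s1 to s bounds its norm by s^E M / (2 M
   + 1), less than half the norm s^E of x^e. *)
pose s := s1 ^+ E.+1 / (2 * M + 1).
have s0 : 0 < s by rewrite divr_gt0 ?exprn_gt0.
have ss1 : s <= s1.
  rewrite ler_pdivrMr // exprS ler_pM2l // (le_trans (exprn_ile1 E (ltW s10) s11)) //.
    by rewrite lerDr mulr_ge0.
have sp : norm_le w s p (s ^+ E / 2).
  apply: norm_leW (norm_le_shrink s10 s0 ss1 pE pM).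
  have -> : (s / s1) ^+ E.+1 = s ^+ E / (2 * M + 1).
    rewrite expr_div_n exprSr -mulrA /s mulrAC divff ?mul1r //.
    by rewrite lt0r_neq0 ?exprn_gt0.
  rewrite ler_pdivlMr // (_ : _ * M * 2 = s ^+ E * (2 * M / (2 * M + 1))); last by ring.
  rewrite ler_piMr ?exprn_ge0 ?(ltW s0) // ler_pdivrMr // mul1r lerDl //.
have sg : norm_le w s g M.
  have := norm_le_shrink s10 s0 ss1 (@order_ge0 _ _ w _) gM.
  by rewrite expr0 mul1r.
pose u := fix u j := if j is j'.+1 then shift e (g + u j' * p) else 0.
have sE0 : 0 < s ^+ E by rewrite exprn_gt0.
(* The bound is stable under the iteration: (M + (2 M / s^E)(s^E / 2)) / s^E = 2 M / s^E. *)
have uM j : norm_le w s (u j) (2 * M / s ^+ E).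
  elim: j => [|j IH] /=.
    by apply: norm_leW (norm_le0 _ _); rewrite divr_ge0 ?mulr_ge0 ?(ltW sE0).
  move=> d; have := norm_leD s0 sg (norm_leM s0 IH sp).
  move=> /(shift_norm_le e s0) /(_ d); rewrite -/E.
  suff -> : (M + 2 * M / s ^+ E * (s ^+ E / 2)) / s ^+ E = 2 * M / s ^+ E by [].
  by field; rewrite lt0r_neq0.
have ust j : order_ge w j (u j.+1 - u j).
  elim: j => [|j IH]; first exact: order_ge0.
  rewrite /= -/(u j) -shiftB opprD addrACA subrr add0r -mulrBl.
  apply: order_ge_shift; rewrite -/E addSnnS; exact: order_geM.
have [q [_ qu]] := cps_limit s0 uM ust.
exists q, (g + q * p - q * monom 1 e); split; first by ring.
move=> k ek; rewrite -(submK ek) [q * monom _ _]mulrC; set a := (k - e)%MM.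
rewrite cpsBE coef_monomM lem_addl addmK mul1r.
have -> : q a = (g + u (wdeg w a).+1 * p) (a + e)%MM.
  rewrite -shiftE; apply/eqP; rewrite -subr_eq0.
  by have := qu (wdeg w a).+2 a (leqnSn _); rewrite cpsBE => ->.
have -> : (g + q * p) (a + e)%MM - (g + u (wdeg w a).+1 * p) (a + e)%MM =
          ((q - u (wdeg w a).+1) * p) (a + e)%MM.
  by rewrite -cpsBE opprD addrACA subrr add0r -mulrBl.
by apply: (order_geM (qu _) pE); rewrite wdegD -/E addSnnS -addnS leq_add2l.
Qed.

(** Division of 1 by f / f(0) with leading monomial x^0: the remainder has no terms, since x^0
    divides every monomial. *)
Lemma cps_unit f : f 0%MM != 0 -> exists g, f * g = 1.
Proof.
move=> f0; pose p := 1 - monom (f 0%MM)^-1 0%MM * f.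
have w0 (i : 'I_n) : (0 < (fun=> 1) i)%N by [].
have p0 k : p k != 0 -> (wdeg (fun=> 1%N) (0%MM : 'X_{1..n}) < wdeg (fun=> 1%N) k)%N.
  rewrite !wdeg1 mdeg0 lt0n; apply: contraNneq => /eqP; rewrite mdeg_eq0 => /eqP ->.
  by rewrite cpsBE cps1E eqxx coef_monomM lepm_refl subm0 mulVf ?subrr.
have [q [r [E rk]]] := division 1 w0 p0.
have r0 : r = 0 by apply: cpsP => k; rewrite rk // -[k]add0m lem_addr.
exists (q * monom (f 0%MM)^-1 0%MM).
by rewrite [RHS]E r0 addr0 monom1 /p; ring.
Qed.

End Division.

(** * Substitution and the inverse function theorem *)

Lemma sum_bm_widen (V : nmodType) n d1 d2 (G : 'X_{1..n} -> V) : (d1 <= d2)%N ->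
  (forall k, (d1 <= mdeg k)%N -> G k = 0) ->
  \sum_(k : 'X_{1..n < d2}) G k = \sum_(k : 'X_{1..n < d1}) G k.
Proof.
move=> d12 G0.
pose s (k : 'X_{1..n < d1}) := BMultinom (leq_trans (bmdeg k) d12).
have sI : injective s.
  move=> k l /(congr1 (fun b : 'X_{1..n < d2} => (b : 'X_{1..n}))) /= skl.
  exact/val_inj.
rewrite (bigID (mem (s @: [set: 'X_{1..n < d1}]))) /= big_imset /=; last first.
  by move=> k l _ _; apply: sI.
rewrite [X in X + _](eq_bigl xpredT) => [|k]; last by rewrite inE.
rewrite [X in _ + X]big1 ?addr0 // => k kN; apply: G0.
rewrite leqNgt; apply: contraNN kN => kd; apply/imsetP.
by exists (BMultinom kd); rewrite ?inE //; apply/val_inj.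
Qed.

Section Substitution.
Variables (K : numFieldType) (n N : nat).
Implicit Types (z : 'I_n -> cps N K) (f g : cps n K).
Local Notation w1 := (fun=> 1%N).

Definition centre z i : cps N K := z i - monom (z i 0%MM) 0%MM.

Lemma centre0 z i : centre z i 0%MM = 0.
Proof. by rewrite cpsBE coef_monom eqxx subrr. Qed.

Lemma centreK z i : z i 0%MM = 0 -> centre z i = z i.
Proof.
by move=> z0; apply: cpsP => a; rewrite cpsBE coef_monom z0 mul0rn subr0.
Qed.

Definition zpow z (k : 'X_{1..n}) : cps N K := \prod_i centre z i ^+ k i.

Lemma zpowD z k l : zpow z (k + l)%MM = zpow z k * zpow z l.
Proof. by rewrite /zpow -big_split /=; apply: eq_bigr => i _; rewrite mnmDE exprD. Qed.

Lemma zpow0 z : zpow z 0%MM = 1.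
Proof. by rewrite /zpow big1 // => i _; rewrite mnm0E expr0. Qed.

Lemma zpowU z i : zpow z U_(i)%MM = centre z i.
Proof.
rewrite /zpow (bigD1 i) //= mnm1E eqxx expr1 big1 ?mulr1 // => j /negPf ji.
by rewrite mnm1E eq_sym ji expr0.
Qed.

Lemma order_ge_centre z i : order_ge w1 1 (centre z i).
Proof.
move=> a; rewrite wdeg1 ltnS leqn0 mdeg_eq0 => /eqP ->; exact: centre0.
Qed.

Lemma order_ge_zpow z k : order_ge w1 (mdeg k) (zpow z k).
Proof.
rewrite mdegE; apply: order_ge_prod => i _; rewrite -[X in order_ge _ X]mul1n.
exact/order_geX/order_ge_centre.
Qed.

Lemma zpow_coef_eq0 z k a : (mdeg a < mdeg k)%N -> zpow z k a = 0.
Proof. by move=> ak; apply: order_ge_zpow; rewrite wdeg1. Qed.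

(** The finite sum loses nothing: [zpow z k] has order at least |k|, so exponents with |k| > |a| do
    not contribute at a. *)
Definition fsubst z (f : fps n K) : fps N K :=
  FPS (fun a => \sum_(k : 'X_{1..n < (mdeg a).+1}) f k * zpow z k a).

Lemma fsubstE d z f a : (mdeg a < d)%N ->
  fsubst z f a = \sum_(k : 'X_{1..n < d}) f k * zpow z k a.
Proof.
move=> ad; rewrite [RHS](sum_bm_widen (G := fun k => f k * zpow z k a) ad) // => k.
by move=> ak; rewrite zpow_coef_eq0 ?mulr0.
Qed.

Lemma fsubst_norm_le z f s t M : 0 < s ->
  (forall i, norm_le w1 s (centre z i) t) -> norm_le w1 t f M ->
  forall d, \sum_(a : 'X_{1..N < d}) `|fsubst z f a| * s ^+ wdeg w1 a <= M.
Proof.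
move=> s0 zt fM d; apply: le_trans (fM d).
apply: (@le_trans _ _ (\sum_(a : 'X_{1..N < d}) \sum_(k : 'X_{1..n < d})
    `|f k| * (`|zpow z k a| * s ^+ wdeg w1 a))).
  apply: ler_sum => a _; rewrite (fsubstE _ _ (bmdeg a)).
  apply: le_trans (ler_wpM2r _ (ler_norm_sum _ _ _)) _; first by rewrite exprn_ge0 ?(ltW s0).
  by rewrite mulr_suml; apply: ler_sum => k _; rewrite normrM mulrA.
rewrite exchange_big /=; apply: ler_sum => k _; rewrite -mulr_sumr ler_wpM2l //.
rewrite wdeg1 mdegE -prodrXr; apply: norm_le_prod => // i _.
exact: norm_leX.
Qed.

Lemma fsubst_convergent z f : convergent (fsubst z f).
Proof.
have w10 m (i : 'I_m) : (0 < w1 i)%N by [].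
have [r [M [r0 _ fM]]] := norm_le_exists (@w10 n) f.
have [s1 [M1 [s10 s11 M10 zM]]] := norm_le_finite (@w10 N) (centre z).
have D0 : 0 < M1 + r by rewrite ltr_wpDl.
(* The centred z_i have order at least 1, so shrinking from s1 to s multiplies their bound M1 by r /
   (M1 + r) and brings it below the radius r of f. *)
pose s := s1 * (r / (M1 + r)).
have s0 : 0 < s by rewrite mulr_gt0 ?divr_gt0.
have ss1 : s <= s1.
  by rewrite ler_piMr ?(ltW s10) // ler_pdivrMr // mul1r lerDr.
have zr i : norm_le w1 s (centre z i) r.
  apply: norm_leW (norm_le_shrink s10 s0 ss1 (order_ge_centre z i) (zM i)).
  have -> : s / s1 = r / (M1 + r) by rewrite mulrC mulKf ?lt0r_neq0.
  rewrite expr1 mulrAC ler_pdivrMr //.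
  by rewrite mulrDr lerDl mulr_ge0 ?(ltW r0).
exact: (@norm_le_convergent _ _ w1 (fsubst z f) _ _ s0 (fsubst_norm_le s0 zr fM)).
Qed.

(* The constant terms of z are dropped, which makes the substitution total. *)
Definition csubst z f : cps N K := CPS (asboolT (fsubst_convergent z f)).

Lemma csubstE d z f a : (mdeg a < d)%N ->
  csubst z f a = \sum_(k : 'X_{1..n < d}) f k * zpow z k a.
Proof. exact: fsubstE. Qed.

Lemma csubst_norm_le z f s t M : 0 < s ->
  (forall i, norm_le w1 s (centre z i) t) -> norm_le w1 t f M ->
  norm_le w1 s (csubst z f) M.
Proof. exact: fsubst_norm_le. Qed.

Fact csubst_is_zmod_morphism z : zmod_morphism (csubst z).
Proof.
move=> f g; apply: cpsP => a; rewrite cpsBE !(csubstE _ _ (ltnSn (mdeg a))).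
by rewrite -sumrB; apply: eq_bigr => k _; rewrite cpsBE mulrBl.
Qed.

Lemma csubst_monom z c k : csubst z (monom c k) = monom c 0%MM * zpow z k.
Proof.
apply: cpsP => a; have [ka|ak] := ltnP (mdeg a) (mdeg k).
  rewrite (csubstE _ _ (ltnSn _)) coef_monomM zpow_coef_eq0; last first.
    by rewrite (leq_ltn_trans _ ka) ?mdegB.
  rewrite mulr0 if_same big1 // => l _; rewrite coef_monom.
  case: eqP => [lk|_]; last by rewrite mul0r.
  by move: (bmdeg l); rewrite lk ltnS leqNgt ka.
rewrite (csubstE _ _ (ltnSn _)) coef_monomM.
have -> : (0 <= a)%MM by apply/mnm_lepP => i; rewrite mnm0E.
rewrite subm0; have ka : (mdeg k < (mdeg a).+1)%N by [].
rewrite (bigD1 (BMultinom ka)) //= coef_monom eqxx big1 ?addr0 // => l.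
by rewrite bmeqP /= coef_monom => /negPf ->; rewrite mul0r.
Qed.

Fact csubst_is_monoid_morphism z : monoid_morphism (csubst z).
Proof.
split=> [|f g]; first by rewrite -monom1 csubst_monom zpow0 monom1 mul1r.
apply: cpsP => a; set d := (mdeg a).+1; have ad : (mdeg a < d)%N by [].
transitivity (\sum_(l : 'X_{1..n < d}) \sum_(m : 'X_{1..n < d})
    f l * g m * zpow z (l + m)%MM a).
  rewrite (csubstE _ _ ad).
  under eq_bigr => k _ do rewrite (cpsME _ _ (bmdeg k)) mulr_suml.
  rewrite exchange_big; apply: eq_bigr => l _.
  under eq_bigr => k _ do rewrite mulr_suml.
  rewrite (exchange_big_dep xpredT) //=; apply: eq_bigr => m _.
  have [ld|ld] := ltnP (mdeg (l + m)%MM) d.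
    by rewrite (big_pred1 (BMultinom ld)).
  rewrite zpow_coef_eq0 ?mulr0 ?big1 // => k /eqP klm.
  by rewrite klm zpow_coef_eq0 ?mulr0.
rewrite (cpsME _ _ ad).
under [RHS]eq_bigr => b _ do under eq_bigr => c _ do
  rewrite (csubstE _ _ (bmdeg b)) (csubstE _ _ (bmdeg c)) big_distrlr /=.
under [RHS]eq_bigr => b _ do rewrite exchange_big /=.
rewrite [RHS]exchange_big /=; apply: eq_bigr => l _.
under [RHS]eq_bigr => b _ do rewrite exchange_big /=.
rewrite [RHS]exchange_big /=; apply: eq_bigr => m _.
rewrite zpowD (cpsME _ _ ad) mulr_sumr; apply: eq_bigr => b _.
by rewrite mulr_sumr; apply: eq_bigr => c _; rewrite mulrACA.
Qed.

HB.instance Definition _ z :=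
  GRing.isZmodMorphism.Build (cps n K) (cps N K) (csubst z) (csubst_is_zmod_morphism z).
HB.instance Definition _ z :=
  GRing.isMonoidMorphism.Build (cps n K) (cps N K) (csubst z) (csubst_is_monoid_morphism z).

Lemma csubstM z f g : csubst z (f * g) = csubst z f * csubst z g.
Proof. exact: rmorphM. Qed.

Lemma csubst_X z i : z i 0%MM = 0 -> csubst z (X_ K i) = z i.
Proof. by move=> z0; rewrite csubst_monom zpowU monom1 mul1r centreK. Qed.

Lemma csubst_C z c : csubst z (monom c 0%MM) = monom c 0%MM.
Proof. by rewrite csubst_monom zpow0 mulr1. Qed.

Lemma csubst_0E z f : csubst z f 0%MM = f 0%MM.
Proof.
rewrite (@csubstE 1%N) ?mdeg0//.
have bm0E (k : 'X_{1..n < 1}) : k == bm0.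
  by rewrite bmeqP /=; have := bmdeg k; rewrite ltnS leqn0 mdeg_eq0 => ->.
rewrite (big_pred1 bm0) => [|k]; last by rewrite /= bm0E.
by rewrite zpow0 cps1E eqxx mulr1.
Qed.

Lemma order_ge_csubst l z f : order_ge w1 l f -> order_ge w1 l (csubst z f).
Proof.
move=> fl a; rewrite wdeg1 => al; rewrite (csubstE _ _ al) big1 // => k _.
by rewrite fl ?mul0r // wdeg1 bmdeg.
Qed.

End Substitution.
#[global] Opaque csubst.

Section Composition.
Variables (K : numFieldType).

Lemma csubst_comp n N P (z : 'I_n -> cps N K) (v : 'I_N -> cps P K) f :
  csubst v (csubst z f) = csubst (fun i => csubst v (z i)) f.
Proof.
have vz k : csubst v (zpow z k) = zpow (fun i => csubst v (z i)) k.
  rewrite rmorph_prod; apply: eq_bigr => i _; rewrite rmorphXn /centre csubst_0E.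
  by congr (_ ^+ _); rewrite rmorphB; congr (_ - _); apply: csubst_C.
apply: cpsP => a; set d := (mdeg a).+1; have ad : (mdeg a < d)%N by [].
rewrite !(csubstE _ _ ad).
under eq_bigr => k _ do rewrite (csubstE _ _ (bmdeg k)) mulr_suml.
rewrite exchange_big /=; apply: eq_bigr => l _.
rewrite -vz (csubstE _ _ ad) mulr_sumr; apply: eq_bigr => k _.
by rewrite mulrA.
Qed.

Lemma X_0 n (i : 'I_n) : X_ K i 0%MM = 0.
Proof. by rewrite coef_monom eq_sym -mdeg_eq0 mdeg1. Qed.

Lemma csubst_id n f : csubst (@X_ K n) f = f.
Proof.
have powE k : zpow (@X_ K n) k = monom 1 k.
  rewrite /zpow; under eq_bigr => i _ do rewrite centreK ?X_0 // monomX expr1n.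
  by rewrite prod_monom big1_eq -multinomUE_id.
apply: cpsP => a; rewrite (csubstE _ _ (ltnSn _)).
rewrite (bigD1 (BMultinom (ltnSn _))) //= powE coef_monom eqxx mulr1 big1 ?addr0 //.
by move=> k; rewrite bmeqP powE coef_monom eq_sym => /negPf ->; rewrite mulr0.
Qed.

End Composition.

Section InverseFunction.
Variables (K : numFieldType) (n : nat).
Local Notation w1 := (fun=> 1%N).
Implicit Types (z v : 'I_n -> cps n K) (f : cps n K).

(** The factors are exchanged one at a time: each exchange contributes order d, and the remaining
    |k| - 1 factors have order at least 1. *)
Lemma order_ge_zpowB N (u v : 'I_n -> cps N K) d k :
  (forall i, order_ge w1 d (centre u i - centre v i)) ->
  order_ge w1 (d + mdeg k).-1 (zpow u k - zpow v k).
Proof.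
move=> uv; have [m] := ubnP (mdeg k); elim: m k => // m IH k.
have [-> _|k0] := eqVneq k 0%MM; first by rewrite !zpow0 subrr => a _; rewrite cps0E.
have [i ki] : exists i, k i != 0%N.
  apply: contrapT => kN; case/eqP: k0; apply/mnmP => i; rewrite mnm0E.
  by apply/eqP; apply: contrapT => /negP ki; apply: kN; exists i.
have Uk : (U_(i) <= k)%MM by rewrite lep1mP.
rewrite -(submK Uk) addmC mdegD mdeg1 add1n !ltnS; set k' := (k - _)%MM => k'm.
rewrite !zpowD !zpowU.
have -> : centre u i * zpow u k' - centre v i * zpow v k' =
  (centre u i - centre v i) * zpow u k' + centre v i * (zpow u k' - zpow v k') by ring.
rewrite addnS /=; apply: order_geD; first by apply: order_geM (uv i) _; apply: order_ge_zpow.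
apply: order_geW (order_geM (order_ge_centre v i) (IH _ k'm)).
by rewrite add1n leqSpred.
Qed.

(** For |k| >= 2 the order d + |k| - 1 is at least d + 1. This gain of one order makes the iteration
    for the inverse function stabilise coefficientwise. *)
Lemma order_ge_csubstB N (u v : 'I_n -> cps N K) d f :
  (forall i, order_ge w1 d (centre u i - centre v i)) -> order_ge w1 2 f ->
  order_ge w1 d.+1 (csubst u f - csubst v f).
Proof.
move=> uv f2 a; rewrite wdeg1 => ad; rewrite cpsBE !(csubstE _ _ (ltnSn _)) -sumrB.
rewrite big1 // => k _; rewrite -mulrBr -cpsBE.
have [k2|k2] := ltnP (mdeg k) 2; first by rewrite f2 ?wdeg1 ?mul0r.
rewrite (order_ge_zpowB uv) ?mulr0 // wdeg1.
by apply: leq_trans ad _; case: (mdeg k) k2 => [|[|m]] // _; rewrite !addnS ltnS leq_addr.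
Qed.

Definition jacobian0 z : 'M[K]_n := \matrix_(i, j) z i U_(j)%MM.

Definition nonlinear_part z i := z i - \sum_j monom (z i U_(j)%MM) U_(j)%MM.

Lemma order_ge_nonlinear_part z i : z i 0%MM = 0 -> order_ge w1 2 (nonlinear_part z i).
Proof.
move=> z0 a; rewrite wdeg1 !ltnS leq_eqVlt => /orP[|]; last first.
  rewrite ltnS leqn0 mdeg_eq0 => /eqP ->; rewrite cpsBE z0 cps_sumE big1 ?subr0 // => j _.
  by rewrite coef_monom eq_sym -mdeg_eq0 mdeg1.
move=> /mdeg1P[j /eqP ->]; rewrite cpsBE cps_sumE (bigD1 j) //= coef_monom eqxx.
rewrite big1 ?addr0 ?subrr // => l lj; rewrite coef_monom.
by rewrite (_ : _ == _ = false) //; apply: contra_neqF lj => /eqP /mnmP /(_ l); rewrite !mnm1E eqxx; case: eqP.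
Qed.

Lemma coordinates_jacobian0 z : coordinates z ->
  (forall i, z i 0%MM = 0) /\ jacobian0 z \in unitmx.
Proof.
case=> z0 dz; split=> //; rewrite unitmxE unitfE; congr (\det _ != 0): dz.
by apply/matrixP => i j; rewrite !mxE coef_pderiv mnm0E add0m.
Qed.

Lemma jacobian0_coordinates z : (forall i, z i 0%MM = 0) ->
  jacobian0 z \in unitmx -> coordinates z.
Proof.
rewrite unitmxE unitfE => z0 dz; split=> //; congr (\det _ != 0): dz.
by apply/matrixP => i j; rewrite !mxE coef_pderiv mnm0E add0m.
Qed.

(* Method of majorants for v = L^-1 (x - Q(v)), where z = L x + Q: if every v_i has
   norm at most B s on the polydisc of radius s, so has every new v_i. *)
Lemma right_inverse z : (forall i, z i 0%MM = 0) -> jacobian0 z \in unitmx ->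
  exists v : 'I_n -> cps n K, (forall i, v i 0%MM = 0) /\ forall i, csubst v (z i) = X_ K i.
Proof.
move=> z0 Jz; set L := jacobian0 z; set L' := invmx L; pose Q := nonlinear_part z.
have Q2 i : order_ge w1 2 (Q i) by apply: order_ge_nonlinear_part.
have w10 (i : 'I_n) : (0 < w1 i)%N by [].
have [s1 [M [s10 s11 M0 QM]]] := norm_le_finite w10 Q.
(* Each bracket X_j - Q_j(v) will have norm at most 2 s, so a new v_i has norm at most 2 s times a
   row sum of |L'|, hence at most B s. *)
pose B := 2 * (\sum_i \sum_j `|L' i j|) + 1.
have B0 : 0 < B by rewrite ltr_wpDl // mulr_ge0 // sumr_ge0 // => i _; rewrite sumr_ge0.
have B1 : 1 <= B by rewrite lerDr mulr_ge0 // sumr_ge0 // => i _; rewrite sumr_ge0.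
have D0 : 0 < B ^+ 2 * M + B by rewrite ltr_wpDl // mulr_ge0 // exprn_ge0 // ltW.
(* Q has order 2, so on the polydisc of radius B s its norm is at most (B s / s1)^2 M = s B^2 M /
   (B^2 M + B), which is below s; the summand B in the denominator gives B s <= s1. *)
pose s := s1 ^+ 2 / (B ^+ 2 * M + B).
have s0 : 0 < s by rewrite divr_gt0 ?exprn_gt0.
have Bs0 : 0 < B * s by rewrite mulr_gt0.
have Bss1 : B * s <= s1.
  rewrite /s mulrA ler_pdivrMr // expr2 mulrCA ler_pM2l //.
  rewrite (@le_trans _ _ B) //; first by rewrite ler_piMr ?(ltW B0).
  by rewrite lerDr mulr_ge0 // exprn_ge0 // ltW.
have Qs i : norm_le w1 (B * s) (Q i) s.
  apply: norm_leW (norm_le_shrink s10 Bs0 Bss1 (Q2 i) (QM i)).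
  have -> : (B * s / s1) ^+ 2 * M = s * (B ^+ 2 * M / (B ^+ 2 * M + B)).
    by rewrite /s; field; rewrite !lt0r_neq0.
  by rewrite ler_piMr ?(ltW s0) // ler_pdivrMr // mul1r lerDl ltW.
pose step (v : 'I_n -> cps n K) i := \sum_j monom (L' i j) 0%MM * (X_ K j - csubst v (Q j)).
pose u := fix u j := if j is j'.+1 then step (u j') else fun=> 0.
have step0 v i : step v i 0%MM = 0.
  rewrite cps_sumE big1 // => j _; rewrite cpsM0E cpsBE X_0 csubst_0E Q2 ?subrr ?mulr0 //.
  by rewrite wdeg1 mdeg0.
have u0 j i : u j i 0%MM = 0 by case: j => [|j] //=; apply: step0.
have uM j i : norm_le w1 s (u j i) (B * s).
  elim: j i => [|j IH] i /=.
    by apply: norm_leW (norm_le0 _ _); apply: ltW.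
  have : norm_le w1 s (step (u j) i) (\sum_k `|L' i k| * (s + s)).
    apply: (norm_le_sum s0) => k _; apply: (norm_leM s0).
      exact: norm_le_C.
    apply: (norm_leD s0).
      exact: norm_le_X.
    apply: norm_leN; apply: csubst_norm_le (Qs k) => // l.
    by rewrite centreK.
  apply: norm_leW; rewrite -mulr_suml -mulr2n -[s *+ 2]mulr_natl mulrA [_ * 2]mulrC.
  rewrite ler_wpM2r ?(ltW s0) // /B [in X in _ <= X](bigD1 i) //= mulrDr -addrA lerDl.
  by rewrite addr_ge0 // mulr_ge0 // sumr_ge0 // => k _; rewrite sumr_ge0.
have stepB d (v v' : 'I_n -> cps n K) i : (forall k, v k 0%MM = 0) -> (forall k, v' k 0%MM = 0) ->
    (forall k, order_ge w1 d (v k - v' k)) -> order_ge w1 d.+1 (step v i - step v' i).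
  move=> v0 v'0 vv'; rewrite /step -sumrB; apply: order_ge_sum => k _.
  rewrite -mulrBr; apply: (order_geM (l := 0)); first exact: order_ge0.
  rewrite opprB addrC addrA subrK -opprB; apply: order_geN.
  by apply: order_ge_csubstB => // l; rewrite !centreK.
have ust i j : order_ge w1 j (u j.+1 i - u j i).
  elim: j i => [|j IH] i; first exact: order_ge0.
  by apply: stepB.
have [v vP] := choice (fun i => cps_limit s0 (uM^~ i) (ust i)).
have v0 i : v i 0%MM = 0.
  by have [_ /(_ 1%N 0%MM)] := vP i; rewrite wdeg1 mdeg0 cpsBE u0 subr0; apply.
have vE i : v i = step v i.
  apply: cpsP => a; set d := (mdeg a).+1.
  have : order_ge w1 d (v i - u d i + (step (u d.-1) i - step v i)).
    apply: order_geD; first by have [_] := vP i; apply.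
    by apply: stepB => // k; rewrite -opprB; apply: order_geN; have [_] := vP k; apply.
  by rewrite /= -/d addrA subrK => /(_ a); rewrite wdeg1 cpsBE => /(_ (ltnSn _)) /eqP; rewrite subr_eq0 => /eqP.
exists v; split=> // i.
have zE : z i = \sum_j monom (L i j) 0%MM * X_ K j + Q i.
  rewrite (eq_bigr (fun j => monom (z i U_(j)%MM) U_(j)%MM)) => [|j _].
    by rewrite addrC subrK.
  by rewrite monomM mulr1 add0m mxE.
rewrite {1}zE rmorphD rmorph_sum /=.
under eq_bigr => j _ do rewrite rmorphM /= csubst_C csubst_X // vE /step mulr_sumr.
rewrite exchange_big /=.
under eq_bigr => k _ do under eq_bigr => j _ do rewrite mulrA monomM addm0.
under eq_bigr => k _ do rewrite -mulr_suml.
have LE k : \sum_j monom (L i j * L' j k) 0%MM = monom (i == k)%:R 0%MM :> cps n K.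
  have <- : (L *m L') i k = (i == k)%:R by rewrite mulmxV // mxE.
  rewrite mxE; apply: cpsP => a; rewrite cps_sumE coef_monom -sumrMnl.
  by apply: eq_bigr => j _; rewrite coef_monom.
under eq_bigr => k _ do rewrite LE.
rewrite (bigD1 i) //= eqxx monom1 mul1r big1 ?addr0 ?subrK // => k /negPf ki.
rewrite eq_sym ki (_ : monom _ _ = 0) ?mul0r //.
by apply: cpsP => a; rewrite coef_monom mul0rn.
Qed.

(** Chain rule at the origin: the nonlinear part of z keeps order 2 after substitution and does not
    reach the linear coefficients. *)
Lemma csubst_jacobian0 z v : (forall i, z i 0%MM = 0) -> (forall i, v i 0%MM = 0) ->
  (forall i, csubst v (z i) = X_ K i) -> jacobian0 z *m jacobian0 v = 1%:M.
Proof.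
move=> z0 v0 vz; apply/matrixP => i j; rewrite !mxE.
have zE : z i = \sum_k monom (z i U_(k)%MM) 0%MM * X_ K k + nonlinear_part z i.
  rewrite (eq_bigr (fun k => monom (z i U_(k)%MM) U_(k)%MM)) => [|k _].
    by rewrite addrC subrK.
  by rewrite monomM mulr1 add0m.
have {}zE : X_ K i = \sum_k monom (z i U_(k)%MM) 0%MM * v k + csubst v (nonlinear_part z i).
  rewrite -vz {1}zE rmorphD rmorph_sum; congr (_ + _); apply: eq_bigr => k _ /=.
  by rewrite csubstM csubst_C csubst_X.
have := congr1 (fun f : cps n K => f U_(j)%MM) zE.
rewrite cpsDE cps_sumE (order_ge_csubst v (order_ge_nonlinear_part (z0 i))).
  rewrite addr0 coef_monom => E; transitivity (1 *+ (U_(j) == U_(i))%MM : K).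
    rewrite E; apply: eq_bigr => k _; rewrite coef_monomM.
    have -> : (0 <= U_(j))%MM by apply/mnm_lepP => l; rewrite mnm0E.
    by rewrite subm0 !mxE.
  congr (_ *+ nat_of_bool _); apply/eqP/eqP => [/mnmP /(_ j)|->//].
  by rewrite !mnm1E eqxx; case: eqP.
by rewrite wdeg1 mdeg1.
Qed.

(** The one-sided inverse v has an invertible jacobian too, so it has a one-sided inverse of its
    own; [csubst v] is then inverse to [csubst z] on both sides. *)
Lemma csubst_bijective z : coordinates z ->
  exists v : 'I_n -> cps n K, cancel (csubst z) (csubst v) /\ cancel (csubst v) (csubst z).
Proof.
move=> /coordinates_jacobian0[z0 Jz].
have [v [v0 vz]] := right_inverse z0 Jz.
have vzK : cancel (csubst z) (csubst v).
  by move=> f; rewrite csubst_comp -[RHS]csubst_id; congr csubst; apply/funext.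
have Jv : jacobian0 v \in unitmx.
  by have /mulmx1_unit[] := csubst_jacobian0 z0 v0 vz.
have [u [u0 uv]] := right_inverse v0 Jv.
have uvK : cancel (csubst v) (csubst u).
  by move=> f; rewrite csubst_comp -[RHS]csubst_id; congr csubst; apply/funext.
exists v; split=> // f.
by rewrite -[RHS]uvK -[in RHS](vzK (csubst v f)) uvK.
Qed.

End InverseFunction.

(** * The dimension of the ring of convergent power series *)

Section IdealLemmas.
Variable S : comNzRingType.
Implicit Types (I J P Q : ideal S) (x y : S).

Lemma idealN I x : x \in I -> - x \in I.
Proof. by rewrite -mulN1r => /(idealMl (-1)). Qed.

Lemma idealB I x y : x \in I -> y \in I -> x - y \in I.
Proof. by move=> xI yI; rewrite idealD ?idealN. Qed.

Lemma ideal_gen_sub (A : S -> Prop) I :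
  (forall a, A a -> a \in I) -> {subset ideal_gen A <= I}.
Proof. by move=> AI x /asboolP; apply. Qed.

Lemma mem_ideal_gen (A : S -> Prop) a : A a -> a \in ideal_gen A.
Proof. by move=> Aa; apply/asboolP => J; apply. Qed.

Lemma principalP f x : (x \in principal f) <-> exists c, x = c * f.
Proof.
split=> [|[c ->]]; last by apply/idealMl/mem_ideal_gen.
have cl : submod_closed ([pred x | `[< exists c, x = c * f >]] : {pred S^o}).
  split=> [|a u v /asboolP[c ->] /asboolP[d ->]]; apply/asboolP.
    by exists 0; rewrite mul0r.
  by exists (a * c + d); rewrite mulrDl -mulrA.
move=> /(@ideal_gen_sub _ (Ideal cl)) H; apply/asboolP/H => a ->.
by apply/asboolP; exists 1; rewrite mul1r.
Qed.

Lemma prime_ideal1 P : prime_ideal P -> 1 \notin P.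
Proof. by case. Qed.

Lemma prime_idealM P x y : prime_ideal P -> x * y \in P -> x \in P \/ y \in P.
Proof. by case=> _ PP /PP /orP[]; [left|right]. Qed.

Lemma prime_ideal_prod P (I : Type) (r : seq I) (p : pred I) (F : I -> S) :
  prime_ideal P -> (forall i, p i -> F i \notin P) -> \prod_(i <- r | p i) F i \notin P.
Proof.
move=> PP FP; apply: (big_ind (fun x => x \notin P)) => //; first exact: prime_ideal1.
by move=> x y xP yP; apply/negP => /(prime_idealM PP)[]; apply/negP.
Qed.

Lemma prime_ideal_prodP P (I : finType) (p : pred I) (F : I -> S) :
  prime_ideal P -> \prod_(i | p i) F i \in P -> exists2 i, p i & F i \in P.
Proof.
move=> PP FP; apply: contrapT => nE; move: FP; apply/negP.
by apply: prime_ideal_prod => // i Pi; apply/negP => Fi; apply: nE; exists i.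
Qed.

Lemma prime_idealX P x e : prime_ideal P -> x ^+ e \in P -> x \in P.
Proof.
move=> PP; elim: e => [|e IH].
  by rewrite expr0 => P1; have := prime_ideal1 PP; rewrite P1.
by rewrite exprS => /(prime_idealM PP)[].
Qed.

End IdealLemmas.

Section Incomparability.
Variables (A S : comNzRingType) (psi : {rmorphism A -> S}).
Implicit Types P Q : ideal S.

Definition preim_pred P : {pred A} := [pred x | psi x \in P].

Lemma preim_closed P : submod_closed (preim_pred P : {pred A^o}).
Proof.
split=> [|a x y xP yP]; rewrite !inE ?rmorph0 ?ideal0 //.
by rewrite [a *: x + y]/(a * x + y) rmorphD rmorphM; apply: idealZD.
Qed.

Definition preim_ideal P : ideal A := Ideal (preim_closed P).

Lemma preim_prime P : prime_ideal P -> prime_ideal (preim_ideal P).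
Proof.
move=> PP; split; first by rewrite inE /= rmorph1 prime_ideal1.
move=> u v; rewrite !inE /= rmorphM => /(prime_idealM PP)[] ->//.
by rewrite orbT.
Qed.

(** Descent on the degree of a monic relation for u modulo Q: its constant coefficient contracts
    into P, hence into Q; as u lies outside the prime Q, the relation can be divided by u. At degree
    0 it says that 1 lies in Q. *)
Lemma incomparability P Q : prime_ideal P -> prime_ideal Q -> {subset Q <= P} ->
  (forall u, exists p : {poly A}, p \is monic /\ (map_poly psi p).[u] \in Q) ->
  {subset preim_ideal P <= preim_ideal Q} -> {subset P <= Q}.
Proof.
move=> PP PQ QP int PQ' u uP; apply: contrapT => /negP uQ.
have [p [pm pu]] := int u.
have [d] := ubnP (size p); elim: d => // d IH in p pm pu *; rewrite ltnS => pd.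
have p0 : p != 0 := monic_neq0 pm.
have [s1|s1] := leqP (size p) 1.
  have p1 : p = 1 by rewrite (size1_polyC s1) in pm *; move: pm; rewrite monicE lead_coefC => /eqP ->.
  by move: pu; rewrite p1 rmorph1 hornerC; apply/negP/prime_ideal1.
have pE := poly_take_drop 1 p.
set q := drop_poly 1 p in pE; set c := take_poly 1 p in pE.
have cE : c = (c`_0)%:P by apply: size1_polyC; apply: size_take_poly.
have puE : (map_poly psi p).[u] = psi c`_0 + (map_poly psi q).[u] * u.
  rewrite -pE {1}cE expr1 rmorphD rmorphM /= map_polyC map_polyX !hornerE.
  by [].
have qm : q \is monic.
  rewrite monicE lead_coefE size_drop_poly coef_drop_poly subn1 addn1 prednK.
    by rewrite -lead_coefE -monicE.
  by rewrite -ltnS prednK // ltnW.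
have cQ : psi c`_0 \in Q.
  suff : c`_0 \in preim_ideal Q by [].
  apply: PQ'; rewrite inE /= (_ : psi _ = (map_poly psi p).[u] - (map_poly psi q).[u] * u).
    by apply: idealB; [apply: QP|apply: idealMl].
  by rewrite puE addrK.
have : (map_poly psi q).[u] * u \in Q.
  by rewrite (_ : _ * u = (map_poly psi p).[u] - psi c`_0) ?idealB // puE addrC addKr.
move=> /(prime_idealM PQ)[qu|]; last exact/negP.
apply: (IH q) => //; rewrite size_drop_poly subn1.
by apply: leq_trans pd; rewrite ltn_predL; apply: leq_trans s1.
Qed.

End Incomparability.

(** f is taken in the second smallest prime of the chain and outside the smallest. All primes but
    the smallest contain f, so integrality modulo f keeps their inclusions strict after contraction,
    and the chain loses one step only. *)
Lemma height_ge_preim (S : comNzRingType) (k : nat) (P : ideal S) :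
  prime_ideal P -> height_ge P k.+1 ->
  exists2 f : S, f != 0 & f \in P /\
    forall (A : comNzRingType) (psi : {rmorphism A -> S}),
    (forall u, exists p : {poly A}, p \is monic /\ (map_poly psi p).[u] \in principal f) ->
    height_ge (preim_ideal psi P) k.
Proof.
elim: k P => [|k IH] P PP [Q [PQ QP PQN hQ]].
  have [f [fP fQ]] : exists f, f \in P /\ f \notin Q.
    by apply: contrapT => nE; apply: PQN => f fP; apply: contrapT => /negP fQ; apply: nE; exists f.
  by exists f => //; apply: contraNneq fQ => ->; apply: ideal0.
have [f f0 [fQ H]] := IH Q PQ hQ; exists f => //; split; first exact: QP.
move=> A psi int; exists (preim_ideal psi Q); split.
- exact: preim_prime.
- by move=> x; rewrite !inE /=; apply: QP.
- move=> sub; apply: PQN; apply: (@incomparability _ _ psi P Q) => // u.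
  have [p [pm /principalP[c pu]]] := int u; exists p; split=> //.
  by rewrite pu; apply: idealMl.
- exact: H.
Qed.

(** * Making a series regular in one variable, Weierstrass finiteness *)

Section Kill.
Variables (K : numFieldType) (n : nat) (T : {pred 'I_n}).

Definition kill : cps n K -> cps n K := csubst (fun i => if i \in T then 0 else X_ K i).
HB.instance Definition _ := GRing.RMorphism.on kill.

Lemma killE f k :
  kill f k = if [forall i in T, k i == 0%N] then f k else 0.
Proof.
set z := fun i => if i \in T then 0 else X_ K i.
have powE a : zpow z a = if [forall i in T, a i == 0%N] then monom 1 a else 0.
  rewrite /zpow; have zc i : centre z i = z i.
    by rewrite centreK // /z; case: ifP => // _; apply: X_0.
  case: ifPn => [/forall_inP aT|/forall_inPn[i iT ai]]; last first.
    by rewrite (bigD1 i) //= zc /z iT expr0n (negPf ai) mul0r.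
  rewrite (eq_bigr (fun i => monom 1 (U_(i) *+ a i)%MM)) => [|i _].
    by rewrite prod_monom big1_eq -multinomUE_id.
  rewrite zc /z; case: ifP => [/aT/eqP->|_]; first by rewrite expr0 mulm0n monom1.
  by rewrite monomX expr1n.
rewrite [LHS](csubstE _ _ (ltnSn _)).
rewrite (bigD1 (BMultinom (ltnSn (mdeg k)))) //= powE big1 ?addr0 => [|l].
  by case: ifP; rewrite ?coef_monom ?eqxx ?mulr1 ?cps0E ?mulr0.
rewrite bmeqP /= powE; case: ifP => _; last by rewrite cps0E mulr0.
by rewrite coef_monom eq_sym => /negPf ->; rewrite mulr0.
Qed.

Lemma killX i : kill (X_ K i) = if i \in T then 0 else X_ K i.
Proof. by rewrite [LHS]csubst_X //; case: ifP => // _; rewrite X_0. Qed.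

Lemma kill_monom c a :
  kill (monom c a) = if [forall i in T, a i == 0%N] then monom c a else 0.
Proof.
apply: cpsP => k; rewrite killE coef_monom; have [->|ka] := eqVneq k a.
  by case: ifP; rewrite ?coef_monom ?eqxx.
by case: ifP; case: ifP; rewrite ?coef_monom ?(negPf ka) // mulr0n.
Qed.

Lemma kill_csubst m (z : 'I_m -> cps n K) f :
  kill (csubst z f) = csubst (fun i => kill (z i)) f.
Proof. exact: csubst_comp. Qed.

End Kill.

(** The lexicographic order here gives most weight to the last index, in accordance with the
    exponents B^i of the shear. The coordinates are minimised one at a time, from the last
    downwards. *)
Lemma lex_min n (P : pred 'X_{1..n}) : (exists a, P a) -> exists2 a, P a &
  forall b, P b -> b = a \/
    exists i : 'I_n, (a i < b i)%N /\ forall j : 'I_n, (i < j)%N -> b j = a j.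
Proof.
move=> exP.
have /(_ n (leqnn n))[a Pa aP] m : (m <= n)%N -> exists2 a, P a & forall b, P b ->
    (forall j : 'I_n, (n - m <= j)%N -> b j = a j) \/
    exists i : 'I_n, (a i < b i)%N /\ forall j : 'I_n, (i < j)%N -> b j = a j.
  elim: m => [|m IH] mn.
    by case: exP => a Pa; exists a => // b _; left => j; rewrite subn0 leqNgt ltn_ord.
  have [a Pa aP] := IH (ltnW mn).
  have im : (n - m.+1 < n)%N by rewrite ltn_subrL (leq_trans _ mn).
  pose i := Ordinal im.
  pose Q v := `[< exists b, [/\ P b, forall j : 'I_n, (n - m <= j)%N -> b j = a j & b i = v] >].
  have exQ : exists v, Q v by exists (a i); apply/asboolP; exists a.
  case: (ex_minnP exQ) => v /asboolP[a' [Pa' a'a a'v]] vmin.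
  exists a' => // b Pb; have [ba|[l [abl ba]]] := aP b Pb; last first.
    have [ml|lm] := leqP (n - m) l.
      right; exists l; rewrite a'a //; split=> // j lj; rewrite ba // a'a //.
      exact: leq_trans ml (ltnW lj).
    have lb : forall j : 'I_n, (n - m <= j)%N -> b j = a j.
      by move=> j mj; apply: ba; apply: leq_trans lm mj.
    have vb : (v <= b i)%N by apply: vmin; apply/asboolP; exists b.
    rewrite leq_eqVlt in vb; case/orP: vb => [/eqP vb|vb].
      left=> j; rewrite leq_eqVlt => /orP[/eqP ji|ij].
        by rewrite (_ : j = i) -?vb //; apply/val_inj.
      by rewrite lb ?a'a // -subnSK.
    right; exists i; rewrite a'v; split=> // j ij.
    by rewrite lb ?a'a // -subnSK.
  have vb : (v <= b i)%N by apply: vmin; apply/asboolP; exists b.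
  rewrite leq_eqVlt in vb; case/orP: vb => [/eqP vb|vb].
    left=> j; rewrite leq_eqVlt => /orP[/eqP ji|ij].
      by rewrite (_ : j = i) -?vb //; apply/val_inj.
    by rewrite ba ?a'a // -subnSK.
  right; exists i; rewrite a'v; split=> // j ij.
  by rewrite ba ?a'a // -subnSK.
exists a => // b /aP[ba|]; last by right.
by left; apply/mnmP => j; apply: ba; rewrite subnn.
Qed.

Section Shear.
Variables (K : numFieldType) (n : nat).
Local Notation S := (cps n.+1 K).

(** Change of variables in the style of Nagata's proof of Noether normalisation. For B > 1 the added
    exponents are at least 2, so the jacobian at 0 is the identity. *)
Definition shear (B : nat) (i : 'I_n.+1) : S :=
  if i == ord0 then X_ K ord0 else X_ K i + monom 1 (U_(ord0) *+ B ^ i)%MM.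

Definition other_vars : {pred 'I_n.+1} := [pred i | i != ord0].

Lemma coef_pure_power (g : S) d : kill other_vars g (U_(ord0) *+ d)%MM = g (U_(ord0) *+ d)%MM.
Proof.
rewrite killE ifT //; apply/forall_inP => i; rewrite inE => /negPf i0.
by rewrite mulmnE mnm1E [ord0 == i]eq_sym i0.
Qed.

Lemma shear_0 B i : (1 < B)%N -> shear B i 0%MM = 0.
Proof.
move=> B1; rewrite /shear; case: eqP => _; first exact: X_0.
rewrite cpsDE X_0 coef_monom add0r eq_sym -mdeg_eq0 mdegMn mdeg1 mul1n expn_eq0.
by rewrite (negPf (lt0n_neq0 (ltnW B1))).
Qed.

Lemma shear_coordinates B : (1 < B)%N -> coordinates (shear B).
Proof.
move=> B1; apply: jacobian0_coordinates => [i|]; first exact: shear_0.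
rewrite (_ : jacobian0 _ = 1%:M) ?unitmx1 //; apply/matrixP => i j; rewrite !mxE.
have XE (l : 'I_n.+1) : X_ K l U_(j)%MM = (l == j)%:R.
  rewrite coef_monom; congr (_ *+ nat_of_bool _).
  by apply/eqP/eqP => [/mnmP /(_ j)|->//]; rewrite !mnm1E eqxx; case: eqP.
rewrite /shear; case: eqP => [->|/eqP i0]; first exact: XE.
rewrite cpsDE XE coef_monom.
suff /negPf -> : U_(j)%MM != (U_(ord0) *+ B ^ i)%MM :> 'X_{1..n.+1} by rewrite addr0.
apply/eqP => /(congr1 mdeg); rewrite mdeg1 mdegMn mdeg1 mul1n => /esym/eqP.
by rewrite gtn_eqF // -[1%N](expn0 B) ltn_exp2l // lt0n.
Qed.

(** On the axis where all other variables vanish, the shear turns x^k into x_0 to the power sum_i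
    B^i k_i. *)
Lemma shear_pure_power B (f : S) d : (1 < B)%N ->
  csubst (shear B) f (U_(ord0) *+ d)%MM =
  \sum_(k : 'X_{1..n.+1 < d.+1} | wdeg (fun i => B ^ i)%N k == d) f k.
Proof.
move=> B1; rewrite -coef_pure_power kill_csubst.
have d1 : (mdeg (U_(ord0 : 'I_n.+1) *+ d)%MM < d.+1)%N by rewrite mdegMn mdeg1 mul1n.
rewrite (csubstE _ _ d1) [RHS]big_mkcond; apply: eq_bigr => k _.
set v := fun i => kill _ _.
have vE i : v i = monom 1 (U_(ord0) *+ B ^ i)%MM.
  have killU e : kill other_vars (monom 1 (U_(ord0) *+ e)%MM) = monom 1 (U_(ord0) *+ e)%MM :> S.
    rewrite kill_monom ifT //; apply/forall_inP => l; rewrite inE => /negPf l0.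
    by rewrite mulmnE mnm1E [ord0 == l]eq_sym l0.
  rewrite /v /shear; case: eqP => [->|/eqP i0]; first exact: (killU 1%N).
  by rewrite rmorphD /= killU killX inE i0 add0r.
have vc i : centre v i = monom 1 (U_(ord0) *+ B ^ i)%MM.
  rewrite centreK vE // coef_monom eq_sym -mdeg_eq0 mdegMn mdeg1 mul1n expn_eq0.
  by rewrite (negPf (lt0n_neq0 (ltnW B1))).
rewrite /zpow; under eq_bigr => i _ do rewrite vc monomX expr1n.
rewrite prod_monom big1_eq coef_monom.
have -> : (\sum_(i < n.+1) U_(ord0) *+ (B ^ i)%N *+ k i)%MM =
          (U_(ord0) *+ wdeg (fun i : 'I_n.+1 => B ^ i)%N k)%MM :> 'X_{1..n.+1}.
  apply/mnmP => l; rewrite mnm_sumE !mulmnE /wdeg big_distrr; apply: eq_bigr => i _.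
  by rewrite !mulmnE -mulnA.
have -> : ((U_(ord0) *+ d)%MM == (U_(ord0) *+ wdeg (fun i : 'I_n.+1 => B ^ i)%N k)%MM :> 'X_{1..n.+1}) =
          (wdeg (fun i : 'I_n.+1 => B ^ i)%N k == d).
  apply/eqP/eqP => [/(congr1 mdeg)|->//].
  by rewrite !mdegMn !mdeg1 !mul1n => /esym.
by case: eqP; rewrite ?mulr1 ?mulr0.
Qed.

(* If a is the lexicographically smallest exponent of f, then for B > |a| the
   exponent sum_i B^i k_i attains its minimum over the exponents k of f only at a. *)
Lemma shear_regular (f : S) : f != 0 -> exists B d, [/\ (1 < B)%N,
  csubst (shear B) f (U_(ord0) *+ d)%MM != 0 &
  forall j, (j < d)%N -> csubst (shear B) f (U_(ord0) *+ j)%MM = 0].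
Proof.
move=> f0; have [a fa aP] := @lex_min _ (fun a => f a != 0) (let: ex_intro2 a fa _ := min_supp f0 in ex_intro _ a fa).
pose B := (mdeg a).+2; pose c k := wdeg (fun i : 'I_n.+1 => B ^ i)%N k.
have ac b : f b != 0 -> b = a \/ (c a < c b)%N.
  move=> /aP[->|[i [abi ba]]]; [by left|right].
  rewrite /c /wdeg !(bigID (fun j : 'I_n.+1 => (i < j)%N) xpredT) /=.
  rewrite [X in (_ < X + _)%N](eq_bigr (fun j : 'I_n.+1 => B ^ j * a j)%N); last by move=> j ij; rewrite ba.
  rewrite ltn_add2l.
  rewrite (bigD1 i) ?ltnn //= [X in (_ < X)%N](bigD1 i) ?ltnn //=.
  apply: leq_trans (leq_addr _ _).
  apply: (@leq_trans (B ^ i * (a i).+1)%N); last by rewrite leq_mul2l abi orbT.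
  rewrite mulnS [X in (_ < X)%N]addnC ltn_add2l.
  (* It remains to bound the digits of a below index i: there are none for i = 0, and otherwise they
     contribute at most |a| B^(i-1) < B^i. *)
  case: i abi ba => [[|i] ilt] abi ba.
    rewrite big1 ?expn_gt0 // => j; rewrite -leqNgt leqn0 => /andP[/eqP j0].
    by rewrite -val_eqE /= j0.
  rewrite /= expnS; apply: (@leq_ltn_trans (mdeg a * B ^ i)%N); last first.
    by rewrite ltn_mul2r expn_gt0 /= /B ltnS.
  rewrite mdegE big_distrl /= [X in (_ <= X)%N](bigID (fun j : 'I_n.+1 => ~~ (i.+1 < j)%N && (j != Ordinal ilt))) /=.
  apply: leq_trans (leq_addr _ _); apply: leq_sum => j /andP[ij ji].
  rewrite mulnC leq_mul2l leq_exp2l // orbC; apply/orP; left.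
  by rewrite -leqNgt leq_eqVlt ltnS in ij; case/orP: ij => // /eqP ij; rewrite -val_eqE /= ij eqxx in ji.
exists B, (c a); split=> //.
  rewrite shear_pure_power //.
  have ad : (mdeg a < (c a).+1)%N.
    by rewrite ltnS; apply: mdeg_le_wdeg => i; rewrite expn_gt0.
  rewrite (bigD1 (BMultinom ad)) //= big1 ?addr0 // => k /andP[/eqP ck].
  rewrite bmeqP /= => ka; apply/eqP; apply: contraNT ka => /ac[->//|].
  by rewrite /c ck ltnn.
move=> j ja; rewrite shear_pure_power // big1 // => k /eqP ck.
apply/eqP; apply: contraLR ja => /ac; rewrite /c ck => -[ka|]; last by rewrite -leqNgt => /ltnW.
by rewrite -ck ka -leqNgt.
Qed.

End Shear.

(** The determinant trick: the adjugate of u - M turns (u - M) v, whose entries lie in J, into det(u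
    - M) v, and v has an entry 1. *)
Lemma integral_of_matrix (A S : comNzRingType) (psi : {rmorphism A -> S}) (J : ideal S)
    d (v : 'cV[S]_d.+1) (M : 'M[A]_d.+1) (u : S) :
  v ord0 ord0 = 1 ->
  (forall i, u * v i ord0 - \sum_j psi (M i j) * v j ord0 \in J) ->
  (map_poly psi (char_poly M)).[u] \in J.
Proof.
move=> v0 H; pose D := u%:M - map_mx psi M.
have detD : (map_poly psi (char_poly M)).[u] = \det D.
  rewrite map_char_poly /char_poly -[LHS]/(horner_eval u _) -det_map_mx; congr (\det _).
  apply/matrixP => i j; rewrite !mxE /= /horner_eval hornerD hornerN hornerC hornerMn hornerX.
  by [].
have Dv i : (D *m v) i ord0 \in J.
  have -> : (D *m v) i ord0 = u * v i ord0 - \sum_j psi (M i j) * v j ord0.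
    rewrite mulmxBl mul_scalar_mx !mxE; congr (_ - _).
    by apply: eq_bigr => j _; rewrite mxE.
  exact: H.
have : \det D * v ord0 ord0 = (\adj D *m (D *m v)) ord0 ord0.
  by rewrite mulmxA mul_adj_mx mul_scalar_mx mxE.
rewrite detD v0 mulr1 => ->; rewrite mxE; apply: ideal_sum => i _.
exact: idealMl.
Qed.

Section Weierstrass.
Variables (K : numFieldType) (n : nat).
Local Notation S := (cps n.+1 K).

Definition first_var : {pred 'I_n.+1} := pred1 ord0.
Definition forget_first : 'I_n.+1 -> cps n K := fun i => if unlift ord0 i is Some j then X_ K j else 0.
Definition lift_vars : 'I_n -> S := fun i => X_ K (lift ord0 i).

Lemma lift_drop f : csubst lift_vars (csubst forget_first f) = kill first_var f.
Proof.
rewrite csubst_comp; congr csubst; apply/funext => i; rewrite inE /forget_first.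
case: unliftP => [j ->|->] /=; last by rewrite ?eqxx rmorph0.
by rewrite csubst_X // X_0.
Qed.

Lemma low_degree_sum d (r : S) : (forall k, (U_(ord0) *+ d <= k)%MM -> r k = 0) ->
  r = \sum_(j < d) kill first_var (shift (U_(ord0) *+ j)%MM r) * X_ K ord0 ^+ j.
Proof.
move=> rd; apply: cpsP => k; rewrite cps_sumE.
have leU j (a : 'X_{1..n.+1}) : (U_(ord0) *+ j <= a)%MM = (j <= a ord0)%N.
  apply/mnm_lepP/idP => [/(_ ord0)|ja i]; first by rewrite mulmnE mnm1E eqxx mul1n.
  by rewrite mulmnE mnm1E; case: eqP => [<-|_]; rewrite ?mul1n ?mul0n.
have E (j : 'I_d) : (kill first_var (shift (U_(ord0) *+ j)%MM r) * X_ K ord0 ^+ j) k =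
    if j == k ord0 :> nat then r k else 0.
  rewrite monomX expr1n mulrC coef_monomM leU mul1r killE.
  case: leqP => jk; last by rewrite gtn_eqF.
  have -> : [forall i in first_var, (k - U_(ord0) *+ j)%MM i == 0%N] = (j == k ord0 :> nat).
    apply/forall_inP/eqP => [/(_ ord0)|jk' i].
      rewrite inE eqxx => /(_ isT); rewrite mnmBE mulmnE mnm1E eqxx mul1n subn_eq0 => kj.
      by apply/eqP; rewrite eqn_leq jk.
    by rewrite inE => /eqP ->; rewrite mnmBE mulmnE mnm1E eqxx mul1n jk' subnn.
  by case: eqP => // jk'; rewrite shiftE submK // leU.
under eq_bigr do rewrite E.
have [dk|kd] := leqP d (k ord0).
  by rewrite rd ?leU // big1 // => j _; rewrite if_same.
rewrite (bigD1 (Ordinal kd)) //= eqxx big1 ?addr0 // => j.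
by rewrite -val_eqE /= => /negPf ->.
Qed.

Lemma weierstrass_finite (f : S) : f != 0 ->
  exists psi : {rmorphism cps n K -> S}, forall u,
    exists p : {poly cps n K}, p \is monic /\ (map_poly psi p).[u] \in principal f.
Proof.
move=> /shear_regular[B [d [B1 fd fj]]].
have [v [thK vK]] := csubst_bijective (@shear_coordinates K n B B1).
(* The n variables are embedded as the last n ones and the shear is then undone, so that finiteness
   is reached modulo f itself rather than its sheared form. *)
pose psi : {rmorphism cps n K -> S} := csubst v \o csubst lift_vars.
exists psi => u.
pose c := csubst (shear K B) f (U_(ord0) *+ d)%MM.
pose p := monom 1 (U_(ord0) *+ d)%MM - monom c^-1 0%MM * csubst (shear K B) f.
(* With weight d + 1 on the other variables, a monomial of weight at most d is a power x_0^j with j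
   <= d; there p vanishes by the choice of d and of the factor c^-1. *)
pose w (i : 'I_n.+1) := if i == ord0 then 1%N else d.+1.
have w0 i : (0 < w i)%N by rewrite /w; case: ifP.
have pw k : p k != 0 -> (wdeg w (U_(ord0) *+ d)%MM < wdeg w k)%N.
  rewrite wdegMn wdegU /w eqxx mul1n; apply: contraNltn => kd; apply/eqP.
  have kE : k = (U_(ord0) *+ k ord0)%MM.
    apply/mnmP => i; rewrite mulmnE mnm1E; case: eqP => [<-|/eqP i0]; first by rewrite mul1n.
    rewrite mul0n; apply/eqP; rewrite -leqn0 leqNgt; apply/negP => ki.
    move: kd; rewrite /wdeg (bigD1 i) //= [i == _]eq_sym (negPf i0) leqNgt.
    by rewrite (leq_trans _ (leq_addr _ _)) // leq_pmulr.
  have kd' : (k ord0 <= d)%N.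
    by move: kd; rewrite /wdeg (bigD1 ord0) //= ?eqxx mul1n; apply: leq_trans; apply: leq_addr.
  rewrite cpsBE coef_monomM (_ : (0 <= k)%MM) ?subm0; last by apply/mnm_lepP => i; rewrite mnm0E.
  rewrite kE coef_monom; move: kd'; rewrite leq_eqVlt => /orP[/eqP ->|kd'].
    by rewrite eqxx mulVf ?subrr.
  rewrite fj // mulr0 subr0; case: eqP => // /(congr1 mdeg).
  by rewrite !mdegMn mdeg1 !mul1n => kd2; rewrite kd2 ltnn in kd'.
have [q qP] := choice (fun i : 'I_d.+1 => division (csubst (shear K B : 'I_n.+1 -> _) u * X_ K ord0 ^+ i) w0 pw).
have [r rP] := choice qP.
have fE : monom 1 (U_(ord0) *+ d)%MM - p = monom c^-1 0%MM * csubst (shear K B) f.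
  by rewrite /p opprB addrC subrK.
(* Multiplication by the sheared u on 1, x_0, ..., x_0^d modulo the sheared f, read off from the
   remainders. With d + 1 powers the matrix is nonempty also for d = 0. *)
pose M : 'M[cps n K]_d.+1 := \matrix_(i, j) csubst forget_first (shift (U_(ord0) *+ j)%MM (r i)).
exists (char_poly M); split; first exact: char_poly_monic.
pose x : 'cV[S]_d.+1 := \col_i csubst v (X_ K ord0 ^+ i).
apply: (@integral_of_matrix _ _ psi _ _ x) => [|i]; first by rewrite mxE expr0 rmorph1.
rewrite mxE; under eq_bigr => j _ do rewrite !mxE /= lift_drop -csubstM.
rewrite -(thK u) -csubstM -rmorph_sum -low_degree_sum => [|k dk]; last first.
  have [_] := rP i; apply; apply: lepm_trans dk; apply/mnm_lepP => l.
  by rewrite !mulmnE leq_mul2l leqnSn orbT.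
rewrite -rmorphB; have [-> _] := rP i; rewrite addrK fE /= !csubstM thK.
by apply/principalP; exists (csubst v (q i) * csubst v (monom c^-1 0%MM)); rewrite mulrA.
Qed.

End Weierstrass.

Lemma cps0_unit (K : numFieldType) (f : cps 0 K) : f != 0 -> exists g, f * g = 1.
Proof.
move=> f0; apply: cps_unit; apply: contraNneq f0 => f00; apply/eqP/cpsP => a.
by rewrite (_ : a = 0%MM) ?f00 //; apply/mnmP => -[].
Qed.

Theorem dimension_le (K : numFieldType) n (P : ideal (cps n K)) :
  prime_ideal P -> ~ height_ge P n.+1.
Proof.
elim: n P => [|n IH] P PP.
  move=> [Q [PQ QP PQN _]]; apply: PQN => f fP; have [->|/cps0_unit[g fg]] := eqVneq f 0.
    exact: ideal0.
  by have := prime_ideal1 PP; rewrite -fg mulrC idealMl.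
move=> /(height_ge_preim PP)[f f0 [fP H]].
have [psi psiP] := weierstrass_finite f0.
exact: (IH (preim_ideal psi P) (preim_prime psi PP) (H _ psi psiP)).
Qed.

(** * Coordinate ideals and the hypersurface *)

(** One variable at a time: division by X_i with p = 0 writes a series as q X_i + r, and setting X_i
    to 0 leaves exactly r. *)
Lemma sub_kill_in_ideal (K : numFieldType) N (T : {set 'I_N}) (I : ideal (cps N K)) (u : cps N K) :
  (forall i, i \in T -> X_ K i \in I) -> u - kill (mem T) u \in I.
Proof.
have [m] := ubnP #|T|; elim: m T u => // m IHm U u; rewrite ltnS => Um.
have [-> _|[i iU]] := set_0Vmem U.
  rewrite (_ : kill _ u = u) ?subrr ?ideal0 //; apply: cpsP => k.
  by rewrite killE ifT //; apply/forall_inP => i; rewrite inE.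
rewrite -(setD1K iU); set T := U :\ i => XI.
have IH : (forall i, i \in T -> X_ K i \in I) -> u - kill (mem T) u \in I.
  by apply: IHm; move: Um; rewrite (cardsD1 i) iU.
have kE : kill (mem (i |: T)) u = kill (pred1 i) (kill (mem T) u).
  apply: cpsP => k; rewrite !killE; case: ifPn => [/forall_inP kT|/forall_inPn[j jT kj]].
    rewrite !ifT //; first by apply/forall_inP => j jT; apply: kT; rewrite inE jT orbT.
    by apply/forall_inP => j; rewrite inE => /eqP ->; apply: kT; rewrite !inE eqxx.
  case: ifP => // /forall_inP ki; rewrite ifF //; apply/negbTE/forall_inPn.
  exists j => //; move: jT; rewrite !inE => /orP[/eqP ji|//].
  by move: (ki j); rewrite inE ji eqxx => /(_ isT); rewrite -ji (negPf kj).
rewrite kE; set v := kill (mem T) u.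
have -> : u - kill (pred1 i) v = (u - v) + (v - kill (pred1 i) v).
  by rewrite addrA subrK.
apply: idealD; first by apply: IH => j jT; apply: XI; rewrite inE jT orbT.
have w0 (l : 'I_N) : (0 < (fun=> 1) l)%N by [].
have p0 k : (0 : cps N K) k != 0 -> (wdeg (fun=> 1%N) (U_(i)%MM : 'X_{1..N}) < wdeg (fun=> 1%N) k)%N.
  by rewrite cps0E eqxx.
have [q [r [E rk]]] := division v w0 p0.
rewrite subr0 in E.
have kr : kill (pred1 i) r = r.
  apply: cpsP => k; rewrite killE; case: ifPn => // /forall_inPn[j]; rewrite inE => /eqP -> ki.
  by rewrite rk // lep1mP.
rewrite {2}E rmorphD rmorphM /= killX inE eqxx mulr0 add0r kr E addrK.
by apply: idealMl; apply: XI; rewrite !inE eqxx.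
Qed.

Section CoordinateIdeals.
Variables (K : numFieldType) (N : nat) (Z : 'I_N -> cps N K) (hZ : coordinates Z).
Local Notation S := (cps N K).
Implicit Types (T U : {set 'I_N}) (u v : S).

Definition cideal T : ideal S := ideal_gen (fun x => exists2 i, i \in T & x = Z i).

Lemma cideal_Z T i : i \in T -> Z i \in cideal T.
Proof. by move=> iT; apply: mem_ideal_gen; exists i. Qed.

Lemma cideal_sub T (I : ideal S) : (forall i, i \in T -> Z i \in I) -> {subset cideal T <= I}.
Proof. by move=> ZI; apply: ideal_gen_sub => a [i iT ->]; apply: ZI. Qed.

Let Z0 i : Z i 0%MM = 0. Proof. by case: hZ. Qed.

(** The quotient by the coordinate ideal of T is realised inside the ring itself, by setting the Z_i
    with i in T to 0. Membership becomes the vanishing of rho, and primality follows from the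
    absence of zero divisors. *)
Lemma retraction T : exists rho : {rmorphism S -> S},
  (forall i, rho (Z i) = if i \in T then 0 else Z i) /\
  forall (I : ideal S) u, (forall i, i \in T -> Z i \in I) -> u - rho u \in I.
Proof.
have [v [ZK vK]] := csubst_bijective hZ.
exists (csubst Z \o (kill (mem T) \o csubst v) : {rmorphism S -> S}); split=> [i|I u ZI] /=.
  rewrite -{1}(csubst_X (Z0 i)) ZK killX -[i \in mem T]/(i \in T).
  by case: ifP => _; rewrite ?rmorph0 ?csubst_X.
have := @sub_kill_in_ideal K N T (preim_ideal (csubst Z) I) (csubst v u).
rewrite inE /= rmorphB /= vK; apply=> i iT; rewrite inE /= csubst_X //; exact: ZI.
Qed.

Lemma Z_neq0 i : Z i != 0.
Proof.
have [v [ZK _]] := csubst_bijective hZ; rewrite -(csubst_X (Z0 i)).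
apply/eqP => /(congr1 (csubst v)); rewrite ZK rmorph0 => /(congr1 (fun f : S => f U_(i)%MM)).
by rewrite coef_monom eqxx => /eqP; rewrite oner_eq0.
Qed.

Lemma mem_cideal T (rho : {rmorphism S -> S}) u :
  (forall i, rho (Z i) = if i \in T then 0 else Z i) ->
  (forall (I : ideal S) u, (forall i, i \in T -> Z i \in I) -> u - rho u \in I) ->
  (u \in cideal T) <-> rho u = 0.
Proof.
move=> rZ rI; split=> [uT|ru].
  pose zero := cideal set0.
  have cl : submod_closed ([pred x | x == 0] : {pred S^o}).
    by split=> [|a x y]; rewrite !inE // => /eqP -> /eqP ->; rewrite scaler0 addr0.
  have : u \in preim_ideal rho (Ideal cl).
    by move: uT; apply: cideal_sub => i iT; rewrite !inE rZ iT.
  by rewrite !inE => /eqP.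
by rewrite -[u]subr0 -ru; apply: rI => i iT; apply: cideal_Z.
Qed.

Lemma cideal_Z_iff T i : (Z i \in cideal T) = (i \in T).
Proof.
have [rho [rZ rI]] := retraction T.
apply/idP/idP => [/(mem_cideal _ rZ rI)|]; last exact: cideal_Z.
by rewrite rZ; case: ifP => // _ /eqP; rewrite (negPf (Z_neq0 i)).
Qed.

Lemma cideal_prime T : prime_ideal (cideal T).
Proof.
have [rho [rZ rI]] := retraction T; have memT u := mem_cideal u rZ rI.
split; first by apply/negP => /memT /eqP; rewrite rmorph1 oner_eq0.
move=> u v /memT; rewrite rmorphM => /cps_mul_eq0[] /memT ->//.
by rewrite orbT.
Qed.

Lemma cideal0 u : u \in cideal set0 -> u = 0.
Proof.
move=> /asboolP.
have cl : submod_closed ([pred x | x == 0] : {pred S^o}).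
  by split=> [|a x y]; rewrite !inE // => /eqP -> /eqP ->; rewrite scaler0 addr0.
by move=> /(_ (Ideal cl)); rewrite inE => H; apply/eqP/H => a [j]; rewrite inE.
Qed.

Lemma cideal_height_step T i k : i \notin T -> height_ge (cideal T) k ->
  height_ge (cideal (i |: T)) k.+1.
Proof.
move=> iT hT; exists (cideal T); split=> //; first exact: cideal_prime.
  by apply: cideal_sub => j jT; apply: cideal_Z; rewrite inE jT orbT.
by move=> /(_ (Z i)); rewrite !cideal_Z_iff !inE eqxx (negPf iT) => /(_ isT).
Qed.

Lemma cideal_height_up T U k : T \subset U -> height_ge (cideal T) k ->
  height_ge (cideal U) (k + #|U :\: T|).
Proof.
have [m] := ubnP #|U :\: T|; elim: m U => // m IH U; rewrite ltnS => Um TU hT.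
have [UT|[i iUT]] := set_0Vmem (U :\: T).
  rewrite UT cards0 addn0 (_ : U = T) //; apply/eqP; rewrite eqEsubset TU andbT.
  by rewrite -setD_eq0 UT.
move: (iUT); rewrite inE => /andP[iT iU].
have -> : U = i |: (U :\ i) by rewrite setD1K.
have E : #|(i |: U :\ i) :\: T| = #|(U :\ i) :\: T|.+1.
  rewrite setD1K // (cardsD1 i) iUT add1n; congr _.+1.
  by apply: eq_card => j; rewrite !inE; case: (j == i) => //=; rewrite andbC.
rewrite E addnS; apply: cideal_height_step; first by rewrite !inE eqxx.
apply: IH => //; first by move: Um; rewrite -{1}(setD1K iU) E.
apply/subsetP => j jT; rewrite !inE (subsetP TU) // andbT.
by apply: contraNneq iT => <-.
Qed.

(** A chain of length |T| + 1 would be prolonged by adjoining the other N - |T| coordinates one by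
    one, to a chain of length N + 1, against [dimension_le]. *)
Lemma cideal_height T : height (cideal T) #|T|.
Proof.
split.
  have := @cideal_height_up set0 T 0 (sub0set _) I.
  by rewrite add0n setD0.
move=> /(cideal_height_up (subsetT T)); rewrite addSn.
have -> : (#|T| + #|[set: 'I_N] :\: T| = N)%N.
  by rewrite setTD cardsC card_ord.
exact/dimension_le/cideal_prime.
Qed.

End CoordinateIdeals.

Section HypersurfacePrime.
Variables (K : numFieldType) (N : nat).
Local Notation S := (cps N K).
Implicit Types (A B : {set 'I_N}) (r : S).

Definition indicator A : 'X_{1..N} := [multinom nat_of_bool (i \in A) | i < N].

Lemma indicatorE A i : indicator A i = (i \in A). Proof. exact: mnmE. Qed.

Lemma prod_X A : \prod_(i in A) X_ K i = monom 1 (indicator A).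
Proof.
rewrite prod_monom big1_eq; congr monom; apply/mnmP => j.
rewrite mnm_sumE indicatorE; case: (boolP (j \in A)) => jA.
  by rewrite (bigD1 j) //= mnm1E eqxx big1 ?addn0 // => i /andP[_ /negPf ij]; rewrite mnm1E ij.
by rewrite big1 // => i iA; rewrite mnm1E; case: eqP => // ij; rewrite -ij iA in jA.
Qed.

Lemma indicatorD1 a A : a \in A -> (U_(a) + indicator (A :\ a))%MM = indicator A.
Proof.
move=> aA; apply/mnmP => i; rewrite mnmDE mnm1E !indicatorE !inE eq_sym.
by case: eqP => [->|_] //; rewrite aA.
Qed.

Section Binomial.
Variables (A B : {set 'I_N}) (a b : 'I_N).
Hypotheses (aA : a \in A) (bB : b \in B) (AB : [disjoint A & B]).

Let bA : b \in A = false.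
Proof. by apply: contraTF AB => bA; apply/pred0Pn; exists b; rewrite /= bA. Qed.
Let aB : a \in B = false.
Proof. by apply: contraTF AB => aB; apply/pred0Pn; exists a; rewrite /= aA. Qed.
Let ab : a == b = false.
Proof. by apply: contraFF aB => /eqP ->. Qed.

Let e i : 'X_{1..N} :=
  if i == a then (U_(a) + indicator (B :\ b))%MM else if i == b then indicator A else U_(i)%MM.
Let c i : K := if i == b then -1 else 1.

(* Z_a -> Z_a prod_(B - b) Z, Z_b -> - prod_A Z *)
Definition chart i : S := monom (c i) (e i).

Let e_neq0 i : e i != 0%MM.
Proof.
rewrite /e; have [_|_] := eqVneq i a; first by rewrite mnmD_eq0 mnm1_eq0.
have [_|_] := eqVneq i b; last by rewrite mnm1_eq0.
by apply/eqP => /mnmP /(_ a); rewrite indicatorE aA mnm0E.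
Qed.

Let chart_0 i : chart i 0%MM = 0.
Proof. by rewrite coef_monom eq_sym (negPf (e_neq0 i)). Qed.

(** Exponent of the image of x^k. The chart sends monomials to signed monomials, so its injectivity
    reduces to that of the additive map L. *)
Let L (k : 'X_{1..N}) : 'X_{1..N} := (\sum_i e i *+ k i)%MM.

Let zpow_chart k : zpow chart k = monom ((-1) ^+ k b) (L k).
Proof.
rewrite /zpow; under eq_bigr => i _ do rewrite (centreK (chart_0 i)) monomX.
rewrite prod_monom; congr monom; rewrite (bigD1 b) //= big1 ?mulr1 /c ?eqxx // => i /negPf ->.
by rewrite expr1n.
Qed.

Let LE k i : L k i = if i == b then 0%N else if i \in A then (k i + k b)%N
  else if i \in B then (k i + k a)%N else k i.
Proof.
rewrite mnm_sumE (bigD1 a) //= (bigD1 b) ?[b == a]eq_sym ?ab //= !mulmnE /e eqxx.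
rewrite [b == a]eq_sym ab eqxx mnmDE mnm1E !indicatorE !inE.
have E (j : 'I_N) : j != a -> j != b ->
  (if j == a then (U_(a) + indicator (B :\ b))%MM else if j == b then indicator A else U_(j)%MM) = U_(j)%MM.
  by move=> /negPf -> /negPf ->.
have [->|ib] /= := eqVneq i b.
  rewrite ab bA big1 // => j /andP[ja jb]; rewrite mulmnE E // mnm1E.
  by rewrite (negPf jb).
have [<-|ia] /= := eqVneq a i.
  rewrite aA aB big1 ?addn0 => [|j /andP[ja jb]]; first by rewrite /=; lia.
  by rewrite mulmnE E // mnm1E (negPf ja).
rewrite eq_sym in ia; rewrite (bigD1 i) ?ib ?ia //= mulmnE E // mnm1E eqxx mul1n.
rewrite [X in (_ + (_ + (_ + X)))%N]big1 ?addn0 => [|j /andP[/andP[ja jb] ji]]; last first.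
  by rewrite mulmnE E // mnm1E (negPf ji).
have := pred0P AB i; rewrite /=.
by case: (i \in A); case: (i \in B) => //= _; lia.
Qed.

(** For i in A the value L k i is k_i + k_b; if k_b is smaller than k'_b, then k_i exceeds k'_i and
    is positive. *)
Let L_lt k k' : L k = L k' -> (k b < k' b)%N -> (indicator A <= k)%MM.
Proof.
move=> LL kb; apply/mnm_lepP => i; rewrite indicatorE; case: (boolP (i \in A)) => // iA.
have := congr1 (fun m : 'X_{1..N} => m i) LL; rewrite /= !LE iA.
case: eqP => [ib|_]; first by rewrite ib bA in iA.
by lia.
Qed.

Let L_inj k k' : ~~ (indicator A <= k)%MM -> ~~ (indicator A <= k')%MM -> L k = L k' -> k = k'.
Proof.
move=> kA k'A LL; have [kb|kb|kb] := ltngtP (k b) (k' b).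
- by rewrite (L_lt LL kb) in kA.
- by rewrite (L_lt (esym LL) kb) in k'A.
have ka : k a = k' a.
  have := congr1 (fun m : 'X_{1..N} => m a) LL; rewrite /= !LE ab aA kb.
  by move/addIn.
apply/mnmP => i; have := congr1 (fun m : 'X_{1..N} => m i) LL; rewrite /= !LE.
case: eqP => [->|_] //; case: ifP => _; first by rewrite kb => /addIn.
by case: ifP => _ //; rewrite ka => /addIn.
Qed.

Lemma chart_inj r : (forall k, (indicator A <= k)%MM -> r k = 0) -> csubst chart r = 0 -> r = 0.
Proof.
move=> rA r0; apply: contrapT => /eqP rn0; have [k rk _] := min_supp rn0.
pose d := maxn (mdeg k).+1 (mdeg (L k)).+1.
have := congr1 (fun f : S => f (L k)) r0.
rewrite (@csubstE _ _ _ d) ?leq_maxr //.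
have kd : (mdeg k < d)%N by rewrite leq_maxl.
rewrite (bigD1 (BMultinom kd)) //= big1 ?addr0 => [|l].
  rewrite zpow_chart coef_monom eqxx mulr1n => /eqP.
  by rewrite mulf_eq0 signr_eq0 orbF (negPf rk).
rewrite bmeqP /= zpow_chart coef_monom => lk.
have [->|rl] := eqVneq (r l) 0; first by rewrite mul0r.
case: eqP => [LL|]; last by rewrite mulr0.
case/eqP: lk; apply: L_inj => //; first by apply: contraNN rl => /rA ->.
by apply: contraNN rk => /rA ->.
Qed.

Lemma binomial_prime : prime_ideal (principal (\prod_(i in A) X_ K i + \prod_(i in B) X_ K i : S)).
Proof.
set h := _ + _; have hE : h = monom 1 (indicator A) - - monom 1 (indicator B) by rewrite /h !prod_X opprK.
have ch : csubst chart h = 0.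
  rewrite /h rmorphD !rmorph_prod /= (bigD1 a) //= [X in _ + X](bigD1 b) //=.
  have XE (D : {set 'I_N}) (x : 'I_N) : (forall i, i \in D :\ x -> (i != a) && (i != b)) ->
      \prod_(i in D | i != x) csubst chart (X_ K i) = monom 1 (indicator (D :\ x)) :> S.
    move=> Dx; rewrite -prod_X [LHS](eq_bigl (mem (D :\ x))) => [|i]; last by rewrite !inE andbC.
    apply: eq_bigr => i /Dx /andP[/negPf ia /negPf ib].
    by rewrite csubst_X // /chart /c /e ia ib.
  rewrite !XE => [|i|i]; last 2 first.
  - by rewrite !inE => /andP[ib iB]; rewrite ib andbT; apply: contraTneq iB => ->; rewrite aB.
  - by rewrite !inE => /andP[ia iA]; rewrite ia /=; apply: contraTneq iA => ->; rewrite bA.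
  rewrite !csubst_X // /chart /c /e !eqxx ab [b == a]eq_sym ab !monomM !mulr1.
  rewrite [(U_(a) + _)%MM]addmC -addmA indicatorD1 // [(indicator A + _)%MM]addmC.
  by apply: cpsP => k; rewrite cpsDE !coef_monom cps0E mulNrn subrr.
have memh u : (u \in principal h) <-> csubst chart u = 0.
  split=> [/principalP[q ->]|cu]; first by rewrite rmorphM /= ch mulr0.
  (* Under these weights prod_A has weight |A|, while a single variable of B already weighs |A| + 1;
     hence prod_A is the leading monomial for the division by h. *)
  pose w (i : 'I_N) := if i \in B then #|A|.+1 else 1%N.
  have w0 i : (0 < w i)%N by rewrite /w; case: ifP.
  have wA : wdeg w (indicator A) = #|A|.
    rewrite /wdeg -sum1_card [RHS]big_mkcond; apply: eq_bigr => i _; rewrite indicatorE /w.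
    case: (boolP (i \in A)) => iA; last by rewrite muln0.
    by case: ifP => // iB; move/pred0P: AB => /(_ i) /=; rewrite iA iB.
  have pw k : (- monom 1 (indicator B) : S) k != 0 -> (wdeg w (indicator A) < wdeg w k)%N.
    rewrite cpsNE coef_monom oppr_eq0; have [-> _|_] := eqVneq k (indicator B); last by rewrite eqxx.
    rewrite wA /wdeg (bigD1 b) //= indicatorE bB /w bB muln1; exact: leq_addr.
  have [q [r [E rA]]] := division u w0 pw.
  rewrite -hE in E; apply/principalP; exists q; rewrite E (chart_inj rA) ?addr0 //.
  by move: cu; rewrite E rmorphD rmorphM /= ch mulr0 add0r.
split; first by apply/negP => /memh /eqP; rewrite rmorph1 oner_eq0.
move=> u v /memh; rewrite rmorphM => /cps_mul_eq0[] /memh ->//.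
by rewrite orbT.
Qed.

End Binomial.
End HypersurfacePrime.

(** * The hypersurface is not free *)

Lemma linZ (S : pzRingType) (V W : lmodType S) (f : {linear V -> W}) c x :
  f (c *: x) = c *: f x.
Proof. exact: linearZ. Qed.

Lemma linB (S : pzRingType) (V W : lmodType S) (f : {linear V -> W}) x y :
  f (x - y) = f x - f y.
Proof. exact: linearB. Qed.

Lemma linD (S : pzRingType) (V W : lmodType S) (f : {linear V -> W}) x y :
  f (x + y) = f x + f y.
Proof. exact: linearD. Qed.

Lemma lin_sum (S : pzRingType) (V W : lmodType S) (f : {linear V -> W})
    (I : Type) (r : seq I) (P : pred I) (F : I -> V) :
  f (\sum_(i <- r | P i) F i) = \sum_(i <- r | P i) f (F i).
Proof. exact: linear_sum. Qed.

Lemma regularZ (S : pzRingType) (c : S) (x : S^o) : c *: x = c * x.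
Proof. by []. Qed.

Section DualBasis.
Import finmap monalg.
Variables (S : comNzRingType) (P : lmodType S).

(** The canonical surjection onto P from the free module on all elements of P; no finite generating
    set is at hand. *)
Definition eval_malg (g : {malg S[P]}) : P := \sum_(k <- msupp g) (mcoeff k g : S) *: k.

Lemma eval_malgEw (d : {fset P}) (g : {malg S[P]}) : (msupp g `<=` d)%fset ->
  eval_malg g = \sum_(k <- d) (mcoeff k g : S) *: k.
Proof.
move=> gd; apply: big_fset_incl => // k kd kg.
by rewrite mcoeff_outdom // scale0r.
Qed.

Fact eval_malg_is_linear : linear eval_malg.
Proof.
move=> a x y; pose d := (msupp x `|` msupp y `|` msupp (a *: x + y))%fset.
rewrite (@eval_malgEw d) ?fsubsetUr // (@eval_malgEw d x); last first.
  exact: fsubset_trans (fsubsetUl _ _) (fsubsetUl _ _).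
rewrite (@eval_malgEw d y); last exact: fsubset_trans (fsubsetUr _ _) (fsubsetUl _ _).
rewrite scaler_sumr -big_split /=; apply: eq_bigr => k _.
by rewrite mcoeffD mcoeffZ scalerDl scalerA.
Qed.

HB.instance Definition _ :=
  GRing.isLinear.Build S {malg S[P]} P *:%R eval_malg eval_malg_is_linear.

Lemma eval_malg_surj (y : P) : exists x, eval_malg x = y.
Proof.
exists (mkmalgU y 1); rewrite (@eval_malgEw [fset y]%fset) ?msuppU_le // big_seq_fset1.
by rewrite mcoeffUU scale1r.
Qed.

(** A resolution of length 0 identifies P with the projective module Q 0. Lifting this
    identification through [eval_malg] gives a section, whose coordinates are the phi k. *)
Lemma projdim0_dual_basis : projdim_le P 0 ->
  exists phi : P -> {linear P -> S^o}, forall x, exists d : {fset P},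
    (forall k, k \notin d -> phi k x = 0) /\ x = \sum_(k <- d) phi k x *: k.
Proof.
move=> [Q [e [del [Qproj Q0 esurj eker delker]]]].
have eI : injective e.
  move=> x y exy; apply/eqP; rewrite -subr_eq0; apply/eqP.
  have /eker[z <-] : e (x - y) = 0 by rewrite linearB exy subrr.
  by rewrite (Q0 1%N isT z) linear0.
have [inv invK] := choice esurj.
have [l lE] := Qproj 0%N _ _ (eval_malg : {linear {malg S[P]} -> P}) e eval_malg_surj.
pose sg (x : P) := l (inv x).
have sg_lin : linear sg.
  move=> a x y; rewrite /sg -linearP; congr (l _); apply: eI.
  by rewrite linearP !invK.
pose ph (k x : P) : S^o := mcoeff k (sg x).
have ph_lin k : linear (ph k).
  by move=> a x y; rewrite /ph sg_lin mcoeffD mcoeffZ.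
pose phl k : {linear P -> S^o} :=
  HB.pack (ph k) (GRing.isLinear.Build S P S^o *:%R (ph k) (ph_lin k)).
exists phl.
move=> x; exists (msupp (sg x)); split=> [k kx|] /=; first exact: mcoeff_outdom.
by rewrite -[LHS]invK -lE.
Qed.

End DualBasis.

Section NotProjective.
Import finmap.
Variables (S : comNzRingType) (I : finType).
Hypothesis dom : forall x y : S, x * y = 0 -> x = 0 \/ y = 0.
Local Notation F := {ffun I -> S^o}.
(** Abstract form of the logarithmic fields: alpha is delta |-> delta(h), iota embeds Der(-log h) as
    the preimage of (h), and E is the Euler field. The values of alpha on v1, v2, v3 form the
    regular sequence. *)
Variables (alpha : {linear F -> S^o}) (P : lmodType S) (iota : {linear P -> F}).
Variables (h : S) (E : P) (v1 v2 v3 : F).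
Let A : S := alpha v1. Let B : S := alpha v2. Let C : S := alpha v3.
Hypothesis iotaI : injective iota.
Hypothesis iotaE : forall d, (exists c, alpha d = c * h) <-> exists x, iota x = d.
Hypotheses (alphaE : alpha (iota E) = h) (h0 : h != 0) (A0 : A != 0).
Hypothesis regB : forall x y, B * x = A * y -> exists z, x = A * z.
Hypothesis regC : forall x y z, C * x = A * y + B * z -> exists y' z', x = A * y' + B * z'.
Hypothesis alpha1 : forall d, alpha d != 1.

Let mulI (a x y : S) : a != 0 -> a * x = a * y -> x = y.
Proof.
move=> a0 /eqP; rewrite -subr_eq0 -mulrBr => /eqP /dom[] /eqP.
  by rewrite (negPf a0).
by rewrite subr_eq0 => /eqP.
Qed.

Let e i : F := [ffun j => (i == j)%:R].

Let ffun_basis (d : F) : d = \sum_i d i *: e i.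
Proof.
apply/ffunP => j; rewrite sum_ffunE (bigD1 j) //= !ffunE eqxx big1 ?addr0 => [|i /negPf ij].
  by rewrite [_ *: _]mulr1.
by rewrite !ffunE ij [_ *: _]mulr0.
Qed.

Let ker_in d : alpha d = 0 -> exists x, iota x = d.
Proof. by move=> d0; apply/iotaE; exists 0; rewrite mul0r. Qed.

(** The Koszul relation between two vectors, as an element of the kernel of alpha inside P. *)
Let kap_ex (ee : F * F) : exists x, iota x = (alpha ee.1 : S) *: ee.2 - (alpha ee.2 : S) *: ee.1.
Proof.
by apply: ker_in; rewrite linB !(linZ alpha) !regularZ mulrC subrr.
Qed.

(* A linear form phi on P extends to F on the kernel of alpha: its values on the
   Koszul relations between A, B, C form a cocycle, hence a coboundary. *)
Lemma not_projective_kernel : ~ projdim_le P 0.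
Proof.
move=> /projdim0_dual_basis[phi phiP].
have [kap kapE] := choice kap_ex.
(* On the kernel, multiplication by A lands in the span of the finitely many relations between v1
   and the basis vectors. *)
have kerE (s : P) : alpha (iota s) = 0 -> A *: s = \sum_i (iota s i : S) *: kap (v1, e i).
  move=> s0; apply: iotaI; rewrite (linZ iota) lin_sum /=.
  under eq_bigr => i _ do rewrite (linZ iota) kapE scalerBr !scalerA /=.
  rewrite big_split /= {1}(ffun_basis (iota s)) scaler_sumr.
  rewrite (eq_bigr (fun i => (iota s i * A : S) *: e i)) => [|i _]; last first.
    by rewrite scalerA mulrC.
  rewrite sumrN -scaler_suml.
  have -> : \sum_i (iota s i * alpha (e i) : S) = alpha (iota s).
    by rewrite {2}(ffun_basis (iota s)) lin_sum; apply: eq_bigr => i _; rewrite (linZ alpha).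
  by rewrite s0 scale0r subr0.
have ext k : exists t : I -> S, forall s : P, alpha (iota s) = 0 ->
    \sum_i (iota s i : S) * t i = phi k s.
  (* Regularity of C modulo (A, B) writes phi(kap (v1, v2)) as A y + B z. Subtracting z alpha, which
     vanishes on the kernel, makes the values at the kap (v1, e i) divisible by A, by regularity of
     B modulo A; the quotients t_i are the coefficients of the extension. *)
  have rel : C * phi k (kap (v1, v2)) + A * phi k (kap (v2, v3)) = B * phi k (kap (v1, v3)).
    transitivity (phi k (C *: kap (v1, v2) + A *: kap (v2, v3))).
      by rewrite linD !(linZ (phi k)).
    rewrite -regularZ -(linZ (phi k)); congr (phi k _); apply: iotaI.
    rewrite linD !(linZ iota) !kapE /=; apply/ffunP => j; rewrite !ffunE.
    by rewrite /A /B /C /GRing.scale /=; ring.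
  have {}rel : C * phi k (kap (v1, v2)) = A * (- phi k (kap (v2, v3))) + B * phi k (kap (v1, v3)).
    by rewrite -rel; ring.
  have [y [z c12]] := regC rel.
  have H i : exists x, phi k (kap (v1, e i)) - (alpha (e i) : S) * z = A * x.
    apply: (@regB _ (phi k (kap (v2, e i)) + (alpha (e i) : S) * y)).
    have : B * phi k (kap (v1, e i)) = A * phi k (kap (v2, e i)) + (alpha (e i) : S) * phi k (kap (v1, v2)).
      transitivity (phi k (A *: kap (v2, e i) + (alpha (e i) : S) *: kap (v1, v2))); last first.
        by rewrite linD !(linZ (phi k)).
      rewrite -regularZ -(linZ (phi k)); congr (phi k _); apply: iotaI.
      rewrite linD !(linZ iota) !kapE /=; apply/ffunP => j; rewrite !ffunE.
      by rewrite /A /B /C /GRing.scale /=; ring.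
    by rewrite c12 mulrBr => ->; ring.
  have [t tE] := choice H; exists t => s s0; apply: (mulI A0).
  rewrite -[RHS]/(A *: (phi k s : S^o)) -(linZ (phi k)) kerE // lin_sum /= mulr_sumr.
  transitivity (\sum_i (iota s i : S) * (phi k (kap (v1, e i)) - (alpha (e i) : S) * z)).
    by apply: eq_bigr => i _; rewrite tE mulrCA.
  rewrite (eq_bigr (fun i => (iota s i : S) * phi k (kap (v1, e i)) - ((iota s i * alpha (e i) : S)) * z)).
    rewrite big_split /= sumrN -mulr_suml.
    have -> : \sum_i (iota s i * alpha (e i) : S) = alpha (iota s).
      by rewrite {2}(ffun_basis (iota s)) lin_sum; apply: eq_bigr => i _; rewrite (linZ alpha).
    rewrite s0 mul0r subr0; apply: eq_bigr => i _; by rewrite (linZ (phi k)).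
  by move=> i _; rewrite mulrBr mulrA.
have [t tE] := choice ext.
have [dd ddP] := choice phiP.
(* By [kerE], a functional of the dual basis that vanishes on the relations kap (v1, e i) vanishes
   on the whole kernel; only those indexed by D remain. *)
pose D : {fset P} := (\bigcup_(i <- enum I) dd (kap (v1, e i)))%fset.
have phiD s k : alpha (iota s) = 0 -> k \notin D -> phi k s = 0.
  move=> s0 kD; apply: (mulI A0).
  rewrite mulr0 -[LHS]/(A *: (phi k s : S^o)) -(linZ (phi k)) kerE // lin_sum big1 // => i _.
  rewrite (linZ (phi k)) (_ : phi k _ = 0) ?scaler0 //.
  have [H _] := ddP (kap (v1, e i)); apply: H.
  by apply: contraNN kD => kd; apply/bigfcupP; exists i; rewrite ?mem_enum.
have sE s : alpha (iota s) = 0 -> s = \sum_(k <- D) phi k s *: k.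
  move=> s0; have [kd {1}->] := ddP s.
  have E1 : (dd s `<=` dd s `|` D)%fset by apply: fsubsetUl.
  have E2 : (D `<=` dd s `|` D)%fset by apply: fsubsetUr.
  rewrite (big_fset_incl _ E1) => [|k _ /kd ->]; last by rewrite scale0r.
  by rewrite [RHS](big_fset_incl _ E2) // => k _ kD; rewrite phiD // scale0r.
have cE (k : P) : exists c, alpha (iota k) = c * h by apply/iotaE; exists k.
have [c cP] := choice cE.
(* The projection onto the kernel along the Euler field: c k is chosen with alpha(iota k) = c k
   h. *)
pose pi (k : P) : F := iota k - c k *: iota E.
have alpha_pi k : alpha (pi k) = 0.
  by rewrite linB (linZ alpha) alphaE cP regularZ subrr.
pose T k (d : F) : S := \sum_i (d i : S) * t k i.
have TP k a x y : T k (a *: x + y) = a * T k x + T k y.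
  rewrite /T mulr_sumr -big_split; apply: eq_bigr => i _.
  by rewrite !ffunE mulrDl -[a *: x i]/(a * x i) mulrA.
(* With the functionals extended to F, the dual basis defines r on all of F, with values in the
   kernel and equal to the identity there. *)
pose r (d : F) : F := \sum_(k <- D) T k d *: pi k.
have rP a x y : r (a *: x + y) = a *: r x + r y.
  rewrite /r scaler_sumr -big_split; apply: eq_bigr => k _.
  by rewrite TP scalerDl scalerA.
have alpha_r d : alpha (r d) = 0.
  by rewrite lin_sum big1 // => k _; rewrite (linZ alpha) alpha_pi scaler0.
have r_ker s : alpha (iota s) = 0 -> r (iota s) = iota s.
  move=> s0; have c0 : \sum_(k <- D) phi k s * c k = 0.
    apply: (mulI h0); rewrite mulr0 -[RHS]s0 {2}(sE s s0) !lin_sum mulr_sumr.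
    by apply: eq_bigr => k _; rewrite (linZ iota) (linZ alpha) cP regularZ mulrC mulrA.
  rewrite [in RHS](sE s s0) lin_sum /r.
  under eq_bigr => k _ do rewrite /T tE // /pi scalerBr scalerA.
  rewrite big_split /= sumrN -scaler_suml c0 scale0r subr0.
  by apply: eq_bigr => k _; rewrite (linZ iota).
(* The complementary projector kills the kernel, so A q(d) = alpha(d) q(v1). For d = v2 regularity
   makes q(v1) divisible by A, and since alpha q = alpha the quotient W has alpha(W) = 1. *)
pose q (d : F) : F := d - r d.
have qP a x y : q (a *: x + y) = a *: q x + q y.
  by rewrite /q rP scalerBr opprD addrACA.
have qker s : alpha (iota s) = 0 -> q (iota s) = 0.
  by move=> s0; rewrite /q r_ker // subrr.
have Aq d : A *: q d = (alpha d : S) *: q v1.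
  have q0 : q 0 = 0.
    have := qP (-1) 0 0; rewrite scaler0 addr0 => /eqP.
    by rewrite scaleN1r addNr => /eqP.
  have := qP A d 0; rewrite !addr0 q0 addr0 => <-.
  have -> : A *: d = (alpha d : S) *: v1 + iota (kap (v1, d)).
    by rewrite kapE /= addrC subrK.
  by rewrite qP qker ?addr0 // kapE linB !(linZ alpha) !regularZ mulrC subrr.
have qv1 j : exists w, (q v1 j : S) = A * w.
  apply: (@regB _ (q v2 j)); have := congr1 (fun f : F => f j) (Aq v2).
  by rewrite !ffunE => /esym.
have [w wE] := choice qv1; pose W : F := [ffun j => w j].
have qv1W : q v1 = A *: W by apply/ffunP => j; rewrite wE !ffunE.
have := alpha1 W; move=> /eqP; apply.
apply: (mulI A0); rewrite mulr1 -[LHS]/(A *: (alpha W : S^o)) -(linZ alpha) -qv1W.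
by rewrite /q linB alpha_r subr0.
Qed.

End NotProjective.

(** * Derivations along coordinates, and the codimension of the hypersurface *)

Definition derivation (S : comNzRingType) (D : S -> S) :=
  (forall x y, D (x + y) = D x + D y) /\ forall x y, D (x * y) = D x * y + x * D y.

Section Derivation.
Variables (S : comNzRingType) (D : S -> S) (hD : derivation D).

Lemma derivationD x y : D (x + y) = D x + D y. Proof. by case: hD. Qed.
Lemma derivationM x y : D (x * y) = D x * y + x * D y. Proof. by case: hD. Qed.

Lemma derivation0 : D 0 = 0.
Proof. by apply: (addIr (D 0)); rewrite -derivationD !add0r. Qed.

Lemma derivation1 : D 1 = 0.
Proof. by apply: (addIr (D 1)); rewrite add0r -[in RHS](mulr1 1) derivationM mulr1 mul1r. Qed.

Lemma derivation_prod (I : finType) (A : {set I}) (F : I -> S) :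
  D (\prod_(i in A) F i) = \sum_(i in A) D (F i) * \prod_(j in A :\ i) F j.
Proof.
have [m] := ubnP #|A|; elim: m A => // m IH A; rewrite ltnS => Am.
have [->|[i iA]] := set_0Vmem A; first by rewrite !big_set0 derivation1.
rewrite (big_setD1 i iA) derivationM /= (big_setD1 i iA) /=; congr (_ + _).
rewrite IH; last by rewrite (cardsD1 i) iA in Am.
rewrite mulr_sumr; apply: eq_bigr => j; rewrite !inE => /andP[ji jA].
have iAj : i \in A :\ j by rewrite !inE iA andbT eq_sym.
rewrite [in RHS](big_setD1 i iAj) /= mulrCA; congr (_ * (_ * _)).
by apply: eq_bigl => l; rewrite !inE; case: (l == i); case: (l == j).
Qed.

End Derivation.

Section Coordinates.
Variables (K : numFieldType) (N : nat) (Z : 'I_N -> cps N K) (hZ : coordinates Z).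
Local Notation S := (cps N K).

Definition jacobian : 'M[S]_N := \matrix_(i, j) pderiv j (Z i).

Lemma jacobian_inverse : exists G : 'M[S]_N, jacobian *m G = 1%:M /\ G *m jacobian = 1%:M.
Proof.
have d0 : (\det jacobian : S) 0%MM != 0.
  have [_] := hZ; congr (_ != 0); rewrite /determinant cps_sumE; apply: eq_bigr => s _.
  rewrite cpsM0E cps_prod0E; congr (_ * _); last by apply: eq_bigr => i _; rewrite !mxE.
  by case: (odd_perm s); rewrite ?expr1 ?expr0 ?cpsNE cps1E eqxx.
have [v dv] := cps_unit d0; exists (v *: \adj jacobian).
rewrite -scalemxAr -scalemxAl mul_mx_adj mul_adj_mx.
by rewrite scale_scalar_mx mulrC dv.
Qed.

(** The D j are the partial derivatives with respect to the coordinates Z_j, and G is the inverse of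
    the jacobian matrix. *)
Lemma dual_derivations : exists D : 'I_N -> S -> S, [/\ forall j, derivation (D j),
  forall i j, D j (Z i) = (i == j)%:R &
  exists G : 'M[S]_N, [/\ jacobian *m G = 1%:M, G *m jacobian = 1%:M &
  (forall j u, D j u = \sum_i G i j * pderiv i u) /\
  (forall i u, pderiv i u = \sum_j D j u * jacobian j i)]].
Proof.
have [G [JG GJ]] := jacobian_inverse.
exists (fun j u => \sum_i G i j * pderiv i u); split=> [j|i j|].
- split=> x y; first by rewrite -big_split; apply: eq_bigr => i _; rewrite pderivD mulrDr.
  rewrite mulr_suml mulr_sumr -big_split; apply: eq_bigr => i _.
  by rewrite pderivM mulrDr mulrA mulrCA.
- have <- : (jacobian *m G) i j = (i == j)%:R by rewrite JG mxE.
  by rewrite mxE; apply: eq_bigr => l _; rewrite mxE mulrC.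
exists G; split=> //; split=> // i u.
under eq_bigr => j _ do rewrite mulr_suml.
rewrite exchange_big /=; rewrite (bigD1 i) //= [X in _ + X]big1 ?addr0 => [|l li].
  have -> : \sum_j G i j * pderiv i u * jacobian j i = (G *m jacobian) i i * pderiv i u.
    by rewrite mxE mulr_suml; apply: eq_bigr => j _; rewrite mulrAC.
  by rewrite GJ mxE eqxx mul1r.
have -> : \sum_j G l j * pderiv l u * jacobian j i = (G *m jacobian) l i * pderiv l u.
  by rewrite mxE mulr_suml; apply: eq_bigr => j _; rewrite mulrAC.
by rewrite GJ mxE (negPf li) mul0r.
Qed.

End Coordinates.

Section OneForms.
Variables (K : numFieldType) (N : nat).
Local Notation S := (cps N K).

Lemma idx1_subproof (i : 'I_N) : sorted ltn [seq val j | j <- [tuple i]].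
Proof. by []. Qed.

Definition idx1 (i : 'I_N) : incr_index N 1 := exist _ [tuple i] (idx1_subproof i).

Lemma idx1K (I : incr_index N 1) : idx1 (tnth (val I) ord0) = I.
Proof.
by case: I => -[[|i [|j s]] //= sz] so; apply: val_inj; apply: val_inj.
Qed.

Lemma wedge_d1 (f : 'I_1 -> S) i : wedge_d f (idx1 i) = pderiv i (f ord0).
Proof. by rewrite ffunE det_mx11 mxE. Qed.

Lemma sum_idx1 (V : nmodType) (F : incr_index N 1 -> V) : \sum_I F I = \sum_i F (idx1 i).
Proof.
rewrite (reindex idx1) //; exists (fun I : incr_index N 1 => tnth (val I) ord0) => [i _|I _] //.
exact: idx1K.
Qed.

Definition vderiv (d : mvfield K N 1) (u : S) : S := \sum_i d (idx1 i) * pderiv i u.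

Lemma pairing1 d (f : 'I_1 -> S) : pairing d (wedge_d f) = vderiv d (f ord0).
Proof. by rewrite /pairing sum_idx1; apply: eq_bigr => i _; rewrite wedge_d1. Qed.

Lemma vderiv_derivation d : derivation (vderiv d).
Proof.
split=> x y; first by rewrite -big_split; apply: eq_bigr => i _; rewrite pderivD mulrDr.
rewrite mulr_suml mulr_sumr -big_split; apply: eq_bigr => i _.
by rewrite pderivM mulrDr mulrA mulrCA.
Qed.

(** By the Leibniz rule it suffices to test the generator of a principal ideal. *)
Lemma derlog1P (h : S) (d : mvfield K N 1) :
  (d \in @derlog_pred K N 1 (principal h)) <-> exists c, vderiv d h = c * h.
Proof.
split=> [/asboolP dh|[c dh]].
  apply/principalP; rewrite -(pairing1 d (fun=> h)); apply: dh => _.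
  by apply/principalP; exists 1; rewrite mul1r.
apply/asboolP => f fI; rewrite pairing1; have /principalP[q ->] := fI ord0.
apply/principalP; exists (vderiv d q + q * c).
by rewrite (derivationM (vderiv_derivation d)) dh mulrDl mulrA.
Qed.

End OneForms.

Section Binomial.
Variables (K : numFieldType) (N : nat) (Z : 'I_N -> cps N K) (hZ : coordinates Z).
Variables (A B : {set 'I_N}).
Hypotheses (A2 : (1 < #|A|)%N) (B2 : (1 < #|B|)%N) (AB : [disjoint A & B]).
Local Notation S := (cps N K).

Definition zprod (T : {set 'I_N}) : S := \prod_(i in T) Z i.
Definition zprod2 : S := zprod A + zprod B.
Local Notation h := zprod2.

Lemma disjointN i : i \in A -> i \in B -> False.
Proof. by move=> iA iB; move/pred0P: AB => /(_ i) /=; rewrite iA iB. Qed.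

Lemma zprod_0 (T : {set 'I_N}) : (0 < #|T|)%N -> zprod T 0%MM = 0.
Proof.
move=> /card_gt0P[i iT]; rewrite /zprod (big_setD1 i iT) cpsM0E.
by case: hZ => -> _; rewrite mul0r.
Qed.

Lemma binomial_0 : h 0%MM = 0.
Proof. by rewrite cpsDE !zprod_0 ?addr0 // ltnW. Qed.

Lemma zprod_neq0 T : zprod T != 0.
Proof. by apply: cps_prod_neq0 => i _; apply: Z_neq0. Qed.

Lemma principal_binomial_prime : prime_ideal (principal h).
Proof.
have [v [ZK vK]] := csubst_bijective hZ; case: (hZ) => Z0 _.
have /card_gt0P[a aA] := ltnW A2; have /card_gt0P[b bB] := ltnW B2.
have [h1 hP] := @binomial_prime K N A B a b aA bB AB.
set h' : S := _ + _ in h1 hP.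
have hE : csubst Z h' = h.
  rewrite /h' rmorphD !rmorph_prod; congr (_ + _); apply: eq_bigr => i _ /=; exact: csubst_X.
have mem u : (u \in principal h) = (csubst v u \in principal h').
  apply/idP/idP => /principalP[c cE]; apply/principalP.
    by exists (csubst v c); rewrite cE -hE csubstM ZK.
  by exists (csubst Z c); rewrite -[u]vK cE csubstM hE.
split; first by rewrite mem rmorph1.
by move=> x y; rewrite !mem csubstM; apply: hP.
Qed.

Lemma binomial_neq0 : h != 0.
Proof.
have [rho [rZ _]] := retraction hZ A.
apply/eqP => /(congr1 rho); rewrite rmorphD !rmorph_prod rmorph0 /=.
have /card_gt0P[a aA] := ltnW A2.
rewrite (big_setD1 a aA) rZ aA /= mul0r add0r (eq_bigr Z) => [/eqP|i iB].
  by apply/negP/zprod_neq0.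
by rewrite rZ; case: ifP => // iA; case: (disjointN iA iB).
Qed.

(** The relevant case of Krull's theorem, by hand: a prime Q strictly inside (h) omits h, so x = c h
    in Q forces c into Q. Iteration puts x into every (h^k), and h has no constant term, so x =
    0. *)
Lemma height_principal_binomial : height (principal h) 1.
Proof.
split.
  exists (cideal Z set0); split=> //; first exact: cideal_prime.
    by move=> u /cideal0 ->; apply: ideal0.
  move=> /(_ h); have hh : h \in principal h by apply: mem_ideal_gen.
  by move=> /(_ hh) /cideal0/eqP; rewrite (negPf binomial_neq0).
move=> [Q [PQ Qh hQ [Q0 [PQ0 Q0Q QQ0 _]]]]; apply: QQ0 => x xQ.
have hNQ : h \notin Q.
  apply/negP => hQ'; apply: hQ => y /principalP[c ->]; exact: idealMl.
have xk k : exists2 c, c \in Q & x = c * h ^+ k.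
  elim: k => [|k [c cQ ->]]; first by exists x; rewrite // expr0 mulr1.
  have /principalP[c' cE] := Qh _ cQ.
  exists c'; last by rewrite cE exprS mulrA.
  by move: cQ; rewrite cE => /(prime_idealM PQ)[] //; rewrite (negPf hNQ).
suff -> : x = 0 by apply: ideal0.
apply: cpsP => k; have [c _ ->] := xk (mdeg k).+1.
have h1 : order_ge (fun=> 1%N) 1 h.
  by move=> l; rewrite wdeg1 ltnS leqn0 mdeg_eq0 => /eqP ->; apply: binomial_0.
have cE : order_ge (fun=> 1%N) 0 c by apply: order_ge0.
by rewrite (order_geM cE (order_geX (e := (mdeg k).+1) h1)) // wdeg1 mul1n.
Qed.

Lemma reduced_equidim_binomial : reduced_equidim (principal h) 1.
Proof.
have Ph := principal_binomial_prime.
split; first exact: prime_ideal1.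
  by move=> x /asboolP[k]; apply: prime_idealX.
move=> P [PP hP Pmin].
have Ph' : {subset P <= principal h} := Pmin _ Ph (fun _ => id) hP.
have [[Q [PQ Qh hQ _]] hN] := height_principal_binomial.
split.
  exists (cideal Z set0); split=> //; first exact: cideal_prime.
    by move=> u /cideal0 ->; apply: ideal0.
  move=> /(_ h); have hh : h \in principal h by apply: mem_ideal_gen.
  by move=> /(_ (hP _ hh)) /cideal0/eqP; rewrite (negPf binomial_neq0).
move=> [Q' [PQ' Q'P PQ'N Q'h]]; apply: hN; exists Q'; split=> //.
- by move=> x /Q'P /Ph'.
- by move=> hQ'; apply: PQ'N => x /Ph' /hQ'.
Qed.

End Binomial.

Lemma height_geS (S : comNzRingType) (P : ideal S) k : height_ge P k.+1 -> height_ge P k.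
Proof.
elim: k P => [|k IH] P //= [Q [PQ QP PQN hQ]]; exists Q; split=> //.
exact: IH hQ.
Qed.

Lemma height_geW (S : comNzRingType) (P : ideal S) k l :
  (k <= l)%N -> height_ge P l -> height_ge P k.
Proof.
move=> /subnKC <-; elim: (l - k)%N => [|m IH]; first by rewrite addn0.
by rewrite addnS => /height_geS.
Qed.

Lemma height_unique (S : comNzRingType) (P : ideal S) k l : height P k -> height P l -> k = l.
Proof.
move=> [hk hkN] [hl hlN]; apply/eqP; rewrite eqn_leq.
apply/andP; split; rewrite leqNgt; apply/negP => /height_geW H.
  exact/hlN/H.
exact/hkN/H.
Qed.

Section NotFree.
Variables (K : numFieldType) (N : nat) (Z : 'I_N -> cps N K) (hZ : coordinates Z).
Variables (A B : {set 'I_N}).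
Hypotheses (A2 : (1 < #|A|)%N) (B2 : (1 < #|B|)%N) (AB : [disjoint A & B]).
Local Notation S := (cps N K).
Implicit Types (T : {set 'I_N}) (x y u w : S).
Local Notation zprod := (zprod Z).
Local Notation h := (zprod2 Z A B).

Lemma cideal1P i u : u \in cideal Z [set i] -> exists c, u = Z i * c.
Proof.
have cl : submod_closed ([pred x | `[< exists c, x = Z i * c >]] : {pred S^o}).
  split=> [|a x y /asboolP[c ->] /asboolP[d ->]]; apply/asboolP.
    by exists 0; rewrite mulr0.
  by exists (a * c + d); rewrite mulrDr mulrCA.
move=> ui; apply/asboolP; suff : u \in Ideal cl by [].
move: ui; apply: cideal_sub => j; rewrite inE => /eqP ->.
by apply/asboolP; exists 1; rewrite mulr1.
Qed.

Lemma zprod_D1 T i : i \in T -> zprod T = Z i * zprod (T :\ i).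
Proof. by move=> iT; rewrite /zprod (big_setD1 i iT). Qed.

(** The factors Z_i are cancelled one at a time, each (Z_i) being prime and not containing w. *)
Lemma zprod_regular T w x y : (forall i, i \in T -> w \notin cideal Z [set i]) ->
  w * x = zprod T * y -> exists z, x = zprod T * z.
Proof.
have [m] := ubnP #|T|; elim: m T x => // m IH T x; rewrite ltnS => Tm wT E.
have [T0|[i iT]] := set_0Vmem T.
  by exists x; rewrite T0 /zprod big_set0 mul1r.
have : w * x \in cideal Z [set i].
  by rewrite E (zprod_D1 iT) -mulrA mulrC; apply/idealMl/cideal_Z; rewrite inE.
move=> /(prime_idealM (cideal_prime hZ _))[|/cideal1P[x' xE]].
  by rewrite (negPf (wT i iT)).
have [|||z zE] := IH (T :\ i) x'.
- by rewrite (cardsD1 i) iT in Tm.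
- by move=> j; rewrite in_setD1 => /andP[_ jT]; apply: wT.
- by apply: (cps_mulI (Z_neq0 hZ i)); rewrite mulrCA -xE E (zprod_D1 iT) mulrA.
- by exists z; rewrite xE zE (zprod_D1 iT) mulrA.
Qed.

(* The retraction Z_i -> 0 fixes p and q, so a relation Z_i x = p y + q z can be
   divided by Z_i after subtracting its image. *)
Lemma zprod_regular2 T (p q : S) x y z :
  (forall i (rho : {rmorphism S -> S}), i \in T ->
    (forall j, rho (Z j) = if j \in [set i] then 0 else Z j) -> rho p = p /\ rho q = q) ->
  zprod T * x = p * y + q * z -> exists y' z', x = p * y' + q * z'.
Proof.
have [m] := ubnP #|T|; elim: m T y z => // m IH T y z; rewrite ltnS => Tm pq E.
have [T0|[i iT]] := set_0Vmem T.
  by exists y, z; rewrite -E T0 /zprod big_set0 mul1r.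
have [rho [rZ rI]] := retraction hZ [set i].
have [rp rq] := pq i rho iT rZ.
have [c yc] : exists c, y - rho y = Z i * c.
  by apply/cideal1P/rI => j ji; apply: cideal_Z.
have [d zd] : exists d, z - rho z = Z i * d.
  by apply/cideal1P/rI => j ji; apply: cideal_Z.
have r0 : p * rho y + q * rho z = 0.
  rewrite -{1}rp -{1}rq -!rmorphM -rmorphD -E (zprod_D1 iT) -mulrA rmorphM rZ inE eqxx.
  by rewrite mul0r.
apply: (IH (T :\ i) c d); first by rewrite (cardsD1 i) iT in Tm.
  by move=> j r; rewrite in_setD1 => /andP[_ jT]; apply: pq.
apply: (cps_mulI (Z_neq0 hZ i)); rewrite mulrA -(zprod_D1 iT) E.
rewrite mulrDr ![Z i * (_ * _)]mulrCA -yc -zd !mulrBr.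
by rewrite addrACA -opprD r0 subr0.
Qed.

(** Modulo Z_i only the term of index i survives, and it is a product of other coordinates. *)
Lemma sum_zprod_notin i : i \in A -> \sum_(j in A) zprod (A :\ j) \notin cideal Z [set i].
Proof.
move=> iA; apply/negP; rewrite (big_setD1 i iA) /= => H.
have : zprod (A :\ i) \in cideal Z [set i].
  rewrite -[zprod _](addrK (\sum_(j in A :\ i) zprod (A :\ j))); apply: idealB => //.
  apply: ideal_sum => j; rewrite in_setD1 => /andP[ji jA].
  have iAj : i \in A :\ j by rewrite !inE iA andbT eq_sym.
  by rewrite (zprod_D1 iAj) mulrC; apply/idealMl/cideal_Z; rewrite inE.
move=> /(prime_ideal_prodP (cideal_prime hZ _))[j]; rewrite (cideal_Z_iff hZ) !inE.
by move=> /andP[/negPf ->].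
Qed.

Lemma deriv_zprod (D : S -> S) T j : derivation D -> (forall i, D (Z i) = (i == j)%:R) ->
  D (zprod T) = if j \in T then zprod (T :\ j) else 0.
Proof.
move=> hD DZ; rewrite (derivation_prod hD); case: ifP => jT.
  rewrite (big_setD1 j jT) /= DZ eqxx mul1r [X in _ + X]big1 ?addr0 // => i; rewrite !inE => /andP[/negPf ij _].
  by rewrite DZ ij mul0r.
rewrite big1 // => i iT; rewrite DZ (_ : i == j = false) ?mul0r //.
by apply: contraTF iT => /eqP ->; rewrite jT.
Qed.

Lemma deriv_binomial (D : S -> S) j : derivation D -> (forall i, D (Z i) = (i == j)%:R) ->
  D h = if j \in A then zprod (A :\ j) else if j \in B then zprod (B :\ j) else 0.
Proof.
move=> hD DZ; rewrite (derivationD hD) !(deriv_zprod _ hD DZ).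
case: ifP => jA; last by rewrite add0r.
by case: ifP => jB; [case: (disjointN AB jA jB)|rewrite addr0].
Qed.

Lemma deriv_zprod_0 (D : S -> S) T : derivation D -> (1 < #|T|)%N -> D (zprod T) 0%MM = 0.
Proof.
move=> hD T2; rewrite (derivation_prod hD) cps_sumE big1 // => i iT.
rewrite cpsM0E (zprod_0 hZ) ?mulr0 //.
by rewrite (cardsD1 i) iT in T2.
Qed.

Lemma derlog1_binomial_not_projective : ~ projdim_le (derlog 1 (principal h)) 0.
Proof.
have [D [hD DZ [G [_ _ [DE _]]]]] := dual_derivations hZ.
have /card_gt0P[a aA] := ltnW A2; have /card_gt0P[b bB] := ltnW B2.
have bA : (b \in A) = false by apply/negP => bA; exact: (disjointN AB bA bB).
pose vec (c : 'I_N -> S) : mvfield K N 1 := [ffun I => \sum_j G (tnth (val I) ord0) j * c j].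
have vecE c u : vderiv (vec c) u = \sum_j c j * D j u.
  rewrite /vderiv; under eq_bigr => i _ do rewrite ffunE mulr_suml.
  rewrite exchange_big /=; apply: eq_bigr => j _.
  rewrite DE mulr_sumr; apply: eq_bigr => i _.
  by rewrite (_ : tnth _ _ = i) // mulrCA mulrA mulrC mulrA.
pose al (d : mvfield K N 1) : S^o := vderiv d h.
have al_lin : linear al.
  move=> c x y; rewrite /al /vderiv scaler_sumr -big_split; apply: eq_bigr => i _.
  by rewrite !ffunE mulrDl -[c *: x _]/(c * x _) regularZ mulrA.
pose alpha : {linear mvfield K N 1 -> S^o} :=
  HB.pack al (GRing.isLinear.Build S (mvfield K N 1) S^o *:%R al al_lin).
pose io (x : derlog 1 (principal h)) : mvfield K N 1 := derlog_val x.
have io_lin : linear io by [].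
pose iota : {linear derlog 1 (principal h) -> mvfield K N 1} :=
  HB.pack io (GRing.isLinear.Build S _ _ *:%R io io_lin).
have iotaI : injective iota by move=> x y /val_inj.
have iotaP d : (exists c, alpha d = c * h) <-> exists x : derlog 1 (principal h), iota x = d.
  split=> [[c dc]|[x <-]].
    have dP : d \in @derlog_pred K N 1 (principal h) by apply/derlog1P; exists c.
    by exists (Derlog dP).
  by apply/derlog1P; exact: (valP x).
have sum1 c (F : 'I_N -> S) i : (forall j, j != i -> c j = 0) -> \sum_j c j * F j = c i * F i.
  by move=> c0; rewrite (bigD1 i) //= big1 ?addr0 // => j /c0 ->; rewrite mul0r.
pose del (i j : 'I_N) : S := (j == i)%:R.
have alphaE i : alpha (vec (del i)) = D i h.
  by rewrite [LHS]vecE (sum1 _ _ i) /del ?eqxx ?mul1r // => j /negPf ->.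
have hDa i : D i h = if i \in A then zprod (A :\ i) else if i \in B then zprod (B :\ i) else 0.
  by apply: deriv_binomial.
(* The field Z_a d/dZ_a + Z_b d/dZ_b maps h to itself, since each product is linear in each of its
   variables. *)
pose eul (j : 'I_N) : S := if j == a then Z a else if j == b then Z b else 0.
have eulE : alpha (vec eul) = h.
  have ba : b != a by apply: contraFneq bA => ->.
  rewrite [LHS]vecE (bigD1 a) //= (bigD1 b) //= big1 ?addr0 => [|j /andP[ja jb]].
    rewrite /eul !eqxx (negPf ba) !hDa aA bA bB -!zprod_D1 //.
  by rewrite /eul (negPf ja) (negPf jb) mul0r.
have [E EE] : exists x : derlog 1 (principal h), iota x = vec eul by apply/iotaP; exists 1; rewrite mul1r eulE.
(* The sum of the d/dZ_j over A. On h it gives the elementary symmetric polynomial of degree |A| -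
   1, coprime to prod (A - a). *)
pose oneA (j : 'I_N) : S := (j \in A)%:R.
have alphaA : alpha (vec oneA) = \sum_(j in A) zprod (A :\ j).
  rewrite [LHS]vecE [RHS]big_mkcond; apply: eq_bigr => j _.
  by rewrite /oneA hDa; case: ifP; rewrite ?mul1r ?mul0r.
have card_D1 T i : (1 < #|T|)%N -> i \in T -> (0 < #|T :\ i|)%N.
  by move=> + iT; rewrite (cardsD1 i) iT.
have a1 : alpha (vec (del a)) = zprod (A :\ a) by rewrite alphaE hDa aA.
have a3 : alpha (vec (del b)) = zprod (B :\ b) by rewrite alphaE hDa bA bB.
apply: (@not_projective_kernel S _ (@cps_mul_eq0 K N) alpha _ iota h E
  (vec (del a)) (vec oneA) (vec (del b)) iotaI iotaP).
- by rewrite EE eulE.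
- exact: binomial_neq0.
- by rewrite a1; apply: zprod_neq0.
- move=> x y; rewrite alphaA a1; apply: zprod_regular => i; rewrite in_setD1 => /andP[_ iA].
  exact: sum_zprod_notin.
- move=> x y z; rewrite alphaA a1 a3; apply: zprod_regular2 => i rho; rewrite in_setD1 => /andP[_ iB] rZ.
  have rz T : T \subset A -> rho (zprod T) = zprod T.
    move=> TA; rewrite rmorph_prod; apply: eq_bigr => j jT /=.
    rewrite rZ inE; case: eqP => // ji; case: (@disjointN _ _ _ AB i) => //.
    by rewrite -ji (subsetP TA).
  rewrite rz ?subsetDl //; split=> //; rewrite rmorph_sum; apply: eq_bigr => j jA /=.
  by rewrite rz ?subsetDl.
(* Both products have at least two factors, so every derivative of h vanishes at the origin and
   alpha never takes the value 1. *)
move=> d; apply/negP => /eqP/(congr1 (fun f : S => f 0%MM)).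
rewrite cps1E eqxx => /eqP; apply/negP; rewrite eq_sym.
rewrite [X in _ != X](_ : _ = 0) ?oner_neq0 // [LHS](_ : _ = vderiv d h 0%MM) //.
rewrite (derivationD (vderiv_derivation d)) cpsDE !deriv_zprod_0 ?addr0 //; exact: vderiv_derivation.
Qed.

(** The codimension in [free_germ] is existential; uniqueness of the height of (h) forces it to be
    1. *)
Lemma binomial_not_free : ~ free_germ (principal h).
Proof.
move=> [k k0 [[_ _ hk] [pd _]]].
have Ph := principal_binomial_prime hZ A2 B2 AB.
have hPk : height (principal h) k by apply: hk; split.
have k1 := height_unique hPk (height_principal_binomial hZ A2 B2 AB).
by rewrite k1 in pd; apply: derlog1_binomial_not_projective.
Qed.

End NotFree.

(** * Multivector fields in coordinates *)

Section CauchyBinet.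
Variables (R : comNzRingType) (N k : nat).
Implicit Types (I J : incr_index N k) (s : 'S_k).

Lemma incr_index_sorted I : sorted (fun i j : 'I_N => (i < j)%N) (val I).
Proof. by have := valP I; rewrite sorted_map. Qed.

Let ltT : transitive (fun i j : 'I_N => (i < j)%N).
Proof. by move=> i j l; apply: ltn_trans. Qed.

Let ltI : irreflexive (fun i j : 'I_N => (i < j)%N).
Proof. by move=> i; apply: ltnn. Qed.

Lemma incr_index_uniq I : uniq (val I).
Proof. exact: sorted_uniq (incr_index_sorted I). Qed.

Lemma incr_index_inj I : injective (tnth (val I)).
Proof. exact/tuple_uniqP/incr_index_uniq. Qed.

Lemma incr_index_eq I J : val I =i val J -> I = J.
Proof.
move=> IJ; apply/val_inj/val_inj.
exact: irr_sorted_eq (incr_index_sorted I) (incr_index_sorted J) IJ.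
Qed.

Lemma incr_index_of_inj (phi : {ffun 'I_k -> 'I_N}) : injective phi ->
  exists I, forall i, (i \in val I) = (i \in codom phi).
Proof.
move=> phiI; have sz : size (enum (codom phi)) == k.
  by rewrite -cardE card_codom // card_ord.
have st : sorted ltn [seq val i | i <- Tuple sz].
  rewrite sorted_map.
  have : sorted (fun i j : 'I_N => (i < j)%N) (enum 'I_N).
    by have := iota_ltn_sorted 0 N; rewrite -val_enum_ord sorted_map.
  by rewrite enumT; apply: sorted_filter => i j l; apply: ltn_trans.
by exists (exist _ (Tuple sz) st) => i; rewrite mem_enum.
Qed.

Definition select I s : {ffun 'I_k -> 'I_N} := [ffun a => tnth (val I) (s a)].

(** Together with [select_surj]: an injection of k letters into N is in a unique way an increasing
    sequence composed with a permutation. *)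
Lemma select_inj (p q : incr_index N k * 'S_k) : select p.1 p.2 = select q.1 q.2 -> p = q.
Proof.
case: p q => [I s] [J t] /= /ffunP E.
have mem (L : incr_index N k) (u : 'S_k) i : (i \in val L) = [exists a, select L u a == i].
  apply/tnthP/existsP => [[a ->]|[a /eqP <-]]; last by exists (u a); rewrite ffunE.
  by exists (u^-1%g a); rewrite ffunE permKV.
have IJ : I = J.
  apply: incr_index_eq => i; rewrite (mem I s) (mem J t).
  by apply: eq_existsb => a; rewrite E.
subst J; congr pair; apply/permP => a; apply: (@incr_index_inj I).
by have := E a; rewrite !ffunE.
Qed.

Lemma select_surj (phi : {ffun 'I_k -> 'I_N}) : injective phi ->
  exists p : incr_index N k * 'S_k, phi = select p.1 p.2.
Proof.
move=> phiI; have [I memI] := incr_index_of_inj phiI.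
have ex a : exists b, tnth (val I) b = phi a.
  have /tnthP[b ->] : phi a \in val I by rewrite memI codom_f.
  by exists b.
have [s sE] := choice ex.
have sI : injective s by move=> a b ab; apply: phiI; rewrite -!sE ab.
by exists (I, perm sI); apply/ffunP => a; rewrite ffunE permE sE.
Qed.

(** The determinant is expanded over all maps from k to N. A non-injective map repeats a row of B
    and contributes 0; the injective ones are grouped by their image, and the permutations assemble
    the minor of A. *)
Theorem cauchy_binet (A : 'M[R]_(k, N)) (B : 'M[R]_(N, k)) :
  \det (A *m B) = \sum_(I : incr_index N k) \det (\matrix_(a < k, b < k) A a (tnth (val I) b)) *
                         \det (\matrix_(a < k, b < k) B (tnth (val I) a) b).
Proof.
pose F (phi : {ffun 'I_k -> 'I_N}) :=
  (\prod_a A a (phi a)) * \det (\matrix_(a < k, b < k) B (phi a) b).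
transitivity (\sum_phi F phi).
  rewrite /determinant.
  under eq_bigr => s _ do under eq_bigr => a _ do rewrite mxE.
  under eq_bigr => s _ do rewrite bigA_distr_bigA /= mulr_sumr.
  rewrite exchange_big /=; apply: eq_bigr => phi _; rewrite /F /determinant mulr_sumr.
  apply: eq_bigr => s _; rewrite big_split /= mulrCA; congr (_ * (_ * _)).
  by apply: eq_bigr => a _; rewrite mxE.
rewrite (bigID (fun phi : {ffun 'I_k -> 'I_N} => injectiveb phi)) /= [X in _ + X]big1 ?addr0; last first.
  move=> phi /injectivePn[a [b ab phiab]]; rewrite /F.
  by rewrite (determinant_alternate ab) ?mulr0 // => c; rewrite !mxE phiab.
transitivity (\sum_(p : incr_index N k * 'S_k) F (select p.1 p.2)).
  have -> : \sum_(phi : {ffun 'I_k -> 'I_N} | injectiveb phi) F phi =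
      \sum_(phi in [set select p.1 p.2 | p in [set: incr_index N k * 'S_k]]) F phi.
    apply: eq_bigl => phi; apply/injectiveP/imsetP => [/select_surj[p ->]|[p _ ->]].
      by exists p; rewrite ?inE.
    by move=> a b; rewrite !ffunE => /incr_index_inj /perm_inj.
  rewrite big_imset /=; last by move=> p q _ _; apply: select_inj.
  by apply: eq_bigl => p; rewrite inE.
rewrite -(pair_bigA _ (fun I s => F (select I s))) /=; apply: eq_bigr => I _.
rewrite {1}/determinant mulr_suml; apply: eq_bigr => s _; rewrite /F.
have -> : \matrix_(a < k, b < k) B (select I s a) b =
    row_perm s (\matrix_(a < k, b < k) B (tnth (val I) a) b).
  by apply/matrixP => a b; rewrite !mxE ffunE.
rewrite row_permE det_mulmx det_perm mulrA [_ * (-1) ^+ s]mulrC; congr (_ * _ * _).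
by apply: eq_bigr => a _; rewrite mxE ffunE.
Qed.

Lemma det_minor1 I J :
  \det (\matrix_(a < k, b < k) (1%:M : 'M[R]_N) (tnth (val I) a) (tnth (val J) b)) = (I == J)%:R.
Proof.
have [<-|IJ] := eqVneq I J.
  rewrite (_ : \matrix_(_, _) _ = 1%:M) ?det1 //; apply/matrixP => a b; rewrite !mxE.
  by rewrite (inj_eq (@incr_index_inj I)).
have [a aJ] : exists a, tnth (val I) a \notin val J.
  apply: contrapT => nE; case/eqP: IJ; apply: incr_index_eq.
  have sub : {subset val I <= val J}.
    move=> i /tnthP[a ->]; apply: contrapT => /negP aJ; apply: nE; by exists a.
  have sz : (size (val J) <= size (val I))%N by rewrite !size_tuple.
  by have [] := uniq_min_size (incr_index_uniq I) sub sz.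
rewrite (expand_det_row _ a) big1 // => b _; rewrite !mxE.
case: eqP => [E|]; last by rewrite mul0r.
by move: aJ; rewrite E mem_tnth.
Qed.

End CauchyBinet.

(** * Projective resolutions and Koszul complexes *)

Definition lin_of (S : pzRingType) (V W : lmodType S) (f : V -> W) (Hf : linear f) :
  {linear V -> W} := HB.pack f (GRing.isLinear.Build S V W *:%R f Hf).

Section Lifting.
Variable S : comNzRingType.

Section Image.
Variables (C B : lmodType S) (del : {linear C -> B}).

Definition image_pred : {pred B} := [pred b | `[< exists c, del c = b >]].

Lemma image_closed : submod_closed image_pred.
Proof.
split=> [|a x y /asboolP[c <-] /asboolP[d <-]]; apply/asboolP.
  by exists 0; rewrite linear0.
by exists (a *: c + d); rewrite linearP.
Qed.

HB.instance Definition _ := GRing.isSubmodClosed.Build S B image_pred image_closed.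

Record image_lmod : Type := Image { image_val :> B ; _ : image_val \in image_pred }.

HB.instance Definition _ := [isSub for image_val].
HB.instance Definition _ := [Choice of image_lmod by <:].
HB.instance Definition _ := [SubChoice_isSubLmodule of image_lmod by <:].

(** [projective] lifts along surjections only, so [del] is first corestricted to its image. *)
Lemma projective_lift (Q : lmodType S) (g : {linear Q -> B}) : projective Q ->
  (forall x, exists y, del y = g x) -> exists l : {linear Q -> C}, forall x, del (l x) = g x.
Proof.
move=> Qproj gdel.
have dP c : del c \in image_pred by apply/asboolP; exists c.
have gP x : g x \in image_pred by apply/asboolP; apply: gdel.
pose d' c : image_lmod := Image (dP c); pose g' x : image_lmod := Image (gP x).
have d'_lin : linear d' by move=> a x y; apply: val_inj; rewrite /= linearP.
have g'_lin : linear g' by move=> a x y; apply: val_inj; rewrite /= linearP.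
have [y|l lE] := Qproj _ _ (lin_of d'_lin) (lin_of g'_lin).
  have /asboolP[c cy] := valP y; exists c; exact: val_inj.
by exists l => x; have /(congr1 val) := lE x.
Qed.

End Image.

Lemma projective_regular : projective (S^o : lmodType S).
Proof.
move=> M N p g psurj; have [m mE] := psurj (g 1).
pose f (x : S^o) : M := (x : S) *: m.
have f_lin : linear f by move=> a x y; rewrite /f scalerDl scalerA.
exists (lin_of f_lin) => x /=; rewrite /f linZ mE -linZ.
by rewrite regularZ mulr1.
Qed.

Lemma projective_trivial (Q : lmodType S) : (forall x : Q, x = 0) -> projective Q.
Proof.
move=> Q0 M N p g _; have f_lin : linear (fun _ : Q => 0 : M).
  by move=> a x y; rewrite scaler0 addr0.
by exists (lin_of f_lin) => x; rewrite (Q0 x) !linear0.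
Qed.

Lemma projective_pair (Q Q' : lmodType S) : projective Q -> projective Q' ->
  projective (Q * Q')%type.
Proof.
move=> Qp Qp' M N p g psurj.
have g1_lin : linear (fun x : Q => g (x, 0)).
  by move=> a x y; rewrite -linearP; congr (g _); apply: (congr2 pair) => //=; rewrite scaler0 addr0.
have g2_lin : linear (fun x : Q' => g (0, x)).
  by move=> a x y; rewrite -linearP; congr (g _); apply: (congr2 pair) => //=; rewrite scaler0 addr0.
have [l1 l1E] := Qp _ _ p (lin_of g1_lin) psurj.
have [l2 l2E] := Qp' _ _ p (lin_of g2_lin) psurj.
pose f (x : Q * Q') : M := l1 x.1 + l2 x.2.
have f_lin : linear f.
  by move=> a x y; rewrite /f !linearP /= scalerDr addrACA.
exists (lin_of f_lin) => x; rewrite /= /f linearD l1E l2E /= -linearD; congr (g _).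
by case: x => a b; apply: (congr2 pair) => /=; rewrite ?addr0 ?add0r.
Qed.

Lemma projective_ffun (T : finType) (Q : lmodType S) : projective Q ->
  projective ({ffun T -> Q} : lmodType S).
Proof.
move=> Qp M N p g psurj.
pose single t (x : Q) : {ffun T -> Q} := [ffun t' => if t' == t then x else 0].
have single_lin t : linear (single t).
  by move=> a x y; apply/ffunP => t'; rewrite !ffunE; case: eqP; rewrite ?scaler0 ?addr0.
have gt_lin t : linear (g \o single t).
  by move=> a x y; rewrite /= single_lin linearP.
have ex t : exists l : {linear Q -> M}, forall x, p (l x) = g (single t x).
  exact: (Qp _ _ p (lin_of (gt_lin t)) psurj).
have [l lE] := choice ex.
pose f (x : {ffun T -> Q}) : M := \sum_t l t (x t).
have f_lin : linear f.
  move=> a x y; rewrite /f scaler_sumr -big_split; apply: eq_bigr => t _.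
  by rewrite !ffunE linearP.
exists (lin_of f_lin) => x; rewrite /= /f lin_sum.
under eq_bigr => t _ do rewrite lE.
rewrite -lin_sum; congr (g _); apply/ffunP => t; rewrite sum_ffunE (bigD1 t) //=.
rewrite ffunE eqxx big1 ?addr0 // => t' /negPf tt'; by rewrite ffunE eq_sym tt'.
Qed.

(* The comparison maps F -> P -> F lift the identity of M, so their composite is
   homotopic to the identity of F; it vanishes in degree 3. *)
Lemma projdim2_contraction (M : lmodType S) (F : nat -> lmodType S) (eF : {linear F 0 -> M})
    (dF : forall i, {linear F i.+1 -> F i}) :
  (forall i, projective (F i)) -> (forall y, exists x, eF x = y) ->
  (forall x, eF x = 0 <-> exists y, dF 0 y = x) ->
  (forall i x, dF i x = 0 <-> exists y, dF i.+1 y = x) ->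
  (forall x : F 4, x = 0) -> projdim_le M 2 ->
  exists s : {linear F 2 -> F 3}, forall x, s (dF 2 x) = x.
Proof.
move=> Fproj eFsurj eFker dFker F40 [P [eP [dP [Pproj P0 ePsurj ePker dPker]]]].
have eFd y : eF (dF 0 y) = 0 by apply/eFker; exists y.
have ePd y : eP (dP 0 y) = 0 by apply/ePker; exists y.
have dFd i y : dF i (dF i.+1 y) = 0 by apply/dFker; exists y.
have dPd i y : dP i (dP i.+1 y) = 0 by apply/dPker; exists y.
have [a0 a0E] := projective_lift (del := eP) (g := eF) (Fproj 0%N) (fun x => ePsurj _).
have [b0 b0E] := projective_lift (del := eF) (g := eP) (Pproj 0%N) (fun x => eFsurj _).
have [|a1 a1E] := @projective_lift _ _ (dP 0) _ (a0 \o dF 0) (Fproj 1%N).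
  by move=> x; apply/ePker; rewrite /= a0E eFd.
have [|b1 b1E] := @projective_lift _ _ (dF 0) _ (b0 \o dP 0) (Pproj 1%N).
  by move=> x; apply/eFker; rewrite /= b0E ePd.
have [|a2 a2E] := @projective_lift _ _ (dP 1) _ (a1 \o dF 1) (Fproj 2%N).
  by move=> x; apply/dPker; rewrite /= a1E /= dFd linear0.
have [|b2 b2E] := @projective_lift _ _ (dF 1) _ (b1 \o dP 1) (Pproj 2%N).
  by move=> x; apply/dFker; rewrite /= b1E /= dPd linear0.
have h0_lin : linear (fun x => x - b0 (a0 x)).
  by move=> c x y; rewrite !linearP /= scalerDr addrACA.
have [|s0 s0E] := @projective_lift _ _ (dF 0) _ (lin_of h0_lin) (Fproj 0%N).
  by move=> x; apply/eFker; rewrite /= linearB /= b0E a0E subrr.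
have h1_lin : linear (fun x => x - b1 (a1 x) - s0 (dF 0 x)).
  move=> c x y; rewrite !linearP /= !scalerDr [c *: x + y + _]addrACA.
  by rewrite [LHS]addrACA.
have [|s1 s1E] := @projective_lift _ _ (dF 1) _ (lin_of h1_lin) (Fproj 1%N).
  move=> x; apply/dFker; rewrite /= !linB s0E /= b1E /= a1E /=.
  by rewrite subrr.
have h2_lin : linear (fun x => x - b2 (a2 x) - s1 (dF 1 x)).
  move=> c x y; rewrite !linearP /= !scalerDr [c *: x + y + _]addrACA.
  by rewrite [LHS]addrACA.
have [|s2 s2E] := @projective_lift _ _ (dF 2) _ (lin_of h2_lin) (Fproj 2%N).
  move=> x; apply/dFker; rewrite /= !linB s1E /= b2E /= a2E /=.
  by rewrite dFd linear0 subr0 subrr.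
exists s2 => x; apply/eqP; rewrite eq_sym -subr_eq0; apply/eqP.
suff /dFker[y <-] : dF 2 (x - s2 (dF 2 x)) = 0 by rewrite (F40 y) linear0.
rewrite linB s2E /= dFd linear0 subr0.
(* This is a cycle in degree 2 of P, hence a boundary from P 3 = 0: the composite of the comparison
   maps vanishes on the image of dF 2, and only the homotopy remains. *)
have /dPker[y yE] : dP 1 (a2 (dF 2 x)) = 0 by rewrite a2E /= dFd linear0.
by rewrite -yE (P0 3%N isT y) !linear0 ?subr0 ?addr0 subrr.
Qed.

End Lifting.

Section Koszul.
Variable S : comNzRingType.

(** The modules of the Koszul complex as an iterated mapping cone. They depend on the length of the
    sequence only; the sequence enters in [koszul_d]. Functions on [void] form the zero module. *)
Fixpoint koszul (k i : nat) : lmodType S :=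
  match k, i with
  | 0, 0 => S^o
  | 0, _.+1 => {ffun void -> S^o}
  | k'.+1, 0 => koszul k' 0
  | k'.+1, i'.+1 => (koszul k' i'.+1 * koszul k' i')%type
  end.

Fixpoint koszul_d (l : seq S) : forall i, koszul (size l) i.+1 -> koszul (size l) i :=
  match l return forall i, koszul (size l) i.+1 -> koszul (size l) i with
  | [::] => fun i _ => 0
  | z :: l' => fun i =>
      match i return koszul (size (z :: l')) i.+1 -> koszul (size (z :: l')) i with
      | 0 => fun u => @koszul_d l' 0 u.1 + z *: u.2
      | i'.+1 => fun u => (@koszul_d l' i'.+1 u.1 + z *: u.2, - @koszul_d l' i' u.2)
      end
  end.
Arguments koszul_d : clear implicits.

Lemma koszul_d_linear l i : linear (koszul_d l i).
Proof.
elim: l i => [|z l IH] [|i] a x y /=; rewrite ?scaler0 ?addr0 //.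
  by rewrite IH scalerDr [z *: (a *: _)]scalerA mulrC -scalerA scalerDr addrACA.
apply: (congr2 pair) => /=; last by rewrite IH opprD -scalerN.
by rewrite IH scalerDr [z *: (a *: _)]scalerA mulrC -scalerA scalerDr addrACA.
Qed.

Lemma koszul_trivial k i (x : koszul k i) : (k < i)%N -> x = 0.
Proof.
elim: k i x => [|k IH] [|i] x //= ki; first by apply/ffunP => -[].
by case: x => u v; rewrite (IH _ u) 1?(IH _ v) // ltnW.
Qed.

Lemma koszul_projective k i : projective (koszul k i).
Proof.
elim: k i => [|k IH] [|i] /=; first exact: projective_regular.
- by apply: projective_trivial => x; apply/ffunP => -[].
- exact: IH.
- by apply: projective_pair; apply: IH.
Qed.

(** Identifies the degree 0 term with S, to which it reduces only once k is known. *)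
Fixpoint koszul_aug k : koszul k 0 -> S^o :=
  match k return koszul k 0 -> S^o with 0 => id | k'.+1 => @koszul_aug k' end.

Lemma koszul_aug_linear k : linear (@koszul_aug k).
Proof. by elim: k => //= k IH a x y; apply: IH. Qed.

Lemma koszul_augZ k c (x : koszul k 0) : koszul_aug (c *: x) = c * koszul_aug x.
Proof. by elim: k x => //= k IH x; apply: IH. Qed.

Lemma koszul_aug_inj k : injective (@koszul_aug k).
Proof. by elim: k => //= k IH x y; apply: IH. Qed.

Lemma koszul_aug_surj k y : exists x, @koszul_aug k x = y.
Proof. by elim: k => [|k [x <-]]; [exists y|exists x]. Qed.

Fixpoint lspan (l : seq S) (x : S) : Prop :=
  if l is z :: l' then exists y v, lspan l' y /\ x = y + z * v else x = 0.

Lemma lspan0 l : lspan l 0.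
Proof. by elim: l => //= z l IH; exists 0, 0; rewrite mulr0 addr0. Qed.

Lemma lspanD l x y : lspan l x -> lspan l y -> lspan l (x + y).
Proof.
elim: l x y => [|z l IH] x y /=; first by move=> -> ->; rewrite addr0.
move=> [a [b [la ->]]] [c [d [lc ->]]]; exists (a + c), (b + d); split; first exact: IH.
by rewrite mulrDr addrACA.
Qed.

Lemma lspanM l a x : lspan l x -> lspan l (a * x).
Proof.
elim: l x => [|z l IH] x /=; first by move=> ->; rewrite mulr0.
move=> [b [c [lb ->]]]; exists (a * b), (a * c); split; first exact: IH.
by rewrite mulrDr mulrCA.
Qed.

Lemma lspan_ideal l (I : ideal S) x : (forall z, z \in l -> z \in I) -> lspan l x -> x \in I.
Proof.
elim: l x => [|z l IH] x lI /=; first by move=> ->; apply: ideal0.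
move=> [y [v [ly ->]]]; apply: idealD.
  by apply: IH => // w wl; apply: lI; rewrite inE wl orbT.
by rewrite mulrC; apply/idealMl/lI; rewrite inE eqxx.
Qed.

Lemma lspan_mem l z : z \in l -> lspan l z.
Proof.
elim: l => //= y l IH; rewrite inE => /orP[/eqP ->|zl].
  by exists 0, 1; split; [apply: lspan0|rewrite add0r mulr1].
by exists z, 0; split; [apply: IH|rewrite mulr0 addr0].
Qed.

Lemma koszul_d0_image l x : lspan l x <-> exists u, koszul_aug (koszul_d l 0 u) = x.
Proof.
elim: l x => [|z l IH] x /=; first by split=> [->|[u <-]]; [exists 0|].
split=> [[y [v [/IH[u uE] ->]]]|[[u v] <-]].
  have [w wE] := koszul_aug_surj (size l) v; exists (u, w) => /=.
  by rewrite addrC koszul_aug_linear wE uE addrC.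
exists (koszul_aug (koszul_d l 0 u)), (koszul_aug v); split; first by apply/IH; exists u.
by rewrite /= addrC koszul_aug_linear addrC.
Qed.

(** Each entry is a nonzerodivisor modulo the entries after it, following the recursion of
    [koszul_d]. The quotient may be zero, which admits the sequence 1, 1, 1, 1. *)
Fixpoint regular_seq (l : seq S) : Prop :=
  if l is z :: l' then (forall v, lspan l' (z * v) -> lspan l' v) /\ regular_seq l' else True.

Definition koszul_lin l i : {linear koszul (size l) i.+1 -> koszul (size l) i} := lin_of (@koszul_d_linear l i).

Lemma koszul_d_addZ l i a z b : koszul_d l i (a + z *: b) = koszul_d l i a + z *: koszul_d l i b.
Proof. by rewrite addrC koszul_d_linear addrC. Qed.

Lemma koszul_dN l i a : koszul_d l i (- a) = - koszul_d l i a.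
Proof. exact: (linearN (koszul_lin l i)). Qed.

(** Mapping cone argument: for a cycle (a, b), write b = d c; then a + z c is a cycle, say d e, and
    (e, - c) maps to (a, b). In degree 1 the existence of c is the regularity of z. *)
Lemma koszul_d_exact l i u : regular_seq l -> koszul_d l i u = 0 -> exists v, koszul_d l i.+1 v = u.
Proof.
elim: l i u => [|z l IH] i u /=.
  by move=> _ _; exists 0; apply/esym/ffunP => -[].
move=> [zreg lreg]; case: i u => [|i] [a b] /= [].
  move=> ab0; have : lspan l (z * koszul_aug b).
    apply/koszul_d0_image; exists (- a); rewrite -koszul_augZ.
    congr koszul_aug; rewrite koszul_dN.
    by apply/eqP; rewrite eq_sym -addr_eq0 addrC /= ab0.
  move=> /zreg /koszul_d0_image[c /koszul_aug_inj cb].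
  have [e eE] : exists e, koszul_d l 1 e = a + z *: c.
    by apply: IH => //; rewrite koszul_d_addZ cb.
  exists (e, - c); rewrite /= eE scalerN addrK; congr pair.
  by rewrite koszul_dN opprK.
move=> ab0 b0.
have [c cb] : exists c, koszul_d l i.+1 c = b.
  by apply: IH => //; apply/eqP; rewrite -oppr_eq0 b0.
have [e eE] : exists e, koszul_d l i.+2 e = a + z *: c.
  by apply: IH => //; rewrite koszul_d_addZ cb.
exists (e, - c); rewrite /= eE scalerN addrK; congr pair.
by rewrite koszul_dN opprK.
Qed.

Lemma koszul_d_comp l i v : koszul_d l i (koszul_d l i.+1 v) = 0.
Proof.
elim: l i v => [|z l IH] [|i] v //=.
  by rewrite koszul_d_addZ IH add0r scalerN subrr.
by rewrite koszul_d_addZ IH add0r scalerN subrr koszul_dN IH !oppr0.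
Qed.

(** Minimality of the Koszul complex: the differentials have, up to sign, only entries of l and
    zeros as matrix coefficients. *)
Lemma linear_koszul_d l i (f : koszul (size l) i -> S^o) u : linear f -> lspan l (f (koszul_d l i u)).
Proof.
elim: l i f u => [|z l IH] [|i] f u f_lin /=.
- exact: (linear0 (lin_of f_lin)).
- exact: (linear0 (lin_of f_lin)).
- exists (f (koszul_d l 0 u.1)), (f u.2); split; first exact: (IH 0%N f).
  by rewrite addrC f_lin addrC.
pose f1 x := f (x, 0); pose f2 x := f (0, x).
have f1_lin : linear f1.
  by move=> a x y; rewrite /f1 -f_lin; congr (f _); apply: (congr2 pair) => //=; rewrite scaler0 addr0.
have f2_lin : linear f2.
  by move=> a x y; rewrite /f2 -f_lin; congr (f _); apply: (congr2 pair) => //=; rewrite scaler0 addr0.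
exists (f1 (koszul_d l i.+1 u.1) + f2 (- koszul_d l i u.2)), (f1 u.2); split.
  apply: lspanD; first exact: IH.
  rewrite -[f2 _]/(lin_of f2_lin _) linearN -mulN1r; apply: lspanM; exact: IH.
have fE p q : f (p, q) = f1 p + f2 q.
  have := f_lin 1 (p, 0) (0, q); rewrite !scale1r => <-; congr (f _).
  by apply: (congr2 pair); rewrite /= ?addr0 ?add0r.
by rewrite fE [_ + z *: _]addrC f1_lin -addrA addrC.
Qed.

Lemma koszul_top k : exists (t : koszul k k) (f : koszul k k -> S^o), linear f /\ f t = 1.
Proof.
elim: k => [|k [t [f [f_lin ft]]]]; first by exists 1, id.
by exists (0, t), (fun x => f x.2); split=> // a x y; rewrite -f_lin.
Qed.

End Koszul.
Arguments koszul_d {S} l i u.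

(** * The singular locus is free *)

Lemma height_eq (S : comNzRingType) (P Q : ideal S) k :
  {subset P <= Q} -> {subset Q <= P} -> height P k -> height Q k.
Proof.
move=> PQ QP.
have H (P' Q' : ideal S) l : {subset P' <= Q'} -> {subset Q' <= P'} -> height_ge P' l -> height_ge Q' l.
  case: l => [|l] // PQ' QP' [Q0 [pQ0 Q0P PQ0 hQ0]]; exists Q0; split=> //.
    by move=> x /Q0P /PQ'.
  by move=> Q'Q0; apply: PQ0 => x /PQ' /Q'Q0.
by move=> [hk hkN]; split; [apply: H hk|move=> /(H _ _ _ QP PQ)].
Qed.

Section SingularLocus.
Variables (K : numFieldType) (N : nat) (Z : 'I_N -> cps N K) (hZ : coordinates Z).
Variables (A B : {set 'I_N}).
Hypotheses (A2 : (1 < #|A|)%N) (B2 : (1 < #|B|)%N) (AB : [disjoint A & B]).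
Local Notation S := (cps N K).
Implicit Types (T W : {set 'I_N}) (x y u : S).
Local Notation zprod := (zprod Z).
Local Notation h := (zprod2 Z A B).
Local Notation cideal := (cideal Z).

(* The irreducible components of the singular locus are the Z_T = 0, T special. *)
Definition special T := [&& T \subset A :|: B, #|T :&: A| == 2 & #|T :&: B| == 2]%N.

Lemma special4 a a' b b' : a \in A -> a' \in A -> a != a' -> b \in B -> b' \in B -> b != b' ->
  special ([set a; a'] :|: [set b; b']).
Proof.
move=> aA a'A aa' bB b'B bb'.
have NB i : i \in A -> i \notin B by move=> iA; apply/negP; apply: (disjointN AB).
have NA i : i \in B -> i \notin A by move=> iB; apply/negP => iA; apply: (disjointN AB iA).
apply/and3P; split.
- by apply/subsetP => i; rewrite !inE => /orP[] /orP[] /eqP ->; rewrite ?aA ?a'A ?bB ?b'B ?orbT.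
- rewrite (_ : _ :&: A = [set a; a']) ?cards2 ?aa' //.
  apply/setP => i; rewrite !inE; apply/andP/orP => [[/orP[/orP//|/orP[]/eqP->] iA]|].
  + by case/negP: (NA _ bB).
  + by case/negP: (NA _ b'B).
  + by case=> /eqP ->; rewrite ?eqxx ?orbT ?aA ?a'A.
- rewrite (_ : _ :&: B = [set b; b']) ?cards2 ?bb' //.
  apply/setP => i; rewrite !inE; apply/andP/orP => [[/orP[/orP[]/eqP->|/orP//] iA]|].
  + by case/negP: (NB _ aA).
  + by case/negP: (NB _ a'A).
  + by case=> /eqP ->; rewrite ?eqxx ?orbT ?bB ?b'B.
Qed.

Lemma exists_two (D : {set 'I_N}) : (1 < #|D|)%N -> exists a a', [/\ a \in D, a' \in D & a != a'].
Proof. by move=> /card_gt1P[a [a' [aD a'D aa']]]; exists a, a'. Qed.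

Lemma exists_special : exists T, special T.
Proof.
have [a [a' [aA a'A aa']]] := exists_two A2; have [b [b' [bB b'B bb']]] := exists_two B2.
by exists ([set a; a'] :|: [set b; b']); apply: special4.
Qed.

Lemma special_other (D : {set 'I_N}) T j : #|T :&: D| = 2%N -> exists i, [/\ i \in T, i \in D & i != j].
Proof.
move=> TD; have [a [a' [/setIP[aT aD] /setIP[a'T a'D] aa']]] : exists a a', [/\ a \in T :&: D, a' \in T :&: D & a != a'].
  by apply: exists_two; rewrite TD.
have [aj|aj] := eqVneq a j; last by exists a.
by exists a'; split=> //; rewrite -aj eq_sym.
Qed.

Lemma zprod_in_cideal W T i : i \in W -> i \in T -> zprod W \in cideal T.
Proof. by move=> iW iT; rewrite (zprod_D1 _ iW) mulrC; apply/idealMl/cideal_Z. Qed.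

Lemma zprodA_in_cideal T j : special T -> zprod (A :\ j) \in cideal T.
Proof.
move=> /and3P[_ /eqP TA _]; have [i [iT iA ij]] := special_other j TA.
by apply: zprod_in_cideal iT; rewrite in_setD1 ij.
Qed.

Lemma zprodB_in_cideal T j : special T -> zprod (B :\ j) \in cideal T.
Proof.
move=> /and3P[_ _ /eqP TB]; have [i [iT iB ij]] := special_other j TB.
by apply: zprod_in_cideal iT; rewrite in_setD1 ij.
Qed.

Definition sing_gen : ideal S := ideal_gen (fun x => x \in principal h \/
  exists (f : 'I_1 -> S) (i : incr_index N 1), (forall a, f a \in principal h) /\ x = wedge_d f i).

Lemma sing_gen_cideal T : special T -> {subset sing_gen <= cideal T}.
Proof.
move=> sT; have [D [hD DZ [G [_ _ [_ pE]]]]] := dual_derivations hZ.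
have hT : h \in cideal T.
  have [i [iT iA _]] : exists i, [/\ i \in T, i \in A & true].
    have /card_gt0P[j _] := ltnW A2; case/and3P: sT => _ /eqP TA _.
    by have [i [iT iA _]] := special_other j TA; exists i.
  have [k [kT kB _]] : exists i, [/\ i \in T, i \in B & true].
    have /card_gt0P[j _] := ltnW A2; case/and3P: sT => _ _ /eqP TB.
    by have [k [kT kB _]] := special_other j TB; exists k.
  by apply: idealD; [apply: zprod_in_cideal iA iT|apply: zprod_in_cideal kB kT].
have phT i : pderiv i h \in cideal T.
  rewrite pE; apply: ideal_sum => j _; rewrite mulrC; apply: idealMl.
  rewrite (deriv_binomial AB (hD j) (fun i => DZ i j)); case: ifP => _; first exact: zprodA_in_cideal.
  by case: ifP => _; [apply: zprodB_in_cideal|apply: ideal0].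
have cT x : x \in principal h -> x \in cideal T.
  by move=> /principalP[c ->]; apply: idealMl.
apply: ideal_gen_sub => x [|[f [i [fh ->]]]]; first exact: cT.
rewrite -(idx1K i) wedge_d1; have /principalP[c ->] := fh ord0.
by rewrite pderivM; apply: idealD; apply: idealMl.
Qed.

Lemma zprodA_in_sing_gen j : j \in A -> zprod (A :\ j) \in sing_gen.
Proof.
move=> jA; have [D [hD DZ [G [_ _ [DE _]]]]] := dual_derivations hZ.
have := deriv_binomial AB (hD j) (fun i => DZ i j); rewrite jA => <-.
rewrite DE; apply: ideal_sum => i _; apply/idealMl/mem_ideal_gen; right.
exists (fun=> h), (idx1 i); rewrite wedge_d1; split=> // _.
exact: mem_ideal_gen.
Qed.

Lemma zprodB_in_sing_gen j : j \in B -> zprod (B :\ j) \in sing_gen.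
Proof.
move=> jB; have [D [hD DZ [G [_ _ [DE _]]]]] := dual_derivations hZ.
have := deriv_binomial AB (hD j) (fun i => DZ i j); rewrite jB.
case: ifP => [jA|_ <-]; first by case: (disjointN AB jA jB).
rewrite DE; apply: ideal_sum => i _; apply/idealMl/mem_ideal_gen; right.
exists (fun=> h), (idx1 i); rewrite wedge_d1; split=> // _.
exact: mem_ideal_gen.
Qed.

Lemma zprod_sub W W' (I : ideal S) : W \subset W' -> zprod W \in I -> zprod W' \in I.
Proof.
move=> WW' WI; rewrite /zprod (bigID (mem W)) /= mulrC; apply: idealMl.
rewrite (eq_bigl (mem W)) // => i; rewrite andb_idl //; exact: (subsetP WW').
Qed.

(** If W missed two elements of A and two of B, these would form a special set disjoint from W. So W
    contains all but one element of A, or of B, and the product over W is a multiple of a partial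
    derivative of h. *)
Lemma covering_in_sing_gen W : (forall T, special T -> exists2 i, i \in T & i \in W) ->
  zprod W \in sing_gen.
Proof.
move=> Wcov.
have sub (D : {set 'I_N}) : (1 < #|D|)%N -> ~ (exists a a', [/\ a \in D :\: W, a' \in D :\: W & a != a']) ->
    exists2 j, j \in D & D :\ j \subset W.
  move=> D2 Dn; have [D0|[j jD]] := set_0Vmem (D :\: W).
    have /card_gt0P[j jD] := ltnW D2; exists j => //; apply: subset_trans (subsetDl _ _) _.
    by rewrite -setD_eq0 D0.
  exists j; first by case/setDP: jD.
  apply/subsetP => i; rewrite !inE => /andP[ij iD]; apply: contrapT => /negP iW.
  by apply: Dn; exists i, j; rewrite inE iW iD.
have [[a [a' [/setDP[aA aW] /setDP[a'A a'W] aa']]]|An] :=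
    pselect (exists a a', [/\ a \in A :\: W, a' \in A :\: W & a != a']); last first.
  have [j jA jW] := sub A A2 An; apply: zprod_sub jW _; exact: zprodA_in_sing_gen.
have [[b [b' [/setDP[bB bW] /setDP[b'B b'W] bb']]]|Bn] :=
    pselect (exists a a', [/\ a \in B :\: W, a' \in B :\: W & a != a']); last first.
  have [j jB jW] := sub B B2 Bn; apply: zprod_sub jW _; exact: zprodB_in_sing_gen.
have [i iT iW] := Wcov _ (special4 aA a'A aa' bB b'B bb').
move: iT iW; rewrite !inE => /orP[] /orP[] /eqP ->.
- by rewrite (negPf aW).
- by rewrite (negPf a'W).
- by rewrite (negPf bW).
- by rewrite (negPf b'W).
Qed.

(* u^k is a product of elements sum_(i in T) c_i Z_i, one for each T; expanding it
   gives monomials whose support W' meets every T. *)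
Lemma power_in_sing_gen u (Ts : seq {set 'I_N}) W :
  (forall T, T \in Ts -> u \in cideal T) ->
  (forall W', W \subset W' -> (forall T, T \in Ts -> exists2 i, i \in T & i \in W') ->
    zprod W' \in sing_gen) ->
  u ^+ size Ts * zprod W \in sing_gen.
Proof.
elim: Ts W => [|T Ts IH] W uT Wcov /=; first by rewrite mul1r; apply: Wcov.
have uTs T' : T' \in Ts -> u \in cideal T' by move=> TT; apply: uT; rewrite inE TT orbT.
pose v := u ^+ size Ts * zprod W.
have cl : submod_closed ([pred x | x * v \in sing_gen] : {pred S^o}).
  split=> [|a x y]; first by change (0 * v \in sing_gen); rewrite mul0r; apply: ideal0.
  change (x * v \in sing_gen -> y * v \in sing_gen -> (a * x + y) * v \in sing_gen).
  by rewrite mulrDl -mulrA; apply: idealZD.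
rewrite exprS -mulrA -/v; suff : u \in Ideal cl by [].
have : u \in cideal T by apply: uT; rewrite inE eqxx.
apply: cideal_sub => i iT; change (Z i * v \in sing_gen).
have [iW|iW] := boolP (i \in W).
  apply/idealMl/IH => // W' WW' cov; apply: Wcov => // T'; rewrite inE => /orP[/eqP ->|]; last exact: cov.
  by exists i => //; apply: (subsetP WW').
have -> : Z i * v = u ^+ size Ts * zprod (i |: W).
  by rewrite /v mulrCA; congr (_ * _); rewrite /zprod big_setU1.
apply: IH => // W' WW' cov; apply: Wcov.
  by apply: subset_trans WW'; apply: subsetUr.
move=> T'; rewrite inE => /orP[/eqP ->|]; last exact: cov.
by exists i => //; apply: (subsetP WW'); rewrite !inE eqxx.
Qed.

Lemma singP u : (u \in sing 1 (principal h)) <-> forall T, special T -> u \in cideal T.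
Proof.
split=> [/asboolP[k uk] T sT|uT].
  exact: (prime_idealX (cideal_prime hZ T) (sing_gen_cideal sT uk)).
apply/asboolP; exists (size (enum special)); rewrite -[_ ^+ _]mulr1.
have <- : zprod set0 = 1 by rewrite /zprod big_set0.
apply: power_in_sing_gen => [T|W _ cov]; first by rewrite mem_enum => /uT.
apply: covering_in_sing_gen => T sT; apply: cov; by rewrite mem_enum.
Qed.

Lemma cards_special T : special T -> #|T| = 4%N.
Proof.
move=> /and3P[TAB /eqP TA /eqP TB].
have -> : T = (T :&: A) :|: (T :&: B) by rewrite -setIUr; apply/esym/setIidPl.
rewrite cardsU TA TB (_ : _ :&: _ = set0) ?cards0 //; apply/setP => i; rewrite !inE.
by apply/negP => /andP[/andP[_ iA] /andP[_ iB]]; apply: (disjointN AB iA iB).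
Qed.

(** From the product over A - j the prime obtains some Z_a, and from the product over A - a a second
    one; likewise for B. *)
Lemma prime_contains_special (P : ideal S) : prime_ideal P ->
  {subset sing 1 (principal h) <= P} -> exists2 T, special T & {subset cideal T <= P}.
Proof.
move=> PP JP.
have two (D : {set 'I_N}) : (1 < #|D|)%N -> (forall j, zprod (D :\ j) \in P) ->
    exists a a', [/\ a \in D, a' \in D, a != a', Z a \in P & Z a' \in P].
  move=> D2 DP; have /card_gt0P[j jD] := ltnW D2.
  have [a] := prime_ideal_prodP PP (DP j); rewrite !inE => /andP[_ aD] Pa.
  have [a'] := prime_ideal_prodP PP (DP a); rewrite !inE => /andP[aa' a'D] Pa'.
  by exists a, a'; split=> //; rewrite eq_sym.
have [|a [a' [aA a'A aa' Pa Pa']]] := two A A2.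
  by move=> j; apply/JP/singP => T sT; apply: zprodA_in_cideal.
have [|b [b' [bB b'B bb' Pb Pb']]] := two B B2.
  by move=> j; apply/JP/singP => T sT; apply: zprodB_in_cideal.
exists ([set a; a'] :|: [set b; b']); first exact: special4.
by apply: cideal_sub => i; rewrite !inE => /orP[] /orP[] /eqP ->.
Qed.

Lemma reduced_equidim_sing : reduced_equidim (sing 1 (principal h)) 4.
Proof.
split.
- have [T sT] := exists_special; apply/negP => /singP /(_ T sT).
  by apply/negP/prime_ideal1/cideal_prime.
- move=> x /asboolP[k /singP xk]; apply/singP => T sT.
  exact: (prime_idealX (cideal_prime hZ T) (xk T sT)).
move=> P [PP JP Pmin]; have [T sT TP] := prime_contains_special PP JP.
have PT : {subset P <= cideal T}.
  apply: Pmin => //; first exact: cideal_prime.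
  by move=> x /singP; apply.
by apply: (height_eq TP PT); rewrite -(cards_special sT); apply: cideal_height.
Qed.

End SingularLocus.

(** * Multi-logarithmic 4-vector fields along the singular locus *)

Lemma det_in_ideal (S : comNzRingType) (I : ideal S) k (M : 'M[S]_k) b :
  (forall a, M a b \in I) -> \det M \in I.
Proof.
move=> MI; rewrite (expand_det_col M b); apply: ideal_sum => a _.
by rewrite mulrC; apply: idealMl.
Qed.

Section WedgeCoordinates.
Variables (K : numFieldType) (N : nat) (Z : 'I_N -> cps N K) (hZ : coordinates Z) (k : nat).
Local Notation S := (cps N K).
Implicit Types (I J : incr_index N k) (d : mvfield K N k).

Definition dZ I : dform K N k := wedge_d (fun b => Z (tnth (val I) b)).

(** The chain rule factors the jacobian matrix of f through that of Z; Cauchy-Binet then expresses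
    df_1 /\ ... /\ df_k in the basis of the dZ_I. *)
Lemma wedge_d_expand (D : 'I_N -> S -> S) (f : 'I_k -> S) :
  (forall i u, pderiv i u = \sum_j D j u * jacobian Z j i) ->
  forall J, wedge_d f J = \sum_I \det (\matrix_(a, b) D (tnth (val I) b) (f a)) * dZ I J.
Proof.
move=> DE J; rewrite ffunE.
rewrite (_ : \matrix_(_, _) _ = (\matrix_(a, j) D j (f a)) *m
   (\matrix_(j, b) jacobian Z j (tnth (val J) b))); last first.
  by apply/matrixP => a b; rewrite !mxE DE; apply: eq_bigr => j _; rewrite !mxE.
rewrite cauchy_binet; apply: eq_bigr => I _; congr (\det _ * _).
  by apply/matrixP => a b; rewrite !mxE.
by rewrite ffunE; congr (\det _); apply/matrixP => a b; rewrite !mxE.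
Qed.

Lemma pairing_expand (D : 'I_N -> S -> S) (f : 'I_k -> S) d :
  (forall i u, pderiv i u = \sum_j D j u * jacobian Z j i) ->
  pairing d (wedge_d f) =
  \sum_I \det (\matrix_(a, b) D (tnth (val I) b) (f a)) * pairing d (dZ I).
Proof.
move=> DE; rewrite /pairing; under eq_bigr => J _ do rewrite (wedge_d_expand f DE) mulr_sumr.
rewrite exchange_big /=; apply: eq_bigr => I _; rewrite mulr_sumr.
by apply: eq_bigr => J _; rewrite mulrCA.
Qed.

(** E I is the wedge of the d/dZ_i for i in I, with the minors of the inverse jacobian as
    coordinates. *)
Lemma dual_basis : exists E : incr_index N k -> mvfield K N k,
  (forall I J, pairing (E J) (dZ I) = (I == J)%:R) /\
  forall d, d = \sum_I (pairing d (dZ I) : S) *: E I.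
Proof.
have [G [JG GJ]] := jacobian_inverse hZ.
pose E J : mvfield K N k := [ffun L => \det (\matrix_(a, b) G (tnth (val L) a) (tnth (val J) b))].
have dZE I L : dZ I L = \det (\matrix_(a < k, b < k) jacobian Z (tnth (val I) a) (tnth (val L) b)).
  by rewrite ffunE; congr (\det _); apply/matrixP => a b; rewrite !mxE.
exists E; split=> [I J|d].
  rewrite /pairing -(det_minor1 S I J) -JG.
  rewrite (_ : \matrix_(_, _) _ = (\matrix_(a, l) jacobian Z (tnth (val I) a) l) *m
     (\matrix_(l, b) G l (tnth (val J) b))); last first.
    by apply/matrixP => a b; rewrite !mxE; apply: eq_bigr => l _; rewrite !mxE.
  rewrite cauchy_binet; apply: eq_bigr => L _; rewrite dZE ffunE mulrC.
  by apply: (congr2 *%R); congr (\det _); apply/matrixP => a b; rewrite !mxE.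
apply/ffunP => L; rewrite sum_ffunE.
transitivity (\sum_J d J * (L == J)%:R).
  by rewrite (bigD1 L) //= eqxx mulr1 big1 ?addr0 // => J /negPf JL; rewrite eq_sym JL mulr0.
have GJE J : (L == J)%:R = \sum_I \det (\matrix_(a < k, b < k) G (tnth (val L) a) (tnth (val I) b)) * dZ I J.
  rewrite -(det_minor1 S L J) -GJ.
  rewrite (_ : \matrix_(_, _) _ = (\matrix_(a, l) G (tnth (val L) a) l) *m
     (\matrix_(l, b) jacobian Z l (tnth (val J) b))); last first.
    by apply/matrixP => a b; rewrite !mxE; apply: eq_bigr => l _; rewrite !mxE.
  rewrite cauchy_binet; apply: eq_bigr => I _; rewrite dZE.
  by apply: (congr2 *%R); congr (\det _); apply/matrixP => a b; rewrite !mxE.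
under eq_bigr => J _ do rewrite GJE mulr_sumr.
rewrite exchange_big /=; apply: eq_bigr => I _; rewrite !ffunE [RHS]mulr_suml.
by apply: eq_bigr => J _; rewrite mulrCA mulrC.
Qed.

End WedgeCoordinates.

Section SingFree.
Variables (K : numFieldType) (N : nat) (Z : 'I_N -> cps N K) (hZ : coordinates Z).
Variables (A B : {set 'I_N}).
Hypotheses (A2 : (1 < #|A|)%N) (B2 : (1 < #|B|)%N) (AB : [disjoint A & B]).
Local Notation S := (cps N K).
Implicit Types (T W : {set 'I_N}) (x y u : S) (I : incr_index N 4).
Local Notation zprod := (zprod Z).
Local Notation cideal := (cideal Z).
Local Notation special := (special A B).
Variable J : ideal S.
Hypothesis JP : forall u, (u \in J) <-> forall T, special T -> u \in cideal T.

Definition index_set I : {set 'I_N} := [set i in val I].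

Lemma index_set_tnth I a : tnth (val I) a \in index_set I.
Proof. by rewrite inE mem_tnth. Qed.

Lemma card_index_set I : #|index_set I| = 4%N.
Proof. by rewrite cardsE (card_uniqP (incr_index_uniq I)) size_tuple. Qed.

Lemma index_set_inj I I' : index_set I = index_set I' -> I = I'.
Proof. by move=> /setP E; apply: incr_index_eq => i; have := E i; rewrite !inE. Qed.

Lemma special_index_set T : special T -> exists I, index_set I = T.
Proof.
move=> sT; have sz : size (enum T) == 4%N by rewrite -cardE (cards_special AB sT).
have phiI : injective [ffun a => tnth (Tuple sz) a].
  by move=> a b; rewrite !ffunE; apply/tuple_uniqP: a b; rewrite /= enum_uniq.
have [I memI] := incr_index_of_inj phiI; exists I; apply/setP => i; rewrite inE memI.
apply/codomP/idP => [[a ->]|iT]; first by rewrite ffunE -mem_enum; apply: (mem_tnth a (Tuple sz)).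
have /tnthP[a ->] : i \in Tuple sz by rewrite mem_enum.
by exists a; rewrite ffunE.
Qed.

Lemma derivation_cideal (D : S -> S) j T x : derivation D -> (forall i, D (Z i) = (i == j)%:R) ->
  j \notin T -> x \in cideal T -> D x \in cideal T.
Proof.
move=> hD DZ jT.
have cl : submod_closed ([pred x | (x \in cideal T) && (D x \in cideal T)] : {pred S^o}).
  split=> [|a u v].
    change ((0 \in cideal T) && (D 0 \in cideal T)).
    by rewrite (derivation0 hD) ideal0.
  change ((u \in cideal T) && (D u \in cideal T) -> (v \in cideal T) && (D v \in cideal T) ->
    (a * u + v \in cideal T) && (D (a * u + v) \in cideal T)).
  move=> /andP[uT DuT] /andP[vT DvT]; apply/andP; split; first exact: idealZD.
  rewrite (derivationD hD) (derivationM hD).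
  by apply: idealD => //; apply: idealD; apply: idealMl.
move=> xT; have : x \in Ideal cl.
  move: xT; apply: cideal_sub => i iT; change ((Z i \in cideal T) && (D (Z i) \in cideal T)).
  rewrite cideal_Z // DZ (_ : i == j = false) ?ideal0 //.
  by apply: contraNF jT => /eqP <-.
by case/andP.
Qed.

(** Two distinct index sets of the same size: I has an index outside I', and the derivation along it
    preserves the ideal of I', which thus contains a whole column. *)
Lemma minor_in_cideal (D : 'I_N -> S -> S) (f : 'I_4 -> S) I I' :
  (forall j, derivation (D j)) -> (forall i j, D j (Z i) = (i == j)%:R) ->
  (forall a, f a \in cideal (index_set I')) -> I != I' ->
  \det (\matrix_(a, b) D (tnth (val I) b) (f a)) \in cideal (index_set I').
Proof.
move=> hD DZ fI II'.
have [b bI'] : exists b, tnth (val I) b \notin index_set I'.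
  apply: contrapT => nE; case/eqP: II'; apply: index_set_inj; apply/eqP.
  rewrite eqEcard !card_index_set leqnn andbT; apply/subsetP => i; rewrite inE => /tnthP[b ->].
  by apply: contrapT => /negP bI'; apply: nE; exists b.
apply: (det_in_ideal (b := b)) => a; rewrite mxE.
exact: (derivation_cideal (hD _) (fun i => DZ i _)).
Qed.

Definition side (i : 'I_N) : {set 'I_N} := if i \in A then A else B.

(** A special set has two elements on each side, A or B; s exchanges the two positions on the same
    side. *)
Lemma partner I : special (index_set I) -> exists s : 'S_4, forall a,
  s a != a /\ forall b, (tnth (val I) b \in side (tnth (val I) a)) = (b == a) || (b == s a).
Proof.
move=> sI; have /and3P[/subsetP IAB /eqP IA /eqP IB] := sI.
have ex a : exists b, b != a /\
    forall c, (tnth (val I) c \in side (tnth (val I) a)) = (c == a) || (c == b).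
  set i := tnth (val I) a; have iI : i \in index_set I := index_set_tnth I a.
  have iD : i \in side i.
    by have := IAB i iI; rewrite /side inE; case: ifP.
  have c2 : #|index_set I :&: side i| = 2%N by rewrite /side; case: ifP.
  have c1 : #|(index_set I :&: side i) :\ i| == 1%N.
    by move: c2; rewrite (cardsD1 i) in_setI iI iD add1n => -[->].
  have /cards1P[j jE] := c1.
  have : j \in (index_set I :&: side i) :\ i by rewrite jE inE.
  rewrite in_setD1 in_setI => /andP[ji /andP[]]; rewrite inE => /tnthP[b jb] jD.
  exists b; split=> [|c].
    by apply: contraNneq ji => ba; rewrite jb ba.
  have := congr1 (fun D : {set _} => tnth (val I) c \in D) jE.
  rewrite in_setD1 in_setI index_set_tnth inE jb (inj_eq (@incr_index_inj _ _ I)).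
  rewrite /i (inj_eq (@incr_index_inj _ _ I)) /=.
  by have [->|] := eqVneq c a; [rewrite /= -/i iD|rewrite /= => _ ->].
have [s sP] := choice ex.
have sI' : injective s.
  move=> a b sab; apply/eqP; apply: contraT => ab.
  have [sa Ea] := sP a; have [sb Eb] := sP b.
  have sideE c d : tnth (val I) c \in side (tnth (val I) d) -> side (tnth (val I) c) = side (tnth (val I) d).
    rewrite {1 3}/side; case: ifP => dA cD; first by rewrite /side cD.
    by rewrite /side; case: ifP => // cA; case: (disjointN AB cA cD).
  have E : side (tnth (val I) a) = side (tnth (val I) b).
    rewrite -(sideE (s a) a) ?Ea ?eqxx ?orbT // sab (sideE (s b) b) // Eb eqxx orbT //.
  have := Eb a; rewrite -E Ea eqxx /= (negPf ab) -sab => /esym/eqP asa.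
  by rewrite -asa eqxx in sa.
by exists (perm sI') => a; rewrite permE.
Qed.

Lemma zprod_notin_cideal W T : (forall i, i \in W -> i \notin T) -> zprod W \notin cideal T.
Proof.
move=> WT; apply: prime_ideal_prod; first exact: cideal_prime.
by move=> i iW; rewrite (cideal_Z_iff hZ) WT.
Qed.

(** For an index in A or B this is the partial derivative of h along it; these four elements of J
    are the test functions for the fields. *)
Definition cofactor_fun I (a : 'I_4) : S := zprod (side (tnth (val I) a) :\ tnth (val I) a).

Lemma cofactor_fun_in I a : cofactor_fun I a \in J.
Proof.
apply/JP => T sT; rewrite /cofactor_fun /side; case: ifP => _.
  exact: (zprodA_in_cideal Z _ sT).
exact: (zprodB_in_cideal Z _ sT).
Qed.

(* D_b kills the product over A - a unless b is the second element of T in A (and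
   likewise for B), so this minor is a monomial matrix. *)
Lemma minor_cofactor (D : 'I_N -> S -> S) I :
  (forall j, derivation (D j)) -> (forall i j, D j (Z i) = (i == j)%:R) -> special (index_set I) ->
  \det (\matrix_(a, b) D (tnth (val I) b) (cofactor_fun I a)) \notin cideal (index_set I).
Proof.
move=> hD DZ sI; have [s sP] := partner sI.
pose m a : S := zprod ((side (tnth (val I) a) :\ tnth (val I) a) :\ tnth (val I) (s a)).
have -> : \matrix_(a, b) D (tnth (val I) b) (cofactor_fun I a) =
    diag_mx (\row_a m a) *m perm_mx s.
  apply/matrixP => a b; rewrite mul_diag_mx !mxE (deriv_zprod _ (hD _) (fun i => DZ i _)).
  have [sa Ea] := sP a; rewrite in_setD1 Ea (inj_eq (@incr_index_inj _ _ I)).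
  have [->|ba] /= := eqVneq b a; first by rewrite (negPf sa) mulr0.
  rewrite [s a == b]eq_sym; case: eqP => [->|_]; last by rewrite mulr0.
  by rewrite mulr1.
rewrite det_mulmx det_diag det_perm; apply/negP => H.
have [|] := prime_idealM (cideal_prime hZ _) H.
  apply/negP; apply: prime_ideal_prod; first exact: cideal_prime.
  move=> a _; rewrite mxE; apply: zprod_notin_cideal => i.
  rewrite !in_setD1 => /and3P[isa ia iD]; apply/negP; rewrite inE => /tnthP[b ib].
  have [_ Ea] := sP a; move: iD; rewrite ib Ea => /orP[] /eqP bE.
    by rewrite ib bE eqxx in ia.
  by rewrite ib bE eqxx in isa.
move=> H1; have /negP := prime_ideal1 (cideal_prime hZ (index_set I)); apply.
have -> : 1 = (-1) ^+ s * (-1) ^+ s :> S by rewrite -signr_addb addbb.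
exact: idealMl.
Qed.

(** When the pairing is expanded in the dZ_I, functions in J contribute to the ideal of T only
    through the minor of T itself, the other minors already lying in that prime. For the test
    functions the minor of T lies outside it and can be cancelled. *)
Lemma derlog4P (d : mvfield K N 4) : (d \in @derlog_pred K N 4 J) <->
  forall I, special (index_set I) -> pairing d (dZ Z I) \in cideal (index_set I).
Proof.
have [D [hD DZ [G [_ _ [_ pE]]]]] := dual_derivations hZ.
split=> [/asboolP dJ I sI|dI].
  have fJ a : cofactor_fun I a \in J.
    exact: cofactor_fun_in.
  have fI a : cofactor_fun I a \in cideal (index_set I) by have /JP := fJ a; apply.
  have /JP /(_ _ sI) := dJ _ fJ; rewrite (pairing_expand _ d pE) (bigD1 I) //= => H.
  have : \det (\matrix_(a, b) D (tnth (val I) b) (cofactor_fun I a)) * pairing d (dZ Z I) \in cideal (index_set I).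
    move: H; set X := \det _ * _; set Y := \sum_(i | _) _ => H.
    rewrite -[X](addrK Y); apply: idealB => //.
    apply: ideal_sum => I' II'; rewrite mulrC; apply: idealMl.
    exact: minor_in_cideal.
  move=> /(prime_idealM (cideal_prime hZ _))[|//].
  by rewrite (negPf (minor_cofactor hD DZ sI)).
apply/asboolP => f fJ; apply/JP => T sT; rewrite (pairing_expand _ d pE).
have [I' I'T] := special_index_set sT; rewrite -I'T in sT *.
apply: ideal_sum => I _; have [->|II'] := eqVneq I I'; first by apply/idealMl/dI.
rewrite mulrC; apply/idealMl/minor_in_cideal => //.
by move=> a; have /JP := fJ a; apply.
Qed.

(* The sequence 1, 1, 1, 1, with contractible Koszul complex, gives the summands S
   of the module the same shape as the others. *)
Definition local_gen I (a : 'I_4) : S := if special (index_set I) then Z (tnth (val I) a) else 1.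
Definition local_gens I : seq S :=
  [:: local_gen I (inord 0); local_gen I (inord 1); local_gen I (inord 2); local_gen I (inord 3)].

Lemma lspan_map_Z (s : seq 'I_N) x : lspan [seq Z i | i <- s] x <-> x \in cideal [set i in s].
Proof.
split=> [|xs].
  by apply: lspan_ideal => z /mapP[i si ->]; apply: cideal_Z; rewrite inE.
have cl : submod_closed ([pred x | `[< lspan [seq Z i | i <- s] x >]] : {pred S^o}).
  split=> [|a u v /asboolP ul /asboolP vl]; apply/asboolP; first exact: lspan0.
  by apply: lspanD => //; apply: lspanM.
apply/asboolP; suff : x \in Ideal cl by [].
move: xs; apply: cideal_sub => i; rewrite inE => si.
by apply/asboolP/lspan_mem/map_f.
Qed.

Lemma regular_map_Z (s : seq 'I_N) : uniq s -> regular_seq [seq Z i | i <- s].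
Proof.
elim: s => //= i s IH /andP[si us]; split=> [v|]; last exact: IH.
move=> /lspan_map_Z /(prime_idealM (cideal_prime hZ _))[]; last by move/lspan_map_Z.
by rewrite (cideal_Z_iff hZ) inE (negPf si).
Qed.

Lemma local_gensE I : special (index_set I) -> local_gens I = [seq Z i | i <- val I].
Proof.
move=> sI; rewrite /local_gens /local_gen sI; case: (val I) => -[|a [|b [|c [|d [|e s]]]]] //= sz.
by rewrite !(tnth_nth a) /= !inordK.
Qed.

Lemma local_gensN I : ~~ special (index_set I) -> local_gens I = [:: 1; 1; 1; 1].
Proof. by move=> /negPf sI; rewrite /local_gens /local_gen sI. Qed.

Lemma local_gens_regular I : regular_seq (local_gens I).
Proof.
have [sI|/local_gensN ->] := boolP (special (index_set I)).
  by rewrite (local_gensE sI); apply/regular_map_Z/incr_index_uniq.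
have H l v : lspan (1 :: l) v.
  by exists 0, v; split; [apply: lspan0|rewrite add0r mul1r].
by split=> //; split=> //; split=> //; split=> // v /=; rewrite mul1r.
Qed.

Lemma lspan_local_gens I x : lspan (local_gens I) x <-> (special (index_set I) -> x \in cideal (index_set I)).
Proof.
have [sI|sI] := boolP (special (index_set I)).
  rewrite (local_gensE sI); split=> [/lspan_map_Z//|/(_ isT) xI]; exact/lspan_map_Z.
split=> // _; rewrite (local_gensN sI); exists 0, x; split; first exact: lspan0.
by rewrite add0r mul1r.
Qed.

End SingFree.

Section Resolution.
Variables (K : numFieldType) (N : nat) (Z : 'I_N -> cps N K) (hZ : coordinates Z).
Variables (A B : {set 'I_N}).
Hypotheses (A2 : (1 < #|A|)%N) (B2 : (1 < #|B|)%N) (AB : [disjoint A & B]).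
Local Notation S := (cps N K).
Implicit Types (I : incr_index N 4).
Local Notation cideal := (cideal Z).
Local Notation special := (special A B).
Variable J : ideal S.
Hypothesis JP : forall u, (u \in J) <-> forall T, special T -> u \in cideal T.
Local Notation local_gens := (local_gens Z A B).

(** A Koszul complex resolves the quotient by its ideal. Dropping degree 0, whence the shift by one,
    resolves the ideal itself in length 3, or S for the sequence of ones. *)
Definition derlog_res (i : nat) : lmodType S := {ffun incr_index N 4 -> koszul S 4 i.+1}.

Definition derlog_resd i (x : derlog_res i.+1) : derlog_res i :=
  [ffun I => koszul_d (local_gens I) i.+1 ((x : {ffun incr_index N 4 -> koszul S 4 i.+2}) I)].

Lemma derlog_resd_linear i : linear (@derlog_resd i).
Proof. by move=> a x y; apply/ffunP => I; rewrite !ffunE koszul_d_linear. Qed.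

Lemma derlog_res_projective i : projective (derlog_res i).
Proof. exact/projective_ffun/koszul_projective. Qed.

Lemma derlog_res_trivial i (x : derlog_res i) : (3 < i)%N -> x = 0.
Proof. by move=> i3; apply/ffunP => I; rewrite [RHS]ffunE; apply: koszul_trivial. Qed.

Lemma derlog_resd_exact i (x : derlog_res i.+1) : derlog_resd x = 0 <-> exists y : derlog_res i.+2, derlog_resd y = x.
Proof.
split=> [/ffunP x0|[y <-]]; last first.
  by apply/ffunP => I; rewrite !ffunE koszul_d_comp.
have ex I : exists y : koszul S 4 i.+3, koszul_d (local_gens I) i.+2 y = (x : {ffun incr_index N 4 -> koszul S 4 i.+2}) I.
  apply: (koszul_d_exact (local_gens_regular hZ A B I)).
  by have := x0 I; rewrite !ffunE.
have [y yE] := choice ex; exists ([ffun I => y I] : {ffun _ -> koszul S 4 i.+3}).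
by apply/ffunP => I; rewrite !ffunE yE.
Qed.

Let aug0 (x : derlog_res 0) I : S := koszul_d (local_gens I) 0 ((x : {ffun incr_index N 4 -> koszul S 4 1}) I).

(** In the basis E I the module is the direct sum of the ideals generated by the [local_gens I], the
    images of the first Koszul differentials. *)
Lemma projdim_derlog4_le : exists (eF : {linear derlog_res 0 -> derlog 4 J}),
  (forall y, exists x, eF x = y) /\ (forall x, eF x = 0 <-> exists y, @derlog_resd 0 y = x).
Proof.
have [E [EdZ dE]] := dual_basis hZ 4.
pose ex (c : incr_index N 4 -> S) : mvfield K N 4 := \sum_I (c I : S) *: E I.
have exE c I : pairing (ex c) (dZ Z I) = c I.
  transitivity (\sum_L (c L : S) * pairing (E L) (dZ Z I)).
    rewrite /pairing; under [RHS]eq_bigr => L _ do rewrite mulr_sumr.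
    rewrite [RHS]exchange_big /=; apply: eq_bigr => L _.
    by rewrite sum_ffunE mulr_suml; apply: eq_bigr => L' _; rewrite ffunE -mulrA.
  rewrite (bigD1 I) //= EdZ eqxx mulr1 big1 ?addr0 // => L /negPf LI.
  by rewrite EdZ eq_sym LI mulr0.
have koszul_augE l (v : koszul S 4 0) : koszul_aug v = v :> S by [].
have augP x : ex (aug0 x) \in @derlog_pred K N 4 J.
  apply/(derlog4P hZ AB JP) => I sI; rewrite exE.
  suff /lspan_local_gens : lspan (local_gens I) (aug0 x I) by apply.
  by apply/koszul_d0_image; eexists.
pose e x : derlog 4 J := Derlog (augP x).
have e_lin : linear e.
  move=> a x y; apply: val_inj => /=.
  rewrite scaler_sumr -big_split; apply: eq_bigr => I _ /=.
  rewrite scalerA -scalerDl; congr (_ *: _).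
  by rewrite /aug0 !ffunE koszul_d_linear.
exists (lin_of e_lin); split=> [y|x].
  have exx I : exists u : koszul S 4 1, koszul_d (local_gens I) 0 u = (pairing (val y) (dZ Z I) : S).
    have /(derlog4P hZ AB JP)/(_ I)/lspan_local_gens/koszul_d0_image := valP y.
    by move=> [u uE]; exists u.
  have [u uE] := choice exx; exists ([ffun I => u I] : {ffun _ -> koszul S 4 1}).
  apply: val_inj; rewrite /= [RHS]dE; apply: eq_bigr => I _; congr (_ *: _).
  by rewrite /aug0 ffunE uE.
split=> [ex0|[y <-]]; last first.
  apply: val_inj; rewrite /= /ex big1 // => I _.
  by rewrite /aug0 ffunE koszul_d_comp scale0r.
have exI I : exists y : koszul S 4 2, koszul_d (local_gens I) 1 y = (x : {ffun incr_index N 4 -> koszul S 4 1}) I.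
  apply: (koszul_d_exact (local_gens_regular hZ A B I)).
  by rewrite -[LHS]/(aug0 x I) -exE (_ : ex _ = 0) ?[pairing _ _]big1 // => [L _|];
    [rewrite ffunE mul0r|exact: (congr1 val ex0)].
have [y yE] := choice exI; exists ([ffun I => y I] : {ffun _ -> koszul S 4 2}).
by apply/ffunP => I; rewrite !ffunE yE.
Qed.

Theorem projdim_derlog4 : projdim (derlog 4 J) 3.
Proof.
have [eF [eFsurj eFker]] := projdim_derlog4_le.
pose dF i := lin_of (@derlog_resd_linear i).
split.
  exists derlog_res, eF, dF; split=> //; first exact: derlog_res_projective.
  - by move=> i i3 x; apply: derlog_res_trivial.
  - by move=> i x; apply: derlog_resd_exact.
move=> d d3 [P [eP [dP [Pproj P0 ePsurj ePker dPker]]]].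
have pd2 : projdim_le (derlog 4 J) 2.
  by exists P, eP, dP; split=> // i i2; apply: P0; apply: leq_trans i2; rewrite ltnS in d3.
have [s sE] := projdim2_contraction (dF := dF) derlog_res_projective eFsurj eFker
  (fun i x => derlog_resd_exact x) (fun x => derlog_res_trivial x isT) pd2.
have [T sT] := exists_special A2 B2 AB; have [I IT] := special_index_set AB sT.
have [t [f [f_lin ft]]] := koszul_top S 4.
pose single i (v : koszul S 4 i.+1) : derlog_res i :=
  [ffun L => if L == I then v else 0] : {ffun incr_index N 4 -> koszul S 4 i.+1}.
have single_lin i : linear (@single i).
  move=> a x y; apply/ffunP => L; rewrite !ffunE; case: eqP => // _.
  by rewrite scaler0 addr0.
(* The retraction s, restricted to one special summand and read on the generator t of the top term,
   is a linear form of value 1 on the boundary of t. By minimality its values there lie in a proper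
   ideal. *)
pose g (v : koszul S 4 3) : S^o := f ((s (@single 2 v) : {ffun incr_index N 4 -> koszul S 4 4}) I).
have g_lin : linear g.
  by move=> a x y; rewrite /g single_lin linearP -f_lin; congr f; rewrite !ffunE.
have : lspan (local_gens I) (g (koszul_d (local_gens I) 3 t)) by apply: linear_koszul_d.
have -> : g (koszul_d (local_gens I) 3 t) = 1.
  have E : dF 2 (@single 3 t) = @single 2 (koszul_d (local_gens I) 3 t).
    apply/ffunP => L; rewrite !ffunE; case: eqP => [->//|_].
    exact: (linear0 (lin_of (@koszul_d_linear S (local_gens L) 3))).
  by rewrite /g -E sE ffunE eqxx.
move=> /lspan_local_gens; rewrite IT => /(_ sT).
by apply/negP/prime_ideal1/cideal_prime.
Qed.

End Resolution.

Section SingBinomialFree.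
Variables (K : numFieldType) (N : nat) (Z : 'I_N -> cps N K) (hZ : coordinates Z).
Variables (A B : {set 'I_N}).
Hypotheses (A2 : (1 < #|A|)%N) (B2 : (1 < #|B|)%N) (AB : [disjoint A & B]).

Theorem sing_binomial_free : free_germ (sing 1 (principal (zprod2 Z A B))).
Proof.
exists 4%N => //; split; first exact: reduced_equidim_sing.
exact: (projdim_derlog4 hZ A2 B2 AB (singP hZ A2 B2 AB)).
Qed.

End SingBinomialFree.

(** * Reduction to the binomial normal form *)

Section Embedding.
Variables (K : numFieldType) (n N : nat) (e : 'I_n -> 'I_N) (eI : injective e).
Implicit Types f g : cps n K.

Lemma cps_embedE f a : cps_embed eI f a =
  if [forall j, (j \notin codom e) ==> (a j == 0%N)] then f [multinom a (e i) | i < n] else 0.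
Proof. by []. Qed.

(** As a substitution, the renaming of variables is a ring morphism. *)
Lemma cps_embed_csubst f : cps_embed eI f = csubst (fun i => X_ K (e i)) f.
Proof.
pose push (k : 'X_{1..n}) : 'X_{1..N} := (\sum_i U_(e i) *+ k i)%MM.
have pushE k i : push k (e i) = k i.
  rewrite mnm_sumE (bigD1 i) //= mulmnE mnm1E eqxx mul1n big1 ?addn0 // => j /negPf ji.
  by rewrite mulmnE mnm1E (inj_eq eI) ji.
have pushN k j : j \notin codom e -> push k j = 0%N.
  move=> je; rewrite mnm_sumE big1 // => i _; rewrite mulmnE mnm1E.
  by case: eqP => // ij; rewrite -ij codom_f in je.
have powE k : zpow (fun i => X_ K (e i)) k = monom 1 (push k).
  rewrite /zpow; under eq_bigr => i _ do rewrite centreK ?X_0 // monomX expr1n.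
  by rewrite prod_monom big1_eq.
apply: cpsP => a; rewrite cps_embedE (csubstE _ _ (ltnSn (mdeg a))).
case: ifPn => [/forallP a0|aN]; last first.
  rewrite big1 // => k _; rewrite powE coef_monom; case: eqP => [ak|_]; last by rewrite mulr0.
  case/negP: aN; apply/forallP => j; apply/implyP => je.
  by rewrite ak pushN.
set k0 := [multinom _ | _ < _].
have ak0 : a = push k0.
  apply/mnmP => j; have [/codomP[i ->]|je] := boolP (j \in codom e).
    by rewrite pushE mnmE.
  by rewrite pushN //; have := a0 j; rewrite je => /eqP.
have k0a : (mdeg k0 < (mdeg a).+1)%N.
  rewrite ltnS ak0 mdeg_sum mdegE; apply: leq_sum => i _.
  by rewrite mdegMn mdeg1 mul1n.
rewrite (bigD1 (BMultinom k0a)) //= powE coef_monom -ak0 eqxx mulr1 big1 ?addr0 // => k.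
rewrite bmeqP /= powE coef_monom => kk0.
case: eqP => [ak|]; last by rewrite mulr0.
case/eqP: kk0; apply/mnmP => i; rewrite -(pushE k i) -ak.
by rewrite [in LHS]ak0 pushE.
Qed.

Lemma cps_embed_prod (I : Type) (r : seq I) (P : pred I) (F : I -> cps n K) :
  cps_embed eI (\prod_(i <- r | P i) F i) = \prod_(i <- r | P i) cps_embed eI (F i).
Proof.
rewrite cps_embed_csubst rmorph_prod; apply: eq_bigr => i _ /=.
by rewrite cps_embed_csubst.
Qed.

Lemma cps_embed_0 f : cps_embed eI f 0%MM = f 0%MM.
Proof. by rewrite cps_embed_csubst csubst_0E. Qed.

Lemma cps_embed_linear f i : cps_embed eI f U_(e i)%MM = f U_(i)%MM.
Proof.
rewrite cps_embedE ifT; first by congr (fps_coef _ _); apply/mnmP => j; rewrite !mnmE (inj_eq eI).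
apply/forallP => j; apply/implyP => je; rewrite mnm1E.
suff /negPf -> : e i != j by [].
by apply: contraNneq je => <-; apply: codom_f.
Qed.

Lemma cps_embed_linearN f j : j \notin codom e -> cps_embed eI f U_(j)%MM = 0.
Proof.
move=> je; rewrite cps_embedE ifF //; apply/negbTE; rewrite negb_forall.
by apply/existsP; exists j; rewrite je mnm1E eqxx.
Qed.

End Embedding.

Section NormalForm.
Variables (K : numFieldType) (n : nat).
Local Notation S := (cps n K).

(** Since z_a vanishes at 0, the linear part of u z_a is u(0) times that of z_a: the jacobian has
    one row rescaled. *)
Lemma coordinates_mul_unit (z : 'I_n -> S) (u : S) (a : 'I_n) : coordinates z -> u 0%MM != 0 ->
  coordinates (fun i => if i == a then u * z i else z i).
Proof.
move=> hz u0; have [z0 Jz] := coordinates_jacobian0 hz.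
apply: jacobian0_coordinates => [i|].
  by case: eqP => _ //; rewrite cpsM0E z0 mulr0.
have lin j : (u * z a) U_(j)%MM = u 0%MM * z a U_(j)%MM.
  have := congr1 (fun f : S => f 0%MM) (pderivM j u (z a)).
  by rewrite cpsDE !cpsM0E z0 mulr0 add0r !coef_pderiv add0m mnm0E.
have -> : jacobian0 (fun i => if i == a then u * z i else z i) =
    diag_mx (\row_i if i == a then u 0%MM else 1) *m jacobian0 z.
  apply/matrixP => i j; rewrite mul_diag_mx !mxE; case: eqP => [->|_]; first exact: lin.
  by rewrite mul1r.
rewrite unitmx_mul Jz andbT unitmxE det_diag unitfE.
apply/prodf_neq0 => i _; rewrite mxE; case: ifP => _ //; exact: oner_neq0.
Qed.

(** The ideal of f + g depends on f and g and not only on their ideals, so f must equal a product of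
    coordinates exactly; the unit relating the two generators is absorbed into one coordinate. *)
Lemma normal_crossing_prod (f : S) : nonsmooth_normal_crossing f ->
  exists (z : 'I_n -> S) (D : {set 'I_n}),
    [/\ coordinates z, (1 < #|D|)%N & f = \prod_(i in D) z i].
Proof.
move=> [p p2 [/andP[_ pn] [z hz fz]]].
pose D := [set i : 'I_n | (i < p)%N].
have cD : #|D| = p.
  have wI : injective (widen_ord pn) by move=> i j /(congr1 val) /= ij; apply/val_inj.
  rewrite -[RHS]card_ord -(card_imset _ wI); apply: eq_card => i.
  rewrite inE; apply/idP/imsetP => [ip|[j _ ->]]; last exact: (ltn_ord j).
  by exists (Ordinal ip) => //; apply/val_inj.
set P := \prod_(i < n | (i < p)%N) z i in fz.
have PE : P = \prod_(i in D) z i by apply: eq_bigl => i; rewrite inE.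
have [u fu] : exists u, f = u * P.
  by apply/principalP; rewrite -fz; apply: mem_ideal_gen.
have [v Pv] : exists v, P = v * f.
  by apply/principalP; rewrite fz; apply: mem_ideal_gen.
have P0 : P != 0 by rewrite PE; apply: cps_prod_neq0 => i _; apply: Z_neq0.
have u0 : u 0%MM != 0.
  have uv : u * v = 1.
    by apply: (cps_mulI P0); rewrite mulr1 {2}Pv fu; ring.
  have := congr1 (fun f : S => f 0%MM) uv; rewrite cpsM0E cps1E eqxx => uv0.
  by apply: contra_eq_neq uv0 => ->; rewrite mul0r eq_sym oner_neq0.
have [a aD] : exists a, a \in D by apply/card_gt0P; rewrite cD ltnW.
exists (fun i => if i == a then u * z i else z i), D; split.
- exact: coordinates_mul_unit.
- by rewrite cD.
rewrite fu PE (big_setD1 a aD) [RHS](big_setD1 a aD) /= eqxx mulrA; congr (_ * _).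
by apply: eq_bigr => i; rewrite in_setD1 => /andP[/negPf ->].
Qed.

End NormalForm.

Section JoinCoordinates.
Variables (K : numFieldType) (n m : nat).
Variables (z : 'I_n -> cps n K) (w : 'I_m -> cps m K).

Definition join_coordinates (i : 'I_(n + m)) : cps (n + m) K :=
  match split i with
  | inl j => cps_embed (@lshift_inj n m) (z j)
  | inr j => cps_embed (@rshift_inj n m) (w j)
  end.

Lemma join_coordinates_l j : join_coordinates (lshift m j) = cps_embed (@lshift_inj n m) (z j).
Proof. by rewrite /join_coordinates (unsplitK (inl j)). Qed.

Lemma join_coordinates_r j : join_coordinates (rshift n j) = cps_embed (@rshift_inj n m) (w j).
Proof. by rewrite /join_coordinates (unsplitK (inr j)). Qed.

Lemma lshift_notin_codom j : lshift m j \notin codom (@rshift n m).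
Proof. by apply/codomP => -[i /eqP]; rewrite eq_lrshift. Qed.

Lemma rshift_notin_codom j : rshift n j \notin codom (@lshift n m).
Proof. by apply/codomP => -[i /eqP]; rewrite eq_rlshift. Qed.

Lemma join_coordinatesP : coordinates z -> coordinates w -> coordinates join_coordinates.
Proof.
move=> /coordinates_jacobian0[z0 Jz] /coordinates_jacobian0[w0 Jw].
apply: jacobian0_coordinates => [i|].
  by rewrite /join_coordinates; case: split => j; rewrite cps_embed_0.
have -> : jacobian0 join_coordinates = block_mx (jacobian0 z) 0 0 (jacobian0 w).
  apply/matrixP => i j; rewrite -(splitK i) -(splitK j) mxE.
  case: (split i) (split j) => i' [] j' /=.
  - by rewrite join_coordinates_l block_mxEul mxE; apply: cps_embed_linear.
  - rewrite join_coordinates_l block_mxEur mxE; apply: cps_embed_linearN.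
    exact: rshift_notin_codom.
  - rewrite join_coordinates_r block_mxEdl mxE; apply: cps_embed_linearN.
    exact: lshift_notin_codom.
  - by rewrite join_coordinates_r block_mxEdr mxE; apply: cps_embed_linear.
by move: Jz Jw; rewrite !unitmxE det_lblock unitrM => -> ->.
Qed.

End JoinCoordinates.

(** The first conjunct makes sure that the failure of freeness concerns the projective dimension and
    not the requirement in [free_germ] that the germ be reduced and equidimensional. *)
Theorem lemma2p13 (R : realType) (n m : nat)
    (f : cps n R[i]) (g : cps m R[i])
    (f_nc : nonsmooth_normal_crossing f) (g_nc : nonsmooth_normal_crossing g) :
  let X : ideal (cps (n + m) R[i]) :=
    principal (cps_embed (@lshift_inj n m) f + cps_embed (@rshift_inj n m) g) in
  [/\ reduced_equidim X 1, ~ free_germ X & free_germ (sing 1 X)].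
Proof.
have [z [A [hz A2 fE]]] := normal_crossing_prod f_nc.
have [w [B [hw B2 gE]]] := normal_crossing_prod g_nc.
pose Z := join_coordinates z w.
have hZ : coordinates Z by apply: join_coordinatesP.
pose A' := [set lshift m i | i in A]; pose B' := [set rshift n j | j in B].
have A'2 : (1 < #|A'|)%N by rewrite card_imset //; apply: lshift_inj.
have B'2 : (1 < #|B'|)%N by rewrite card_imset //; apply: rshift_inj.
have AB : [disjoint A' & B'].
  apply/pred0P => i /=; apply/negP => /andP[/imsetP[j _ ->] /imsetP[k _ /eqP]].
  by rewrite eq_lrshift.
have -> : cps_embed (@lshift_inj n m) f + cps_embed (@rshift_inj n m) g = zprod2 Z A' B'.
  rewrite fE gE !cps_embed_prod /zprod2 /zprod; congr (_ + _).
    rewrite big_imset => [|i j _ _]; last exact: lshift_inj.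
    by apply: eq_bigr => i _; rewrite /Z join_coordinates_l.
  rewrite big_imset => [|i j _ _]; last exact: rshift_inj.
  by apply: eq_bigr => i _; rewrite /Z join_coordinates_r.
split.
- exact: reduced_equidim_binomial.
- exact: binomial_not_free.
- exact: sing_binomial_free.
Qed.
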